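(* Let $N\ge2$, let $\mathcal{X}_1,\dots,\mathcal{X}_N\subset\mathbb{R}^d$ be compact convex sets and $\mathcal{X}=\prod_{i=1}^N\mathcal{X}_i$. Let $\boldsymbol{\mu}^0,\boldsymbol{\mu}^1\in\prod_{i=1}^N\mathcal{P}(\mathcal{X}_i)$, let $\gamma=(\gamma_i)_{i=1}^N$ where $\gamma_i\in\mathcal{P}(\mathcal{X}_i\times\mathcal{X}_i)$ has marginals $\mu_i^0$ and $\mu_i^1$ (not necessarily optimal), and for $t\in[0,1]$ let $\boldsymbol{\mu}^t=(\mu_i^t)_{i=1}^N$ with $\mu_i^t=((1-t)\pi^1+t\pi^2)_\#\gamma_i$, where $\pi^1,\pi^2$ are the projections of $\mathcal{X}_i\times\mathcal{X}_i$ on the first and second factor. If $c\in\mathcal{C}^{2k-1}(\mathcal{X})$ for some integer $k\ge1$, then the function $t\mapsto E(\boldsymbol{\mu}^t)$ is of class $\mathcal{C}^k$ on $[0,1]$. Moreover, if $c\in\mathcal{C}^2(\mathcal{X})$ then its derivative is $C\,\mathrm{cost}(\gamma)$-Lipschitz, for some $C>0$ that only depends on $N$ and $\Vert c\Vert_{\mathcal{C}^2}$, where $\mathrm{cost}(\gamma)=\sum_{i=1}^N\int_{\mathcal{X}_i\times\mathcal{X}_i}\Vert y_i-x_i\Vert^2d\gamma_i(x_i,y_i)$. In particular both $E$ and $-E$ are $(-C)$-displacement convex.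
   Context: $\mathcal{P}(K)$ denotes Borel probability measures on $K$. For compact convex $K\subset\mathbb{R}^m$, $\mathcal{C}^k(K)$ is the Banach space of functions on $K$ admitting a $\mathcal{C}^k$ extension to $\mathbb{R}^m$, with norm $\Vert f\Vert_{\mathcal{C}^k}=\inf_{\tilde f}\sup_{|\alpha|\le k}\Vert\partial^\alpha\tilde f\Vert_\infty$ over such extensions. Multi-marginal entropic optimal transport: $E(\boldsymbol{\mu})=\min_{\sigma\in\Pi(\boldsymbol{\mu})}\int_{\mathcal{X}}c\,d\sigma+H(\sigma|\otimes_{i=1}^N\mu_i)$, where $\Pi(\boldsymbol{\mu})$ is the set of probability measures on $\mathcal{X}$ with marginals $\mu_1,\dots,\mu_N$ and $H(\sigma|\rho)=\int\log(d\sigma/d\rho)\,d\sigma$ if $\sigma\ll\rho$ and $+\infty$ otherwise. $W_2$ is the $L^2$-Wasserstein distance (Euclidean ground cost) and $\boldsymbol{W_2}(\boldsymbol{\mu},\boldsymbol{\nu})=\big(\sum_{i=1}^NW_2(\mu_i,\nu_i)^2\big)^{1/2}$. For $\lambda\in\mathbb{R}$, a functional $J$ on $\prod_i\mathcal{P}(\mathcal{X}_i)$ is $\lambda$-displacement convex if for all $\boldsymbol{\mu}^0,\boldsymbol{\mu}^1$, all $W_2$-optimal plans $\gamma_i$ between $\mu_i^0$ and $\mu_i^1$ with associated $\boldsymbol{\mu}^t$ (defined by $\mu_i^t=((1-t)\pi^1+t\pi^2)_\#\gamma_i$), and all $t\in[0,1]$, $J(\boldsymbol{\mu}^t)\le(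1-t)J(\boldsymbol{\mu}^0)+tJ(\boldsymbol{\mu}^1)-\frac{\lambda}{2}t(1-t)\boldsymbol{W_2}(\boldsymbol{\mu}^0,\boldsymbol{\mu}^1)^2$.
   Formalization: The constant C is allowed to depend also on the dimension d; with the stated coordinatewise C^2 norm no C depending only on N and the norm of c can serve all d (take c(x)=cos of the sum of the coordinates of x_1 and Dirac masses at 0 and s(1,...,1)). *)

(* Defs.v *)
From HB Require Import structures.
From mathcomp Require Import all_boot all_order all_algebra.
From mathcomp Require Import all_classical all_reals all_analysis.
From mathcomp Require Import measurable_realfun.

Set Implicit Arguments.
Unset Strict Implicit.
Unset Printing Implicit Defensive.

Import Order.TTheory GRing.Theory Num.Theory.
Import numFieldNormedType.Exports.

Local Open Scope classical_set_scope.
Local Open Scope ring_scope.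

(* R^d is 'rV[R]_d, and (R^d)^N is 'M[R]_(N, d), the i-th point being the
   i-th row.  Both carry the Borel sigma-algebra of their topology.
   The library's norm `| x | on matrices is the sup norm; the Euclidean norm
   is enorm below. *)
Section borel_matrix.
Context {R : realType} {m n : nat}.

HB.instance Definition _ := @isMeasurable.Build
  (sigma_display (@open 'M[R]_(m, n))) 'M[R]_(m, n) <<s @open 'M[R]_(m, n) >>
  (@sigma_algebra0 _ setT _) (@sigma_algebraC _ _) (@sigma_algebra_bigcup _ setT _).

Lemma open_measurable_mx (A : set 'M[R]_(m, n)) : open A -> measurable A.
Proof. exact: sub_sigma_algebra. Qed.

Lemma open_mx_bigcup (A : set 'M[R]_(m, n)) : open A ->
  A = \bigcup_(q in [set q : 'M[rat]_(m, n) * nat |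
        ball (map_mx ratr q.1 : 'M[R]_(m, n)) q.2.+1%:R^-1 `<=` A])
      ball (map_mx ratr q.1 : 'M[R]_(m, n)) q.2.+1%:R^-1.
Proof.
move=> oA; apply/seteqP; split=> [x Ax|x [q qA /qA]//].
have /nbhs_ballP[e /= e0 xeA] : nbhs x A by exact: open_nbhs_nbhs.
have [k ke] : exists k : nat, k.+1%:R^-1 < e / 2.
  have /ltr_add_invr[k] : 0 < e / 2 by rewrite divr_gt0.
  by rewrite add0r => ?; exists k.
have k0 : 0 < k.+1%:R^-1 :> R by rewrite invr_gt0.
have hq i j : {q : rat | ball (x i j) k.+1%:R^-1 (ratr q)}.
  apply: cid.
  have [r [xr [q _ qr]]] : ball (x i j) k.+1%:R^-1 `&` (@ratr R @` setT) !=set0.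
    apply: dense_rat; last exact: ball_open.
    by exists (x i j); exact: ballxx.
  by exists q; rewrite qr.
pose Q := \matrix_(i, j) sval (hq i j).
have Qx : ball (map_mx ratr Q : 'M[R]_(m, n)) k.+1%:R^-1 x.
  split => // i j; rewrite !mxE; apply: ball_sym; exact: svalP (hq i j).
exists (Q, k) => //= y Qy; apply: xeA.
have := ball_triangle (ball_sym Qx) Qy; apply: le_ball.
by rewrite [leRHS]splitr ltW// ltrD.
Qed.

Lemma continuous_measurable_mx (f : 'M[R]_(m, n) -> R) :
  continuous f -> measurable_fun setT f.
Proof.
move=> /continuousP cf; apply: (measurability _ (RGenOpens.measurableE R)).
move=> _ [_ [a [b ->] <-]]; rewrite setTI; apply: open_measurable_mx.
exact/cf/interval_open.
Qed.

Lemma measurable_coord (i : 'I_m) (j : 'I_n) :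
  measurable_fun setT (fun x : 'M[R]_(m, n) => x i j).
Proof. exact: (continuous_measurable_mx (@coord_continuous _ _ _ i j)). Qed.

Lemma measurable_fun_mx d (T : measurableType d) (f : T -> 'M[R]_(m, n)) :
  (forall i j, measurable_fun setT (fun x => f x i j)) -> measurable_fun setT f.
Proof.
move=> mf; apply: (@measurability _ _ _ _ _ _ (@open 'M[R]_(m, n))) => //.
move=> _ [A oA <-]; rewrite setTI (open_mx_bigcup oA) preimage_bigcup.
rewrite bigcup_mkcond; apply: countable_bigcupT_measurable => // -[Q k].
case: ifP => // _ /=.
rewrite (_ : _ @^-1` _ = \bigcap_(ij in [set: 'I_m * 'I_n])
    ((fun x => f x ij.1 ij.2) @^-1` ball (ratr (Q ij.1 ij.2) : R) k.+1%:R^-1)).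
  apply: fin_bigcap_measurable => // ij _.
  by rewrite -[X in measurable X]setTI; apply: mf => //; exact: measurable_ball.
apply/seteqP; split=> [x [_ /= h] [i j] _|x h] /=.
  by have := h i j; rewrite mxE.
split=> [|i j]; first by rewrite invr_gt0.
by rewrite mxE; exact: (h (i, j)).
Qed.

End borel_matrix.

Section couplings.
Context {R : realType} {d1 d2 : measure_display}
  {T1 : measurableType d1} {T2 : measurableType d2}.

(* Borel probabilities on K are taken to be the probabilities on the ambient
   space with full mass on K. *)
Definition prob_on d (T : measurableType d) (K : set T) (mu : probability T R) :=
  mu K = 1%E.

Definition coupling (mu : probability T1 R) (nu : probability T2 R) :
    set (probability (T1 * T2)%type R) :=
  [set g | (forall A, measurable A -> pushforward g fst A = mu A) /\
           (forall B, measurable B -> pushforward g snd B = nu B)].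

End couplings.

Section product_measure.
Context {R : realType} {d : nat}.

Definition cons_row n (p : 'rV[R]_d * 'M[R]_(n, d)) : 'M[R]_(n.+1, d) :=
  col_mx p.1 p.2 : 'M[R]_(1 + n, d).

Lemma row0_cons_row n x (y : 'M[R]_(n, d)) : row ord0 (cons_row (x, y)) = x.
Proof.
rewrite /cons_row (_ : ord0 = lshift n (ord0 : 'I_1)); last exact/val_inj.
by rewrite (@rowKu _ 1 n d ord0 x y) row_id.
Qed.

Lemma rowS_cons_row n i x (y : 'M[R]_(n, d)) :
  row (lift ord0 i) (cons_row (x, y)) = row i y.
Proof.
rewrite /cons_row (_ : lift ord0 i = rshift 1 i); last exact/val_inj.
exact: (@rowKd _ 1 n d i x y).
Qed.

Lemma measurable_cons_row n : measurable_fun setT (@cons_row n).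
Proof.
apply: measurable_fun_mx => i j.
rewrite (_ : (fun _ => _) =
    (fun p : 'rV[R]_d * 'M[R]_(n, d) =>
      match @fintype.split 1 n i with inl k => p.1 k j | inr k => p.2 k j end)).
  case: (@fintype.split 1 n i) => k.
    by apply: (measurableT_comp (measurable_coord k j)); exact: measurable_fst.
  by apply: (measurableT_comp (measurable_coord k j)); exact: measurable_snd.
by apply/funext => p; rewrite [LHS]mxE.
Qed.

HB.instance Definition _ n :=
  isMeasurableFun.Build _ _ _ _ (@cons_row n) (@measurable_cons_row n).

Fixpoint prod_measure n : ('I_n -> probability 'rV[R]_d R) ->
    probability 'M[R]_(n, d) R :=
  match n with
  | 0 => fun _ => \d_(0 : 'M[R]_(0, d))
  | n'.+1 => fun mu =>
      distribution (mu ord0 \x prod_measure (fun i => mu (lift ord0 i)))%E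
        (@cons_row n')
  end.

Lemma measurable_row n (i : 'I_n) :
  measurable_fun setT (row i : 'M[R]_(n, d) -> 'rV[R]_d).
Proof.
apply: measurable_fun_mx => k j.
by under eq_fun do rewrite mxE; exact: measurable_coord.
Qed.

Lemma measurable_box n (A : 'I_n -> set 'rV[R]_d) :
  (forall i, measurable (A i)) ->
  measurable [set x : 'M[R]_(n, d) | forall i, A i (row i x)].
Proof.
move=> mA; rewrite (_ : [set _ | _] =
    \bigcap_(i in [set: 'I_n]) (row i : 'M[R]_(n, d) -> 'rV[R]_d) @^-1` A i).
  apply: fin_bigcap_measurable => // i _.
  by rewrite -[X in measurable X]setTI; exact: (@measurable_row n i measurableT).
by apply/seteqP; split=> [x h i _|x h i]; exact: h.
Qed.

Lemma prod_measureE n (mu : 'I_n -> probability 'rV[R]_d R)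
    (A : 'I_n -> set 'rV[R]_d) : (forall i, measurable (A i)) ->
  prod_measure mu [set x | forall i, A i (row i x)] = (\prod_i mu i (A i))%E.
Proof.
elim: n mu A => [|n IH] mu A mA /=.
  by rewrite big_ord0 diracE mem_set// => -[].
rewrite big_ord_recl -IH// -product_measure1E//; last first.
  exact: (@measurable_box n (fun i => A (lift ord0 i))).
rewrite /distribution /pushforward; congr ((_ \x _)%E _).
apply/seteqP; split=> -[x y] /= => [h|[hx hy] i].
  by split=> [|i]; [rewrite -(row0_cons_row x y)|rewrite -(rowS_cons_row i x y)].
by have [j|] := unliftP ord0 i => ->; rewrite (row0_cons_row, rowS_cons_row).
Qed.

End product_measure.

Section smoothness.
Context {R : realType}.

Definition Ck_line (k : nat) (f : R -> R) :=
  (forall j, (j < k)%N -> forall x, derivable (derive1n j f) x 1) /\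
  (forall j, (j <= k)%N -> continuous (derive1n j f)).

Context {m n : nat}.
Implicit Types (F c : 'M[R]_(m, n) -> R) (K : set 'M[R]_(m, n)).

(* Iterated partial derivatives of order size s.  A multi-index is the list
   of the differentiation directions; for functions of class C^k with
   size s <= k the order of the list is irrelevant. *)
Definition dpartial (s : seq ('I_m * 'I_n)) F : 'M[R]_(m, n) -> R :=
  foldr (fun ij G => 'D_(delta_mx ij.1 ij.2) G) F s.

Definition Ck (k : nat) F :=
  (forall s ij, (size s < k)%N ->
     forall x, derivable (dpartial s F) x (delta_mx ij.1 ij.2)) /\
  (forall s, (size s <= k)%N -> continuous (dpartial s F)).

Definition Ck_ext (k : nat) K c : set ('M[R]_(m, n) -> R) :=
  [set F | Ck k F /\ forall x, K x -> F x = c x].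

Definition Ck_on (k : nat) K c := Ck_ext k K c !=set0.

(* This infimum is finite whenever K is compact and Ck_on k K c. *)
Definition Ck_norm (k : nat) K c : R :=
  fine (ereal_inf [set ereal_sup [set `|dpartial s F x|%:E |
          s in [set s | (size s <= k)%N] & x in setT] | F in Ck_ext k K c]).

End smoothness.

Section entropic_transport.
Context {R : realType}.
Local Open Scope ereal_scope.
Local Open Scope charge_scope.

(* lne is the extended logarithm (-oo at 0), and 'd s '/d r > 0 s-almost
   everywhere. *)
Definition rel_entropy d (T : measurableType d) (s r : probability T R) : \bar R :=
  if `[< s `<< r >] then \int[s]_x lne ('d (charge_of_finite_measure s) '/d r x) else +oo.

Context {N d : nat}.
Implicit Types (X : 'I_N -> set 'rV[R]_d) (mu : 'I_N -> probability 'rV[R]_d R).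

Definition prodset X : set 'M[R]_(N, d) := [set x | forall i, X i (row i x)].

Definition multi_coupling X mu : set (probability 'M[R]_(N, d) R) :=
  [set s | prob_on (prodset X) s /\
           forall i A, measurable A -> pushforward s (row i) A = mu i A].

(* The minimum over couplings, written as an infimum. *)
Definition eot X (c : 'M[R]_(N, d) -> R) mu : \bar R :=
  ereal_inf [set \int[s]_(x in prodset X) (c x)%:E
                 + rel_entropy s (prod_measure mu) | s in multi_coupling X mu].

End entropic_transport.

Section displacement.
Context {R : realType} {d : nat}.

Definition enorm (x : 'rV[R]_d) : R := Num.sqrt (\sum_j x ord0 j ^+ 2).

Definition quad_cost (g : probability ('rV[R]_d * 'rV[R]_d)%type R) : \bar R :=
  (\int[g]_p (enorm (p.2 - p.1) ^+ 2)%:E)%E.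

(* The infimum is finite for measures with finite second moments, in
   particular for measures carried by compact sets. *)
Definition W2 (mu nu : probability 'rV[R]_d R) : R :=
  Num.sqrt (fine (ereal_inf [set quad_cost g | g in coupling mu nu])).

Definition optimal_plan (mu nu : probability 'rV[R]_d R) g :=
  coupling mu nu g /\
  forall g', coupling mu nu g' -> (quad_cost g <= quad_cost g')%E.

Definition interp (t : R) (p : 'rV[R]_d * 'rV[R]_d) : 'rV[R]_d :=
  (1 - t) *: p.1 + t *: p.2.

Lemma measurable_interp t : measurable_fun setT (interp t).
Proof.
apply: measurable_fun_mx => i j; rewrite /interp.
under eq_fun do rewrite !mxE.
apply: measurable_funD; apply: measurable_funM => //.
  by apply: (measurableT_comp (measurable_coord i j)); exact: measurable_fst.
by apply: (measurableT_comp (measurable_coord i j)); exact: measurable_snd.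
Qed.

HB.instance Definition _ t :=
  isMeasurableFun.Build _ _ _ _ (interp t) (@measurable_interp t).

Context {N : nat}.
Implicit Types (mu nu : 'I_N -> probability 'rV[R]_d R).
Implicit Types (g : 'I_N -> probability ('rV[R]_d * 'rV[R]_d)%type R).

Definition mu_t g (t : R) : 'I_N -> probability 'rV[R]_d R :=
  fun i => distribution (g i) (interp t).

Definition plan_cost g : \bar R := (\sum_i quad_cost (g i))%E.

Definition W2N mu nu : R := Num.sqrt (\sum_i W2 (mu i) (nu i) ^+ 2).

Definition displacement_convex (X : 'I_N -> set 'rV[R]_d) (lambda : R)
    (J : ('I_N -> probability 'rV[R]_d R) -> \bar R) :=
  forall mu0 mu1 g,
    (forall i, prob_on (X i) (mu0 i)) -> (forall i, prob_on (X i) (mu1 i)) ->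
    (forall i, optimal_plan (mu0 i) (mu1 i) (g i)) ->
    forall t : R, 0 <= t <= 1 ->
    (J (mu_t g t) <= (1 - t)%:E * J mu0 + t%:E * J mu1
       - (lambda / 2 * t * (1 - t) * W2N mu0 mu1 ^+ 2)%:E)%E.

End displacement.

(* Main.v *)
Require Import Defs.
From HB Require Import structures.
From mathcomp Require Import all_boot all_order all_algebra.
From mathcomp Require Import all_classical all_reals all_analysis.
From mathcomp Require Import measurable_realfun ring lra.

Set Implicit Arguments.
Unset Strict Implicit.
Unset Printing Implicit Defensive.

Import Order.TTheory GRing.Theory Num.Theory.
Import numFieldNormedType.Exports.

Local Open Scope classical_set_scope.
Local Open Scope ring_scope.

(** The marginals depend on time through maps applied to a fixed plan: [mu_i^t]
is the image of [gamma_i] under [(x, y) |-> (1 - t) x + t y].  So all the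
problems can be pulled back to the fixed product measure [P] of the plans, on
the space of pairs of configurations, where only the cost varies, namely
[c_t (x, y) = c ((1 - t) x + t y)], and it is as smooth in [t] as [c] is.

For a fixed cost, entropic transport is dual to the Schroedinger system: find
[S], a sum of functions of one coordinate each, such that the density
[exp (S - c)] has all its conditional means equal to 1.  By Gibbs' inequality
the value of the problem is then the mean of [S] ([eot_potential]), and pulling
back to [P] changes neither the system nor the value ([eot_transported]).

The system is solved by relaxation ([relaxation_zero], [potential_exists]).  As
[S - c] stays bounded, the equation is strongly monotone for the mean square
norm on additive functions, which gives geometric convergence in that norm.
Conditional means average over the other coordinates and turn mean square
control into sup control ([cmean_decorrelate]), so convergence is uniform.  The
same two estimates invert the linearised system with a bound in the sup norm
([weighted_solve], [weighted_stability]).  Since the derivative of the potential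
in time solves that system, with weight [exp (S - c_t)], the smoothness of the
potential is bootstrapped up to that of the curve of costs ([potential_curve]);
the value, a mean, follows.

For the quantitative statements, the inequality [exp a >= exp b + exp b (a - b)]
compares the potentials of two costs and gives
[| E s - E t - (s - t) e t | <= W (s - t)^2], where [e t] is the mean of the
time derivative of the cost under the optimal coupling at time [t], and [W] is a
constant times the cost of the plans ([value_quadratic]): the squared
displacement is a sum of functions of one coordinate, so that its mean under the
optimal coupling is its mean under the plans.  This two-sided estimate yields
that [e] is the derivative of the value, that it is Lipschitz, and that the
value and its opposite are convex up to a multiple of [t (1 - t)]; for optimal
plans the cost is the squared Wasserstein distance.  The constant involves a
bound on the derivatives of [c] up to order two on the whole space: a smooth
cutoff shows that the infimum which defines the norm is finite, and an extension
within 1 of it is used ([Ck_norm_attained]). *)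

(** * Bounded measurable functions and their means *)

Section bounded_measurable.
Context {R : realType} {d : measure_display} {T : measurableType d}.
Implicit Types (f g : T -> R).

Definition bmeas f :=
  measurable_fun setT f /\ exists M, forall x, `|f x| <= M.

Lemma bmeas_cst (k : R) : bmeas (fun=> k).
Proof. by split; [exact: measurable_cst|exists `|k|]. Qed.

Lemma bmeasD f g : bmeas f -> bmeas g -> bmeas (fun x => f x + g x).
Proof.
move=> [mf [A fA]] [mg [B gB]]; split; first exact: measurable_funD.
by exists (A + B) => x; rewrite (le_trans (ler_normD _ _))// lerD.
Qed.

Lemma bmeasM f g : bmeas f -> bmeas g -> bmeas (fun x => f x * g x).
Proof.
move=> [mf [A fA]] [mg [B gB]]; split; first exact: measurable_funM.
by exists (A * B) => x; rewrite normrM ler_pM.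
Qed.

Lemma bmeasZ k f : bmeas f -> bmeas (fun x => k * f x).
Proof. exact/bmeasM/bmeas_cst. Qed.

Lemma bmeasN f : bmeas f -> bmeas (fun x => - f x).
Proof.
by move=> /(bmeasZ (-1)); under eq_fun do rewrite mulN1r.
Qed.

Lemma bmeasB f g : bmeas f -> bmeas g -> bmeas (fun x => f x - g x).
Proof. by move=> bf bg; apply: bmeasD => //; exact: bmeasN. Qed.

Lemma bmeas_norm f : bmeas f -> bmeas (fun x => `|f x|).
Proof.
move=> [mf [A fA]]; split; first exact: measurableT_comp.
by exists A => x; rewrite normr_id.
Qed.

Lemma bmeas_sum (I : Type) (r : seq I) (Q : pred I) (F : I -> T -> R) :
  (forall i, bmeas (F i)) -> bmeas (fun x => \sum_(i <- r | Q i) F i x).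
Proof.
move=> bF; elim: r => [|i r IH].
  by under eq_fun do rewrite big_nil; exact: bmeas_cst.
by under eq_fun do rewrite big_cons; case: (Q i) => //; exact: bmeasD.
Qed.

Lemma bmeas_expR f : bmeas f -> bmeas (fun x => expR (f x)).
Proof.
move=> [mf [A fA]]; split; first exact: measurableT_comp.
exists (expR A) => x; rewrite ger0_norm ?expR_ge0// ler_expR.
exact: le_trans (ler_norm _) (fA x).
Qed.

Context (P : probability T R).

Lemma prob_inhabited : exists x : T, True.
Proof.
apply: contrapT => h.
have : P setT = 0%E.
  rewrite (_ : setT = set0) ?measure0//; apply/seteqP; split => // x _.
  by apply: h; exists x.
by have /= -> := @probability_setT _ _ _ P; case => /eqP; rewrite oner_eq0.
Qed.

Lemma bmeas_integrable f : bmeas f -> P.-integrable setT (EFin \o f).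
Proof.
move=> [mf [A fA]]; apply: (@le_integrable _ _ _ _ _ measurableT _ (cst A%:E)) => //.
- exact/measurable_EFinP.
- by move=> x _ /=; rewrite lee_fin (le_trans (fA x))// ler_norm.
- exact: finite_measure_integrable_cst.
Qed.

Definition mean f : R := (\int[P]_x f x)%R.

Lemma meanE f : bmeas f -> (\int[P]_x (f x)%:E)%E = (mean f)%:E.
Proof.
by move=> bf; rewrite /mean /Rintegral fineK//; apply: integrable_fin_num => //;
  exact: bmeas_integrable.
Qed.

Lemma mean_cst k : mean (fun=> k) = k.
Proof.
rewrite /mean Rintegral_cst//.
by have /= -> := @probability_setT _ _ _ P; rewrite mulr1.
Qed.

Lemma meanD f g : bmeas f -> bmeas g ->
  mean (fun x => f x + g x) = mean f + mean g.
Proof. by move=> bf bg; apply: RintegralD => //; exact: bmeas_integrable. Qed.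

Lemma meanZ k f : bmeas f -> mean (fun x => k * f x) = k * mean f.
Proof. by move=> bf; apply: RintegralZl => //; exact: bmeas_integrable. Qed.

Lemma meanB f g : bmeas f -> bmeas g ->
  mean (fun x => f x - g x) = mean f - mean g.
Proof. by move=> bf bg; apply: RintegralB => //; exact: bmeas_integrable. Qed.

Lemma mean_sum (I : Type) (r : seq I) (Q : pred I) (F : I -> T -> R) :
  (forall i, bmeas (F i)) ->
  mean (fun x => \sum_(i <- r | Q i) F i x) = \sum_(i <- r | Q i) mean (F i).
Proof.
move=> bF; elim: r => [|i r IH].
  by under eq_fun do rewrite big_nil; rewrite big_nil mean_cst.
under eq_fun do rewrite big_cons; rewrite big_cons; case: (Q i) => //.
by rewrite meanD ?IH//; exact: bmeas_sum.
Qed.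

Lemma le_mean f g : bmeas f -> bmeas g -> (forall x, f x <= g x) ->
  mean f <= mean g.
Proof.
by move=> bf bg fg; apply: le_Rintegral => //; exact: bmeas_integrable.
Qed.

Lemma mean_ge0 f : (forall x, 0 <= f x) -> 0 <= mean f.
Proof. by move=> f0; apply: Rintegral_ge0. Qed.

Lemma le_norm_mean f : bmeas f -> `|mean f| <= mean (fun x => `|f x|).
Proof.
by move=> bf; apply: le_normr_Rintegral => //; exact: bmeas_integrable.
Qed.

Lemma le_mean_cst f (M : R) : bmeas f -> (forall x, f x <= M) -> mean f <= M.
Proof.
by move=> bf fM; rewrite -(mean_cst M); apply: le_mean => //; exact: bmeas_cst.
Qed.

Lemma ge_mean_cst f (M : R) : bmeas f -> (forall x, M <= f x) -> M <= mean f.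
Proof.
by move=> bf fM; rewrite -(mean_cst M); apply: le_mean => //; exact: bmeas_cst.
Qed.

Lemma norm_mean_le f (M : R) : bmeas f -> (forall x, `|f x| <= M) ->
  `|mean f| <= M.
Proof.
move=> bf fM; apply: le_trans (le_norm_mean bf) _.
by apply: le_mean_cst => //; exact: bmeas_norm.
Qed.

(** The zero set of [g] has full measure; [g] replaces an almost everywhere
quantifier. *)
Lemma mean_ae0 f g : bmeas f -> bmeas g -> (forall x, 0 <= g x) ->
  mean g = 0 -> (forall x, g x = 0 -> f x = 0) -> mean f = 0.
Proof.
move=> bf bg g0 mg fg.
suff : (\int[P]_x (f x)%:E = \int[P]_x (cst 0%E x))%E.
  by rewrite integral0 /mean /Rintegral => ->.
apply: ae_eq_integral => //.
  by apply/measurable_EFinP; case: bf.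
have : (\int[P]_x `|(g x)%:E|)%E = 0%E.
  under eq_integral do rewrite abse_EFin ger0_norm//.
  by rewrite meanE// mg.
have mg' : measurable_fun setT (EFin \o g) by apply/measurable_EFinP; case: bg.
move/(ae_eq_integral_abs P measurableT mg').1.
by apply: filterS => x /= gx _; congr EFin; apply: fg; case: (gx I).
Qed.

End bounded_measurable.

(** * Conditional means by resampling *)

Section resampling.
Context {R : realType} {d : measure_display} {T : measurableType d}.
Context {I : finType} (P : probability T R) (u : I -> T -> T -> T).
Implicit Types (f g : T -> R) (i j : I).

(** Independent coordinates, described by a map instead of a product
structure. Think of [u i x y] as the point whose [i]-th coordinate is that of
[x], the other ones being those of [y]: fields [res_idem] and [res_indep] are
then identities between coordinates, and [res_inv] says that coordinate [i] is
independent of the others under [P]. *)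
Record resampling : Prop := Resampling {
  res_meas : forall i, measurable_fun setT (fun xy : T * T => u i xy.1 xy.2);
  res_inv : forall i A, measurable A ->
    (P \x P)%E ((fun xy : T * T => u i xy.1 xy.2) @^-1` A) = P A;
  res_idem : forall i x y z, u i (u i x y) z = u i x z;
  res_indep : forall i j x y z, i != j -> u i (u j x y) z = u i y z }.

(** The conditional mean given the [i]-th coordinate, as a function defined
everywhere rather than up to null sets. *)
Definition cmean i f x : R := mean P (fun y => f (u i x y)).

Definition rowdep i f := forall x y, f (u i x y) = f x.

(** The orthogonal projection, for the mean square norm, onto the sums of
functions of one coordinate each: once centred, the conditional means with
respect to different coordinates are orthogonal. *)
Definition aproj f x : R := \sum_i (cmean i f x - mean P f) + mean P f.

Definition additive_fun f := forall x, aproj f x = f x.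

Lemma aprojE f x :
  aproj f x = \sum_i (cmean i f x - mean P f) + mean P f.
Proof. by []. Qed.

Hypothesis uP : resampling.

Lemma bmeas_res i f x : bmeas f -> bmeas (fun y => f (u i x y)).
Proof.
move=> [mf [A fA]]; split; last by exists A.
apply: (measurableT_comp mf).
exact: (measurableT_comp (res_meas uP i) (pair1_measurable x)).
Qed.

Lemma bmeas_res2 i f : bmeas f -> bmeas (fun xy : T * T => f (u i xy.1 xy.2)).
Proof.
move=> [mf [A fA]]; split; last by exists A.
exact: (measurableT_comp mf (res_meas uP i)).
Qed.

Lemma integrable_res2 i f : bmeas f ->
  (P \x P)%E.-integrable setT (fun xy : T * T => (f (u i xy.1 xy.2))%:E).
Proof.
move=> bf; have [mf _] := bmeas_res2 i bf.
have [_ [A fA]] := bmeas_norm bf.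
apply/integrable12ltyP; first exact/measurable_EFinP.
apply: (@le_lt_trans _ _ (\int[P]_x `|A|%:E)%E); last first.
  rewrite integral_cst//; have /= -> := @probability_setT _ _ _ P.
  by rewrite mule1 ltry.
apply: ge0_le_integral => //.
- by move=> x _; apply: integral_ge0.
- apply: (measurable_fun_fubini_tonelli_F
    (abse \o (fun xy : T * T => (f (u i xy.1 xy.2))%:E))) => //=.
  by apply: measurableT_comp => //; exact/measurable_EFinP.
- move=> x _ /=.
  have := @meanE _ _ _ P _ (bmeas_norm (bmeas_res i x bf)).
  under eq_integral do rewrite -abse_EFin.
  move=> ->; rewrite lee_fin (le_trans _ (ler_norm A))//.
  apply: le_mean_cst; first exact/bmeas_norm/bmeas_res.
  by move=> y; have := fA (u i x y); rewrite normr_id.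
Qed.

Lemma cmeanE i f x : bmeas f ->
  (\int[P]_y (f (u i x y))%:E)%E = (cmean i f x)%:E.
Proof. by move=> bf; rewrite meanE//; exact: bmeas_res. Qed.

Lemma norm_cmean_le i f (M : R) x : bmeas f -> (forall x, `|f x| <= M) ->
  `|cmean i f x| <= M.
Proof. by move=> bf fM; apply: norm_mean_le => //; exact: bmeas_res. Qed.

Lemma bmeas_cmean i f : bmeas f -> bmeas (cmean i f).
Proof.
move=> bf; have [_ [A fA]] := bf; split; last first.
  by exists A => x; exact: norm_cmean_le.
apply/measurable_EFinP.
have /= := measurable_fubini_F (integrable_res2 i bf).
rewrite /fubini_F; congr measurable_fun; apply/funext => x /=.
exact: cmeanE.
Qed.

Lemma mean_cmean i f : bmeas f -> mean P (cmean i f) = mean P f.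
Proof.
move=> bf; apply: EFin_inj; rewrite -!meanE//; last exact: bmeas_cmean.
under eq_integral do rewrite -cmeanE//.
have /= := integral12_prod_meas1 (integrable_res2 i bf).
rewrite /fubini_F /= => ->.
have [mf _] := bf.
have mfE : measurable_fun setT (EFin \o f) by exact/measurable_EFinP.
have intf : (P \x P)%E.-integrable
    ((fun xy : T * T => u i xy.1 xy.2) @^-1` setT)
    ((EFin \o f) \o (fun xy : T * T => u i xy.1 xy.2)).
  by rewrite preimage_setT; exact: (integrable_res2 i bf).
have := integral_pushforward (res_meas uP i) mfE intf measurableT.
rewrite preimage_setT => <-.
apply: eq_measure_integral; first exact: (res_meas uP i).
by move=> ? A mA _; exact: (res_inv uP i mA).
Qed.

Lemma cmean_cst i k x : cmean i (fun=> k) x = k.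
Proof. exact: mean_cst. Qed.

Lemma cmeanD i f g x : bmeas f -> bmeas g ->
  cmean i (fun x => f x + g x) x = cmean i f x + cmean i g x.
Proof. by move=> bf bg; rewrite /cmean meanD//; exact: bmeas_res. Qed.

Lemma cmeanB i f g x : bmeas f -> bmeas g ->
  cmean i (fun x => f x - g x) x = cmean i f x - cmean i g x.
Proof. by move=> bf bg; rewrite /cmean meanB//; exact: bmeas_res. Qed.

Lemma cmeanZ i k f x : bmeas f ->
  cmean i (fun x => k * f x) x = k * cmean i f x.
Proof. by move=> bf; rewrite /cmean meanZ//; exact: bmeas_res. Qed.

Lemma cmean_sum (J : Type) (r : seq J) (Q : pred J) (F : J -> T -> R) i x :
  (forall k, bmeas (F k)) ->
  cmean i (fun x => \sum_(k <- r | Q k) F k x) x = \sum_(k <- r | Q k) cmean i (F k) x.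
Proof. by move=> bF; rewrite /cmean mean_sum// => k; exact: bmeas_res. Qed.

Lemma le_cmean i f g x : bmeas f -> bmeas g -> (forall x, f x <= g x) ->
  cmean i f x <= cmean i g x.
Proof. by move=> bf bg fg; apply: le_mean => //; exact: bmeas_res. Qed.

Lemma le_norm_cmean i f x : bmeas f ->
  `|cmean i f x| <= cmean i (fun x => `|f x|) x.
Proof. by move=> bf; apply: le_norm_mean; exact: bmeas_res. Qed.

Lemma rowdep_cmean i f : rowdep i (cmean i f).
Proof.
by move=> x y; rewrite /cmean; congr mean; apply/funext => z; rewrite res_idem.
Qed.

Lemma cmeanMl i f g x : rowdep i g -> bmeas f ->
  cmean i (fun x => g x * f x) x = g x * cmean i f x.
Proof.
move=> ig bf; rewrite /cmean; under eq_fun do rewrite ig.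
by rewrite meanZ//; exact: bmeas_res.
Qed.

Lemma cmean_rowdep i g x : rowdep i g -> cmean i g x = g x.
Proof.
by move=> ig; rewrite /cmean; under eq_fun do rewrite ig; rewrite mean_cst.
Qed.

Lemma cmean_neq i j g x : i != j -> rowdep j g -> cmean i g x = mean P g.
Proof.
move=> ij jg; rewrite /cmean; congr mean; apply/funext => y.
by rewrite -(jg (u i x y) y) res_indep 1?eq_sym// jg.
Qed.

Lemma mean_cmeanM i f g : bmeas f -> bmeas g ->
  mean P (fun x => f x * cmean i g x) = mean P (fun x => cmean i f x * cmean i g x).
Proof.
move=> bf bg; rewrite -(mean_cmean i); last exact/bmeasM/bmeas_cmean.
congr mean; apply/funext => x.
under eq_fun do rewrite mulrC.
by rewrite cmeanMl//; [rewrite mulrC|exact: rowdep_cmean].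
Qed.

Lemma bmeas_aproj f : bmeas f -> bmeas (aproj f).
Proof.
move=> bf; apply: bmeasD; last exact: bmeas_cst.
apply: bmeas_sum => i; apply: bmeasB; last exact: bmeas_cst.
exact: bmeas_cmean.
Qed.

Lemma aprojD f g x : bmeas f -> bmeas g ->
  aproj (fun x => f x + g x) x = aproj f x + aproj g x.
Proof.
move=> bf bg; rewrite /aproj meanD// addrACA -big_split/=; congr (_ + _).
by apply: eq_bigr => i _; rewrite cmeanD//; ring.
Qed.

Lemma aprojZ k f x : bmeas f -> aproj (fun x => k * f x) x = k * aproj f x.
Proof.
move=> bf; rewrite /aproj meanZ// mulrDr mulr_sumr; congr (_ + _).
by apply: eq_bigr => i _; rewrite cmeanZ//; ring.
Qed.

Lemma aprojB f g x : bmeas f -> bmeas g ->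
  aproj (fun x => f x - g x) x = aproj f x - aproj g x.
Proof.
move=> bf bg; rewrite -mulN1r -aprojZ// -aprojD//; last exact: bmeasZ.
by under [in RHS]eq_fun do rewrite mulN1r.
Qed.

Lemma aproj_cst k x : aproj (fun=> k) x = k.
Proof.
rewrite /aproj mean_cst big1 ?add0r// => i _.
by rewrite cmean_cst subrr.
Qed.

Lemma mean_aproj f : bmeas f -> mean P (aproj f) = mean P f.
Proof.
move=> bf; have bi i : bmeas (fun x => cmean i f x - mean P f).
  by apply: bmeasB; [exact: bmeas_cmean|exact: bmeas_cst].
rewrite /aproj meanD; [|exact: bmeas_sum|exact: bmeas_cst].
rewrite mean_sum// mean_cst big1 ?add0r// => i _.
by rewrite meanB ?mean_cst ?mean_cmean ?subrr//;
  [exact: bmeas_cmean|exact: bmeas_cst].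
Qed.

Lemma cmean_aproj i f x : bmeas f -> cmean i (aproj f) x = cmean i f x.
Proof.
move=> bf; have bi j : bmeas (fun x => cmean j f x - mean P f).
  by apply: bmeasB; [exact: bmeas_cmean|exact: bmeas_cst].
rewrite /aproj cmeanD; [|exact: bmeas_sum|exact: bmeas_cst].
rewrite cmean_sum// cmean_cst (bigD1 i)//= big1 => [|j ji].
  rewrite cmeanB; [|exact: bmeas_cmean|exact: bmeas_cst].
  by rewrite cmean_cst cmean_rowdep ?addr0 ?subrK//; exact: rowdep_cmean.
rewrite cmeanB; [|exact: bmeas_cmean|exact: bmeas_cst].
rewrite cmean_cst (@cmean_neq i j) ?mean_cmean ?subrr// 1?eq_sym//.
exact: rowdep_cmean.
Qed.

Lemma additive_aproj f : bmeas f -> additive_fun (aproj f).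
Proof.
move=> bf x; rewrite {1}/aproj mean_aproj//; congr (_ + _).
by apply: eq_bigr => i _; rewrite cmean_aproj.
Qed.

(** Each conditional mean is self-adjoint, hence so is the projection. *)
Lemma aproj_adj f g : bmeas f -> bmeas g ->
  mean P (fun x => f x * aproj g x) = mean P (fun x => aproj f x * g x).
Proof.
have key f' g' : bmeas f' -> bmeas g' ->
    mean P (fun x => f' x * aproj g' x) =
    \sum_i (mean P (fun x => cmean i f' x * cmean i g' x) - mean P f' * mean P g')
    + mean P f' * mean P g'.
  move=> bf bg; have bi i : bmeas (fun x => cmean i g' x - mean P g').
    by apply: bmeasB; [exact: bmeas_cmean|exact: bmeas_cst].
  under eq_fun do rewrite /aproj mulrDr mulr_sumr.
  have bfi i : bmeas (fun x => f' x * (cmean i g' x - mean P g')) by exact: bmeasM.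
  rewrite meanD; [|exact: bmeas_sum|exact/bmeasM/bmeas_cst].
  under [X in _ + mean _ X]eq_fun do rewrite mulrC.
  rewrite meanZ// mean_sum// (mulrC (mean P g')); congr (_ + _).
  apply: eq_bigr => i _; under eq_fun do rewrite mulrBr.
  rewrite meanB; [|by apply: bmeasM => //; exact: bmeas_cmean|exact/bmeasM/bmeas_cst].
  rewrite (mean_cmeanM i bf bg); congr (_ - _).
  by under eq_fun do rewrite mulrC; rewrite meanZ// mulrC.
move=> bf bg; rewrite (key f g bf bg).
have -> : (fun x => aproj f x * g x) = (fun x => g x * aproj f x).
  by apply/funext => x; rewrite mulrC.
rewrite (key g f bg bf).
have E i : (fun x => cmean i f x * cmean i g x) = (fun x => cmean i g x * cmean i f x).
  by apply/funext => x; rewrite mulrC.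
under eq_bigr do rewrite E.
by have -> : mean P g * mean P f = mean P f * mean P g by exact: mulrC.
Qed.

(** Tested against an additive function, [f] and its projection are
indistinguishable; all uses of the Schroedinger system go through this. *)
Lemma aproj_additive f S : bmeas f -> bmeas S -> additive_fun S ->
  mean P (fun x => aproj f x * S x) = mean P (fun x => f x * S x).
Proof.
move=> bf bS aS; rewrite -aproj_adj//; congr mean.
by apply/funext => x; rewrite aS.
Qed.

Lemma mean_aproj_sqr f : bmeas f ->
  mean P (fun x => aproj f x ^+ 2) <= mean P (fun x => f x ^+ 2).
Proof.
move=> bf; have bp := bmeas_aproj bf.
have E1 : mean P (fun x => aproj f x * f x) = mean P (fun x => aproj f x ^+ 2).
  by rewrite -(aproj_adj bf bf) -(aproj_additive bf bp)//; exact: additive_aproj.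
have : 0 <= mean P (fun x => (f x - aproj f x) ^+ 2).
  by apply: mean_ge0 => x; exact: sqr_ge0.
have -> : (fun x => (f x - aproj f x) ^+ 2) =
    (fun x => (f x ^+ 2 - 2 * (aproj f x * f x)) + aproj f x ^+ 2).
  by apply/funext => x; ring.
have b2 h : bmeas h -> bmeas (fun x => h x ^+ 2) by move=> bh; exact: bmeasM.
have bpf : bmeas (fun x => aproj f x * f x) by exact: bmeasM.
rewrite meanD; [|apply: bmeasB; [exact: b2|exact: bmeasZ]|exact: b2].
rewrite meanB; [|exact: b2|exact: bmeasZ].
by rewrite meanZ// E1; lra.
Qed.

Lemma norm_components_le f (M : R) x :
  (forall i x, `|cmean i f x| <= M) -> `|mean P f| <= M ->
  `|aproj f x| <= (2 * #|I|%:R + 1) * M.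
Proof.
move=> fM mM; rewrite mulrDl mul1r (le_trans (ler_normD _ _))// lerD//.
rewrite (le_trans (ler_norm_sum _ _ _))//.
apply: (@le_trans _ _ (\sum_(i : I) (2 * M))).
  apply: ler_sum => i _.
  by rewrite (le_trans (ler_normB _ _))// mulr2n mulrDl mul1r lerD.
by rewrite sumr_const -[leLHS]mulr_natl mulrCA mulrA.
Qed.

Lemma norm_aproj_le f (M : R) x : bmeas f -> (forall x, `|f x| <= M) ->
  `|aproj f x| <= (2 * #|I|%:R + 1) * M.
Proof.
move=> bf fM; apply: norm_components_le; last exact: norm_mean_le.
by move=> i y; exact: norm_cmean_le.
Qed.

(** An additive function is the sum of its centred components and of its mean,
so that sup bounds need only be checked on conditional means. *)
Lemma norm_additive_le S (M : R) x : additive_fun S ->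
  (forall i x, `|cmean i S x| <= M) -> `|mean P S| <= M ->
  `|S x| <= (2 * #|I|%:R + 1) * M.
Proof. by move=> aS fM mM; rewrite -aS; exact: norm_components_le. Qed.

Lemma sqr_mean_norm_le f : bmeas f ->
  mean P (fun x => `|f x|) ^+ 2 <= mean P (fun x => f x ^+ 2).
Proof.
move=> bf; set a := mean P _.
have : 0 <= mean P (fun x => (`|f x| - a) ^+ 2).
  by apply: mean_ge0 => x; exact: sqr_ge0.
have -> : (fun x => (`|f x| - a) ^+ 2) =
    (fun x => (f x ^+ 2 - 2 * a * `|f x|) + a ^+ 2).
  by apply/funext => x; rewrite sqrrB real_normK ?num_real//; ring.
have b2 h : bmeas h -> bmeas (fun x => h x ^+ 2) by move=> bh; exact: bmeasM.
have bn := bmeas_norm bf.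
rewrite meanD; [|apply: bmeasB; [exact: b2|exact: bmeasZ]|exact: bmeas_cst].
rewrite meanB; [|exact: b2|exact: bmeasZ].
by rewrite meanZ// mean_cst -/a; nra.
Qed.

(** Averaging over the other coordinates smooths. After subtracting its own
[i]-th component, an additive [e] only depends on the other coordinates, and
its conditional mean is a plain mean. This is what turns mean square estimates
into sup estimates. *)
Lemma cmean_decorrelate i (b e : T -> R) (L : R) x :
  bmeas b -> bmeas e -> additive_fun e -> (forall x, `|b x| <= L) ->
  `|cmean i (fun x => b x * e x) x - cmean i b x * cmean i e x| <=
    L * (2 * #|I|%:R * mean P (fun x => `|e x|)).
Proof.
move=> bb be ae bL; have bce := bmeas_cmean i be.
rewrite -[X in _ - X]mulrC -cmeanMl//; last exact: rowdep_cmean.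
rewrite -cmeanB; [|exact: bmeasM|exact: bmeasM].
have L0 : 0 <= L by exact: le_trans (bL x).
pose r j x := cmean j e x - mean P e.
have br j : bmeas (r j).
  by apply: bmeasB; [exact: bmeas_cmean|exact: bmeas_cst].
have bnr j : bmeas (fun x => `|r j x|) by exact: bmeas_norm.
have mr j : mean P (fun x => `|r j x|) <= 2 * mean P (fun x => `|e x|).
  apply: (@le_trans _ _ (mean P (fun x => `|cmean j e x| + `|mean P e|))).
    apply: le_mean => [//||y]; last exact: ler_normB.
    by apply: bmeasD; [exact/bmeas_norm/bmeas_cmean|exact: bmeas_cst].
  rewrite meanD; [|exact/bmeas_norm/bmeas_cmean|exact: bmeas_cst].
  rewrite mean_cst mulr2n mulrDl mul1r lerD//; last exact: le_norm_mean.
  rewrite -[leRHS](mean_cmean j); last exact: bmeas_norm.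
  apply: le_mean => [||y]; [exact/bmeas_norm/bmeas_cmean|exact/bmeas_cmean/bmeas_norm|].
  exact: le_norm_cmean.
have bs : bmeas (fun y => \sum_(j | j != i) `|r j y|).
  exact: bmeas_sum.
apply: (@le_trans _ _ (cmean i (fun y => L * \sum_(j | j != i) `|r j y|) x)).
  apply: (le_trans (le_norm_cmean _ _ _)).
    by apply: bmeasB; exact: bmeasM.
  apply: le_cmean => [||y]; [|exact: bmeasZ|].
    by apply: bmeas_norm; apply: bmeasB; exact: bmeasM.
  rewrite (mulrC (b y)) -mulrBl mulrC normrM ler_pM//.
  have -> : e y - cmean i e y = \sum_(j | j != i) r j y.
    by rewrite -[e y]ae /aproj (bigD1 i)//= -/(r i y) {1}/r; ring.
  exact: ler_norm_sum.
rewrite cmeanZ// ler_wpM2l//.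
rewrite cmean_sum//.
apply: (@le_trans _ _ (\sum_(j | j != i) 2 * mean P (fun x => `|e x|))).
  apply: ler_sum => j ji; rewrite (@cmean_neq i j) 1?eq_sym// => y z.
  by rewrite /r rowdep_cmean.
rewrite sumr_const -[leLHS]mulr_natl -mulrA [leRHS]mulrCA ler_wpM2r//.
  by rewrite mulr_ge0//; apply: mean_ge0.
by rewrite ler_nat max_card.
Qed.

End resampling.

(** * Equations projected on the additive functions *)

Section relaxation.
Context {R : realType}.

Lemma geometric_small (C r eps : R) : 0 <= r < 1 -> 0 < eps ->
  exists n0, forall n, (n0 <= n)%N -> C * r ^+ n <= eps.
Proof.
move=> /andP[r0 r1] e0.
have : `|r| < 1 by rewrite ger0_norm.
move/(cvg_geometric C)/cvgr0Pnorm_le => /(_ _ e0)[n0 _ h].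
by exists n0 => n nn; rewrite (le_trans (ler_norm _))//; exact: (h n nn).
Qed.

(** The sequences [s n - C r^n / (1 - r)] and [s n + C r^n / (1 - r)] are
monotone and squeeze the limit, which is the supremum of the former. *)
Lemma geometric_limit (s : nat -> R) (C r : R) : 0 <= r < 1 -> 0 <= C ->
  (forall n, `|s n.+1 - s n| <= C * r ^+ n) ->
  forall n, `|s n - sup [set s k - C / (1 - r) * r ^+ k | k in setT]| <=
    C / (1 - r) * r ^+ n.
Proof.
move=> /andP[r0 r1] C0 sC.
pose K := C / (1 - r); rewrite -/K.
have r1' : 0 < 1 - r by rewrite subr_gt0.
have KE n : K * r ^+ n - K * r ^+ n.+1 = C * r ^+ n.
  by rewrite exprS /K; field; rewrite gt_eqF.
have up n k : s (n + k)%N - K * r ^+ (n + k) >= s n - K * r ^+ n.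
  elim: k => [|k IH]; first by rewrite addn0.
  apply: (le_trans IH); rewrite addnS.
  by have := sC (n + k)%N; have := KE (n + k)%N; rewrite ler_norml => ? /andP[]; lra.
have dn n k : s (n + k)%N + K * r ^+ (n + k) <= s n + K * r ^+ n.
  elim: k => [|k IH]; first by rewrite addn0.
  apply: (le_trans _ IH); rewrite addnS.
  by have := sC (n + k)%N; have := KE (n + k)%N; rewrite ler_norml => ? /andP[]; lra.
have K0 n : 0 <= K * r ^+ n by rewrite mulr_ge0 ?exprn_ge0// /K divr_ge0// ltW.
have ub n : ubound [set s k - K * r ^+ k | k in setT] (s n + K * r ^+ n).
  move=> _ [k _ <-]; have := up k n; have := dn n k; rewrite (addnC k).
  by have := K0 (n + k)%N; lra.
move=> n; rewrite ler_norml; apply/andP; split.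
  suff : sup [set s k - K * r ^+ k | k in setT] <= s n + K * r ^+ n by lra.
  by apply: ge_sup; [exists (s 0%N - K * r ^+ 0), 0%N|exact: ub].
suff : s n - K * r ^+ n <= sup [set s k - K * r ^+ k | k in setT] by lra.
by apply: ub_le_sup; [exists (s n + K * r ^+ n); exact: ub|exists n].
Qed.

Context {d : measure_display} {T : measurableType d}.

Definition unif_lim (s : nat -> T -> R) (S : T -> R) :=
  forall eps, 0 < eps -> exists n0, forall n, (n0 <= n)%N ->
    forall x, `|s n x - S x| <= eps.

Lemma bmeas_unif_lim (s : nat -> T -> R) S :
  (forall n, bmeas (s n)) -> unif_lim s S -> bmeas S.
Proof.
move=> bs sS; split.
  apply: (@measurable_fun_cvg _ _ _ _ s) => [n|x _]; first by case: (bs n).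
  apply/cvgrPdist_le => e e0; have [n0 h] := sS _ e0.
  by exists n0 => // n nn; rewrite distrC; exact: h.
have [n0 h] := sS _ ltr01.
have [_ [A hA]] := bs n0; exists (1 + A) => x.
have := h n0 (leqnn _) x; have := hA x; rewrite !ler_norml.
by move=> /andP[? ?] /andP[? ?]; apply/andP; split; lra.
Qed.

Context {I : finType} (P : probability T R) (u : I -> T -> T -> T).
Implicit Types (f g e b S : T -> R) (tau : R) (i : I).
Hypothesis uP : resampling P u.

Local Notation cmean := (cmean P u).
Local Notation aproj := (aproj P u).
Local Notation mean := (mean P).
Local Notation additive := (additive_fun P u).
Let N : R := #|I|%:R.

Let N0 : 0 <= N. Proof. exact: ler0n. Qed.

Lemma aproj_dist_le f g (M : R) x : bmeas f -> bmeas g ->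
  (forall x, `|f x - g x| <= M) ->
  `|aproj f x - aproj g x| <= (2 * N + 1) * M.
Proof.
move=> bf bg fg; rewrite -aprojB//.
by apply: norm_aproj_le => //; exact: bmeasB.
Qed.

Lemma additive_unif_lim (s : nat -> T -> R) S :
  (forall n, bmeas (s n)) -> (forall n, additive (s n)) ->
  unif_lim s S -> additive S.
Proof.
move=> bs as_ sS x; have bS := bmeas_unif_lim bs sS.
apply/eqP; rewrite -subr_eq0 -normr_le0; apply/ler_addgt0Pr => e e0.
rewrite add0r.
have N2 : 0 < 2 * N + 2 by have := N0; lra.
have [n0 h] := sS _ (divr_gt0 e0 N2).
have := @aproj_dist_le S (s n0) (e / (2 * N + 2)) x bS (bs n0).
rewrite as_ => /(_ _)/=; have hx y := h n0 (leqnn _) y.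
move=> /(_ _)/wrap[y|]; first by rewrite distrC.
have := hx x; rewrite !ler_norml => /andP[a1 a2] /andP[b1 b2].
have E : e = (2 * N + 1) * (e / (2 * N + 2)) + e / (2 * N + 2).
  by field; rewrite gt_eqF.
by rewrite E; apply/andP; split; lra.
Qed.

Lemma bmeas_relax tau e f : bmeas e -> bmeas f ->
  bmeas (fun x => e x - tau * f x).
Proof. by move=> be bf; apply: bmeasB => //; exact: bmeasZ. Qed.

Lemma additive_relax tau e f : bmeas e -> bmeas f -> additive e ->
  additive f -> additive (fun x => e x - tau * f x).
Proof.
move=> be bf ae af x; rewrite aprojB//; last exact: bmeasZ.
by rewrite aprojZ// ae af.
Qed.

Section one_step.
Variables (b e : T -> R) (m L : R).
Hypotheses (bb : bmeas b) (be : bmeas e) (ae : additive e).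
Hypotheses (m0 : 0 < m) (mL : m <= L) (bmL : forall x, m <= b x <= L).

Let f x := b x * e x.
Let bf : bmeas f. Proof. exact: bmeasM. Qed.
Let L0 : 0 < L. Proof. exact: lt_le_trans mL. Qed.

(** Multiplication by [b] followed by the projection is [m]-strongly monotone
and [L]-Lipschitz on additive functions, for the mean square norm; the step
[m / L ^+ 2] minimises the contraction factor [1 - 2 tau m + tau^2 L^2]. *)
Lemma relax_l2 :
  mean (fun x => (e x - m / L ^+ 2 * aproj f x) ^+ 2) <=
  (1 - m ^+ 2 / L ^+ 2) * mean (fun x => e x ^+ 2).
Proof.
set tau := m / L ^+ 2.
have bp := bmeas_aproj uP bf.
have b2 h : bmeas h -> bmeas (fun x => h x ^+ 2) by move=> bh; exact: bmeasM.
have bpe : bmeas (fun x => aproj f x * e x) by exact: bmeasM.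
have -> : (fun x => (e x - tau * aproj f x) ^+ 2) = (fun x =>
    (e x ^+ 2 - 2 * tau * (aproj f x * e x)) + tau ^+ 2 * aproj f x ^+ 2).
  by apply/funext => x; ring.
rewrite meanD; [|apply: bmeasB; [exact: b2|exact: bmeasZ]|exact/bmeasZ/b2].
rewrite meanB; [|exact: b2|exact: bmeasZ].
rewrite !meanZ; [|exact: b2|exact: bpe].
rewrite (aproj_additive uP bf be ae).
have h1 : m * mean (fun x => e x ^+ 2) <= mean (fun x => f x * e x).
  rewrite -meanZ; last exact: b2.
  apply: le_mean => [||x]; [exact/bmeasZ/b2|exact: bmeasM|].
  rewrite /f -mulrA -expr2 ler_wpM2r ?sqr_ge0//.
  by have /andP[] := bmL x.
have h2 : mean (fun x => aproj f x ^+ 2) <= L ^+ 2 * mean (fun x => e x ^+ 2).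
  apply: (le_trans (mean_aproj_sqr uP bf)); rewrite -meanZ; last exact: b2.
  apply: le_mean => [||x]; [exact: b2|exact/bmeasZ/b2|].
  rewrite /f exprMn ler_wpM2r ?sqr_ge0// lerXn2r ?nnegrE ?(ltW L0)//.
    by have /andP[bm _] := bmL x; rewrite (le_trans _ bm)// ltW.
  by have /andP[] := bmL x.
have t0 : 0 <= tau by rewrite /tau ltW// divr_gt0// exprn_gt0.
have := ler_wpM2l t0 h1; have := ler_wpM2l (sqr_ge0 tau) h2.
set A := mean (fun x => e x ^+ 2); set B := mean _; set D := mean _ => u1 u2.
have E : (1 - m ^+ 2 / L ^+ 2) * A =
    A - 2 * (tau * (m * A)) + tau ^+ 2 * (L ^+ 2 * A).
  by rewrite /tau; field; rewrite gt_eqF.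
by rewrite E; lra.
Qed.

(** Here the factor [1 - tau * cmean i b] is pointwise, so that the components
contract in sup norm up to a source controlled by the mean norm of [e]. *)
Lemma relax_cmean i x :
  `|cmean i (fun x => e x - m / L ^+ 2 * aproj f x) x| <=
  (1 - m ^+ 2 / L ^+ 2) * `|cmean i e x| +
  m / L * (2 * N * mean (fun x => `|e x|)).
Proof.
set tau := m / L ^+ 2; have bp := bmeas_aproj uP bf.
have t0 : 0 <= tau by rewrite /tau ltW// divr_gt0// exprn_gt0.
rewrite cmeanB//; last exact: bmeasZ.
rewrite cmeanZ// cmean_aproj//.
have bL y : `|b y| <= L.
  by have /andP[bm bL] := bmL y; rewrite ger0_norm// (le_trans _ bm)// ltW.
have := cmean_decorrelate uP i x bb be ae bL.
set Z := cmean i (fun x => _) x; set be_ := cmean i e x; set Q := mean _ => h.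
have bi : m <= cmean i b x <= L.
  apply/andP; split.
    by apply: ge_mean_cst => [|y]; [exact: (bmeas_res uP)|have /andP[] := bmL (u i x y)].
  by apply: le_mean_cst => [|y]; [exact: (bmeas_res uP)|have /andP[] := bmL (u i x y)].
move: bi => /andP[bi1 bi2].
have tm : tau * m = m ^+ 2 / L ^+ 2 by rewrite /tau; field; rewrite gt_eqF.
have tL : tau * L = m / L by rewrite /tau; field; rewrite gt_eqF.
have tL1 : tau * L <= 1 by rewrite tL ler_pdivrMr// mul1r.
have -> : be_ - tau * Z = (1 - tau * cmean i b x) * be_ - tau * (Z - cmean i b x * be_).
  by ring.
rewrite (le_trans (ler_normB _ _))// lerD//.
  rewrite normrM ler_wpM2r// ger0_norm.
    by rewrite -tm lerD2l lerN2 ler_wpM2l.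
  by rewrite subr_ge0 (le_trans _ tL1)// ler_wpM2l.
by rewrite normrM ger0_norm// -tL -mulrA ler_wpM2l.
Qed.

End one_step.

(** Relaxation [S |-> S - tau * G S] is a contraction for the mean square
norm, by strong monotonicity. For the sup norm of the components [cmean i S]
it is a contraction up to a term controlled by the mean square norm, because
averaging over the other coordinates smooths. Both estimates together give
uniform geometric convergence. The domain [D] is what makes [G], of
exponential type in the applications, monotone with fixed constants. *)
Theorem relaxation_zero (D : (T -> R) -> Prop) (G : (T -> R) -> T -> R)
    (m L : R) (S0 : T -> R) :
  0 < m -> m <= L -> D S0 ->
  (forall S, D S -> bmeas S /\ additive S) ->
  (forall s S, (forall n, D (s n)) -> unif_lim s S -> D S) ->
  (forall S S', D S -> D S' -> exists b, [/\ bmeas b,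
     (forall x, m <= b x <= L) &
     forall x, G S x - G S' x = aproj (fun x => b x * (S x - S' x)) x]) ->
  (forall S, D S -> D (fun x => S x - m / L ^+ 2 * G S x)) ->
  exists S, D S /\ forall x, G S x = 0.
Proof.
move=> m0 mL D0 Dba Dlim DG Dstep.
have L0 : 0 < L by exact: lt_le_trans mL.
pose tau := m / L ^+ 2.
have t0 : 0 < tau by rewrite /tau divr_gt0// exprn_gt0.
pose s n := iter n (fun S x => S x - tau * G S x) S0.
have Ds n : D (s n) by elim: n => //= n; exact: Dstep.
pose e n x := s n.+1 x - s n x.
have be n : bmeas (e n).
  by apply: bmeasB; [case: (Dba _ (Ds n.+1))|case: (Dba _ (Ds n))].
have ae n : additive (e n).
  have [b1 a1] := Dba _ (Ds n.+1); have [b2 a2] := Dba _ (Ds n).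
  by move=> x; rewrite /e (aprojB uP x b1 b2) a1 a2.
pose kap := m ^+ 2 / L ^+ 2.
have k0 : 0 < kap by rewrite /kap divr_gt0// exprn_gt0.
have k1 : kap <= 1.
  by rewrite /kap ler_pdivrMr ?exprn_gt0// mul1r lerXn2r// nnegrE ltW.
(* The square of [r] dominates the factor [1 - kap] of the mean square error,
and [r] exceeds the factor [1 - kap] of the components, which leaves room for
their source term. *)
pose r := 1 - kap / 2.
have r01 : 0 <= r < 1 by rewrite /r; apply/andP; split; lra.
have [r0 r1] : 0 <= r /\ r < 1 by move/andP: r01.
have [_ [K hK]] := be 0%N.
have K0 : 0 <= K.
  by have [x _] := prob_inhabited P; exact: le_trans (hK x).
(* The choice of [B] makes [(1 - kap) * B + 2 * N * (m / L) * K <= r * B]. *)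
pose B := K + 4 * N * (m / L) * K / kap.
have mL0 : 0 <= m / L by rewrite divr_ge0// ltW.
have KB : K <= B.
  rewrite /B lerDl divr_ge0 ?(ltW k0)//.
  by apply: mulr_ge0 => //; apply: mulr_ge0 => //; apply: mulr_ge0.
have step n : exists b, [/\ bmeas b, (forall x, m <= b x <= L) &
    e n.+1 = fun x => e n x - tau * aproj (fun x => b x * e n x) x].
  have [b [bb bmL h]] := DG _ _ (Ds n.+1) (Ds n).
  by exists b; split => //; apply/funext => x; rewrite -h /e /=; ring.
have mean_le_root n : mean (fun x => e n x ^+ 2) <= (K * r ^+ n) ^+ 2 ->
    mean (fun x => `|e n x|) <= K * r ^+ n.
  move=> h; rewrite -(@ler_pXn2r _ 2)// ?nnegrE ?mulr_ge0 ?exprn_ge0//; last first.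
    by apply: mean_ge0.
  exact: le_trans (sqr_mean_norm_le _ (be n)) h.
have key n : mean (fun x => e n x ^+ 2) <= (K * r ^+ n) ^+ 2 /\
    forall i x, `|cmean i (e n) x| <= B * r ^+ n.
  elim: n => [|n [IH1 IH2]].
    rewrite expr0 !mulr1; split.
      apply: le_mean_cst => [|x]; first exact: bmeasM.
      by rewrite -real_normK ?num_real// lerXn2r// nnegrE.
    move=> i x; apply: le_trans KB.
    by apply: norm_cmean_le.
  have [b [bb bmL ->]] := step n; split.
    apply: (le_trans (relax_l2 bb (be n) (ae n) m0 mL bmL)).
    apply: (@le_trans _ _ ((1 - kap) * (K * r ^+ n) ^+ 2)).
      by rewrite ler_wpM2l// subr_ge0.
    have -> : K * r ^+ n.+1 = r * (K * r ^+ n) by rewrite exprS; ring.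
    rewrite (exprMn _ r) ler_wpM2r ?sqr_ge0// /r.
    by have := sqr_ge0 kap; nra.
  move=> i x; apply: (le_trans (relax_cmean bb (be n) (ae n) m0 mL bmL i x)).
  have men := mean_le_root n IH1.
  apply: (@le_trans _ _ ((1 - kap) * (B * r ^+ n) + m / L * (2 * N * (K * r ^+ n)))).
    rewrite lerD// ler_wpM2l ?subr_ge0//.
    by rewrite ler_wpM2l// mulr_ge0.
  rewrite (exprS r n).
  have -> : (1 - kap) * (B * r ^+ n) + m / L * (2 * N * (K * r ^+ n)) =
      ((1 - kap) * B + 2 * N * (m / L) * K) * r ^+ n by ring.
  have -> : B * (r * r ^+ n) = B * r * r ^+ n by rewrite mulrA.
  rewrite ler_wpM2r ?exprn_ge0//.
  suff : 2 * N * (m / L) * K <= kap / 2 * B by rewrite /r; nra.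
  rewrite /B mulrDr -lerBlDr.
  have -> : kap / 2 * (4 * N * (m / L) * K / kap) = 2 * N * (m / L) * K.
    by field; rewrite (gt_eqF k0) (gt_eqF L0).
  by rewrite lerBlDr lerDr mulr_ge0// divr_ge0// ltW.
pose C := (2 * N + 1) * B.
have C0 : 0 <= C.
  by rewrite /C mulr_ge0//; [have := N0; lra|exact: le_trans KB].
have eC x n : `|s n.+1 x - s n x| <= C * r ^+ n.
  rewrite /C -mulrA; apply: (norm_additive_le x (ae n)); first by case: (key n).
  apply: (le_trans (le_norm_mean P (be n))).
  apply: (@le_trans _ _ (K * r ^+ n)); last by rewrite ler_wpM2r ?exprn_ge0.
  by apply: mean_le_root; case: (key n).
pose S x := sup [set s k x - C / (1 - r) * r ^+ k | k in setT].
have sS n x : `|s n x - S x| <= C / (1 - r) * r ^+ n.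
  exact: (geometric_limit r01 C0 (eC x)).
have limS : unif_lim s S.
  move=> eps eps0; have [n0 h] := geometric_small (C / (1 - r)) r01 eps0.
  by exists n0 => n nn x; apply: (le_trans (sS n x)); exact: h.
have DS := Dlim _ _ Ds limS.
exists S; split => // x; apply/eqP; rewrite -normr_le0.
apply/ler_addgt0Pr => eps eps0; rewrite add0r.
pose C' := C / tau + (2 * N + 1) * (L * (C / (1 - r))).
have [n0 h] := geometric_small C' r01 eps0.
apply: le_trans (h n0 (leqnn _)).
have [b [bb bmL hb]] := DG _ _ DS (Ds n0).
have -> : G S x = (G S x - G (s n0) x) - (s n0.+1 x - s n0 x) / tau.
  by rewrite /=; field; rewrite gt_eqF.
rewrite (le_trans (ler_normB _ _))// addrC /C' [leRHS]mulrDl lerD//.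
  by rewrite normrM normfV (ger0_norm (ltW t0)) mulrAC ler_pM2r ?invr_gt0.
rewrite hb -!mulrA; apply: norm_aproj_le => // [|y].
  by apply: bmeasM => //; apply: bmeasB; [case: (Dba _ DS)|case: (Dba _ (Ds n0))].
rewrite normrM ler_pM//.
  by have /andP[bm bL] := bmL y; rewrite ger0_norm// (le_trans _ bm)// ltW.
by have := sS n0 y; rewrite distrC /C !mulrA.
Qed.

(** A bound, in the sup norm, of the inverse of [e |-> aproj (b * e)] on
additive functions, when the weight [b] lies between [m] and [L]. *)
Definition stab (m L : R) := (2 * N + 1) * ((1 + 2 * N * (L / m)) / m + 1 / m).

Lemma stab_ge0 (m L : R) : 0 < m -> m <= L -> 0 <= stab m L.
Proof.
move=> m0 mL; have L0 : 0 < L by exact: lt_le_trans mL.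
rewrite /stab mulr_ge0//; first by have := N0; lra.
by rewrite addr_ge0// divr_ge0 ?(ltW m0)// addr_ge0// !mulr_ge0// ?invr_ge0 ltW.
Qed.

(** Testing the equation against [e] itself bounds the mean norm of [e] by
[M / m]; then [cmean_decorrelate] bounds each of its components. *)
Lemma weighted_stability b e f (m L M : R) : 0 < m ->
  bmeas b -> bmeas e -> bmeas f -> additive e ->
  (forall x, m <= b x <= L) -> (forall x, `|f x| <= M) ->
  (forall x, aproj (fun x => b x * e x) x = aproj f x) ->
  forall x, `|e x| <= stab m L * M.
Proof.
move=> m0 bb be bf ae bmL fM E x.
have M0 : 0 <= M by exact: le_trans (fM x).
have mL : m <= L by have /andP[] := bmL x; exact: le_trans.
have L0 : 0 < L by exact: lt_le_trans mL.
have b2 h : bmeas h -> bmeas (fun x => h x ^+ 2) by move=> bh; exact: bmeasM.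
have bbe : bmeas (fun x => b x * e x) by exact: bmeasM.
set A := mean (fun x => `|e x|).
have A0 : 0 <= A by apply: mean_ge0.
have AM : A <= M / m.
  have h : m * A ^+ 2 <= M * A.
    apply: (@le_trans _ _ (m * mean (fun x => e x ^+ 2))).
      by rewrite ler_pM2l//; exact: sqr_mean_norm_le.
    apply: (@le_trans _ _ (mean (fun x => b x * e x * e x))).
      rewrite -meanZ; last exact: b2.
      apply: le_mean => [||y]; [exact/bmeasZ/b2|exact: bmeasM|].
      rewrite -mulrA -expr2 ler_wpM2r ?sqr_ge0//.
      by have /andP[] := bmL y.
    rewrite -(aproj_additive uP bbe be ae).
    have -> : (fun x => aproj (fun x => b x * e x) x * e x) =
        (fun x => aproj f x * e x) by apply/funext => y; rewrite E.
    rewrite (aproj_additive uP bf be ae).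
    rewrite -meanZ; last exact: bmeas_norm.
    apply: le_mean => [||y]; [exact: bmeasM|exact/bmeasZ/bmeas_norm|].
    by rewrite (le_trans (ler_norm _))// normrM ler_wpM2r.
  rewrite ler_pdivlMr//; move: h; rewrite leNgt => h.
  by rewrite leNgt; apply/negP => h'; move: h; apply/negP/negPn; nra.
have bL y : `|b y| <= L.
  by have /andP[bm bL] := bmL y; rewrite ger0_norm// (le_trans _ bm)// ltW.
have NA : 0 <= 2 * N * (L / m) by rewrite !mulr_ge0// ?invr_ge0 ltW.
rewrite /stab -mulrA; apply: (norm_additive_le x ae).
  move=> i y; have := cmean_decorrelate uP i y bb be ae bL.
  rewrite -(cmean_aproj uP i y bbe).
  have -> : aproj (fun x => b x * e x) = aproj f by apply/funext.
  rewrite (cmean_aproj uP i y bf) -/A => h.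
  have bi : m <= cmean i b y.
    by apply: ge_mean_cst => [|z]; [exact: (bmeas_res uP)|have /andP[] := bmL (u i y z)].
  have h2 : `|cmean i f y| <= M by exact: norm_cmean_le.
  have h3 : m * `|cmean i e y| <= M + L * (2 * N * (M / m)).
    apply: (@le_trans _ _ `|cmean i b y * cmean i e y|).
      rewrite normrM ler_wpM2r// ger0_norm//.
      by rewrite (le_trans _ bi)// ltW.
    have -> : cmean i b y * cmean i e y = cmean i f y - (cmean i f y - cmean i b y * cmean i e y).
      by ring.
    rewrite (le_trans (ler_normB _ _))// lerD// (le_trans h)// ler_wpM2l ?(ltW L0)//.
    by rewrite ler_wpM2l// mulr_ge0.
  rewrite mulrDl -[leLHS]addr0 lerD//; last by rewrite !mulr_ge0// invr_ge0 ltW.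
  rewrite mulrAC ler_pdivlMr// mulrC (le_trans h3)//.
  by rewrite le_eqVlt; apply/orP; left; apply/eqP; ring.
apply: (le_trans (le_norm_mean P be)); apply: (le_trans AM).
rewrite mulrDl mul1r (mulrC m^-1) lerDr mulr_ge0//.
by rewrite divr_ge0 ?(ltW m0)// addr_ge0.
Qed.

(** The affine case of [relaxation_zero], all the additive functions being
allowed. *)
Lemma weighted_solve b f (m L : R) : 0 < m -> m <= L ->
  bmeas b -> bmeas f -> (forall x, m <= b x <= L) ->
  exists e, [/\ bmeas e, additive e &
    forall x, aproj (fun x => b x * e x) x = aproj f x].
Proof.
move=> m0 mL bb bf bmL.
pose D S := bmeas S /\ additive S.
pose G S x := aproj (fun x => b x * S x) x - aproj f x.
have [|||||S [[bS aS] h]] := @relaxation_zero D G m L (fun=> 0) m0 mL.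
- by split; [exact: bmeas_cst|move=> x; rewrite aproj_cst].
- by [].
- move=> s S Ds sS; split.
    by apply: bmeas_unif_lim sS => n; case: (Ds n).
  by apply: additive_unif_lim sS => n; case: (Ds n).
- move=> S S' [bS aS] [bS' aS']; exists b; split => // x.
  have sub2 (p q r : R) : p - r - (q - r) = p - q by ring.
  rewrite /G sub2 -aprojB//; [|exact: bmeasM|exact: bmeasM].
  by congr aproj; apply/funext => y; ring.
- move=> S [bS aS].
  have bbS : bmeas (fun x => b x * S x) by exact: bmeasM.
  have bG : bmeas (G S) by apply: bmeasB; exact: bmeas_aproj.
  split; first exact: bmeas_relax.
  apply: additive_relax => // x; rewrite /G aprojB//; [|exact: bmeas_aproj|exact: bmeas_aproj].
  by rewrite !additive_aproj.
exists S; split => // x.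
by have /eqP := h x; rewrite subr_eq0 => /eqP.
Qed.

End relaxation.

(** * Schroedinger potentials *)

Section exponential_slope.
Context {R : realType}.
Implicit Types (x y z : R).

Lemma expR_tangent x y : expR y * (x - y) <= expR x - expR y.
Proof.
have := expR_ge1Dx (x - y); have := expR_gt0 y.
by rewrite expRD expRN => y0 h; have := ler_wpM2l (ltW y0) h;
  rewrite mulrCA divff ?gt_eqF// mulr1; lra.
Qed.

(** The divided difference of the exponential. The denominator is a real
power, which is measurable at 0 as well. *)
Definition expR_slope x y : R :=
  if x == y then expR y
  else (expR x - expR y) * (x - y) * ((x - y) ^+ 2) `^ (-1).

Lemma expR_slopeE x y : expR x - expR y = expR_slope x y * (x - y).
Proof.
rewrite /expR_slope; case: eqVneq => [->|xy]; first by rewrite !subrr mulr0.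
by rewrite powR_inv1 ?sqr_ge0//; field; rewrite subr_eq0.
Qed.

Lemma expR_slope_itv a b x y : a <= x <= b -> a <= y <= b ->
  expR a <= expR_slope x y <= expR b.
Proof.
wlog xy : x y / y < x => [H ax ay|].
  have [yx|xy|->] := ltgtP y x; first exact: H.
    have -> : expR_slope x y = expR_slope y x; last exact: H.
    apply: (@mulIf _ (x - y)); first by rewrite subr_eq0 lt_eqF.
    by rewrite -expR_slopeE -[RHS]opprK -mulrN opprB -expR_slopeE opprB.
  by rewrite /expR_slope eqxx !ler_expR.
move=> /andP[ax xb] /andP[ay yb].
have xy0 : 0 < x - y by rewrite subr_gt0.
apply/andP; split; rewrite -(ler_pM2r xy0) -expR_slopeE.
  apply: le_trans (expR_tangent x y); rewrite ler_pM2r//; by rewrite ler_expR.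
have := expR_tangent y x; have : expR x <= expR b by rewrite ler_expR.
move=> /(ler_wpM2r (ltW xy0)); lra.
Qed.

(** A relaxation step for the scalar equation [expR x * Q = 1] is increasing
as long as it does not overshoot; ordered bounds on the unknown are therefore
preserved. *)
Lemma relax_mono tau (Q x y : R) : 0 <= tau -> 0 <= Q -> x <= y ->
  tau * (expR y * Q) <= 1 ->
  x - tau * (expR x * Q - 1) <= y - tau * (expR y * Q - 1).
Proof.
move=> t0 Q0 xy h.
have := expR_tangent x y; rewrite -subr_ge0 => /(mulr_ge0 (mulr_ge0 t0 Q0)).
have : 0 <= (1 - tau * (expR y * Q)) * (y - x) by rewrite mulr_ge0 ?subr_ge0.
nra.
Qed.

Context {d : measure_display} {T : measurableType d}.

Lemma bmeas_expR_slope (f g : T -> R) : bmeas f -> bmeas g ->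
  bmeas (fun t => expR_slope (f t) (g t)).
Proof.
move=> [mf [A fA]] [mg [B gB]]; split.
  apply: measurable_fun_ifT.
  - exact: measurable_fun_eqr.
  - exact: measurableT_comp.
  - apply: measurable_funM.
      apply: measurable_funM; apply: measurable_funB => //; exact: measurableT_comp.
    have m2 : measurable_fun setT (fun t => (f t - g t) ^+ 2).
      by apply: measurable_funX; exact: measurable_funB.
    exact: (measurableT_comp (measurable_powR (-1)) m2).
exists (expR (A + B)) => t.
have h1 : - (A + B) <= f t <= A + B.
  have := fA t; have := gB t; rewrite !ler_norml => /andP[? ?] /andP[? ?].
  by apply/andP; split; lra.
have h2 : - (A + B) <= g t <= A + B.
  have := fA t; have := gB t; rewrite !ler_norml => /andP[? ?] /andP[? ?].
  by apply/andP; split; lra.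
have /andP[l r] := expR_slope_itv h1 h2.
by rewrite ger0_norm// (le_trans _ l)// expR_ge0.
Qed.

End exponential_slope.

Section schrodinger.
Context {R : realType} {d : measure_display} {T : measurableType d}.
Context {I : finType} (P : probability T R) (u : I -> T -> T -> T).
Hypothesis uP : resampling P u.
Implicit Types (f g e b S c : T -> R) (i : I).

Local Notation cmean := (cmean P u).
Local Notation aproj := (aproj P u).
Local Notation mean := (mean P).
Local Notation additive := (additive_fun P u).
Let N : R := #|I|%:R.

Let N0 : 0 <= N. Proof. exact: ler0n. Qed.

(** The Schroedinger system: the density [expR (S - c)] has the same
conditional means as the constant 1. The unknown is one additive function
rather than a family of functions of one coordinate, which removes the
indeterminacy of their additive constants. *)
Definition potential c S := [/\ bmeas S, additive S &
  forall x, aproj (fun x => expR (S x - c x)) x = 1].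

(** The right-hand side is free of [x]: how much the [i]-th conditional mean
of [expR (S - c)] oscillates, apart from the component of [S] itself, is
decided by [c]. *)
Lemma additive_offE i S x z : bmeas S -> additive S ->
  S (u i x z) - cmean i S (u i x z) =
  \sum_(j | j != i) (cmean j S z - mean S).
Proof.
move=> bS aS; rewrite -{1}[S (u i x z)]aS aprojE (bigD1 i)//=.
rewrite (eq_bigr (fun j => cmean j S z - mean S)); first by ring.
move=> j ji; congr (_ - _).
by rewrite -(rowdep_cmean uP j S (u i x z) z) (res_indep uP)// rowdep_cmean.
Qed.

(** Each component oscillates by at most [2 * C], so that [S] is within
[N * (2 * C)] of its mean; the mean itself is at most [N * (2 * C) + C]. *)
Definition potential_bound (C : R) := 2 * (N * (2 * C) + C).

(** Relaxation started at 0 preserves the bound [2 * C] on the oscillation of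
the components and the bound on the mean: by [relax_mono], each of these
scalar quantities is compared with a constant which it cannot cross. On this
domain [S - c] is bounded, so the slopes of the exponential lie between two
positive constants and [relaxation_zero] applies. *)
Lemma potential_exists c (C : R) : bmeas c -> (forall x, `|c x| <= C) ->
  exists S, potential c S /\ forall x, `|S x| <= potential_bound C.
Proof.
move=> bc cC.
have C0 : 0 <= C.
  by have [x _] := prob_inhabited P; exact: le_trans (cC x).
pose A := 2 * C; pose w := N * A + C.
have A0 : 0 <= A by rewrite /A; lra.
have NA0 : 0 <= N * A by rewrite mulr_ge0.
have w0 : 0 <= w by rewrite /w; lra.
pose D S := [/\ bmeas S, additive S, (forall i x y, cmean i S x - cmean i S y <= A) &
  `|mean S| <= w].
pose p S x := expR (S x - c x).
pose G S x := aproj (p S) x - 1.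
pose m := expR (- (2 * w)); pose L := expR (2 * w + 2 * A).
have m0 : 0 < m by exact: expR_gt0.
have mL : m <= L by rewrite ler_expR; lra.
have L0 : 0 < L by exact: expR_gt0.
have bp S : bmeas S -> bmeas (p S) by move=> bS; apply/bmeas_expR/bmeasB.
have DS S : D S -> forall x, `|S x - mean S| <= N * A.
  move=> [bS aS oS _] x; rewrite -{1}[S x]aS aprojE addrK.
  rewrite (le_trans (ler_norm_sum _ _ _))//.
  apply: (@le_trans _ _ (\sum_(i : I) A)); last first.
    by rewrite sumr_const -[leLHS]mulr_natl.
  apply: ler_sum => i _; rewrite -(mean_cmean uP i bS).
  have bi := bmeas_cmean uP i bS.
  rewrite -(mean_cst P (cmean i S x)) -meanB//; last exact: bmeas_cst.
  apply: norm_mean_le => [|y]; first by apply: bmeasB => //; exact: bmeas_cst.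
  by rewrite ler_norml lerNl opprB !oS.
have DSc S : D S -> forall x, - (2 * w) <= S x - c x <= 2 * w.
  move=> DS0; have [bS aS oS mS] := DS0; move=> x.
  have := DS _ DS0 x; move: mS; have := cC x; rewrite !ler_norml /w.
  by move=> /andP[? ?] /andP[? ?] /andP[? ?]; apply/andP; split; lra.
have tL : m / L ^+ 2 * L <= 1.
  have -> : m / L ^+ 2 * L = m / L by field; rewrite gt_eqF.
  by rewrite ler_pdivrMr// mul1r.
have t0 : 0 <= m / L ^+ 2 by rewrite ltW// divr_gt0// exprn_gt0.
have tle q : q <= L -> m / L ^+ 2 * q <= 1.
  by move=> qL; apply: le_trans tL; rewrite ler_wpM2l.
have [|||||S [DS0 hS]] := @relaxation_zero _ _ _ _ _ _ uP D G m L (fun=> 0) m0 mL.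
- split; [exact: bmeas_cst|by move=> x; rewrite aproj_cst| |].
    by move=> i x y; rewrite !cmean_cst subrr.
  by rewrite mean_cst normr0.
- by move=> S [].
- move=> s S Ds sS.
  have bS : bmeas S by apply: bmeas_unif_lim sS => n; case: (Ds n).
  split => //.
  + by apply: (additive_unif_lim uP _ _ sS) => n; case: (Ds n).
  + move=> i x y; apply/ler_addgt0Pr => eps eps0.
    have [n0 h] := sS _ (divr_gt0 eps0 (ltr0n _ 2)).
    have [bs as_ os ms] := Ds n0.
    have hz z : `|cmean i (s n0) z - cmean i S z| <= eps / 2.
      rewrite -cmeanB//; apply: norm_cmean_le => [||v] //; first exact: bmeasB.
      exact: h.
    have := hz x; have := hz y; have := os i x y; rewrite !ler_norml.
    by move=> ? /andP[? ?] /andP[? ?]; lra.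
  + apply/ler_addgt0Pr => eps eps0; have [n0 h] := sS _ eps0.
    have [bs as_ os ms] := Ds n0.
    have -> : mean S = mean (s n0) - (mean (s n0) - mean S) by ring.
    rewrite (le_trans (ler_normB _ _))// lerD// -meanB//.
    by apply: norm_mean_le => [|v]; [exact: bmeasB|exact: h].
- move=> S S' DS1 DS2; have [bS aS oS mS] := DS1; have [bS' aS' oS' mS'] := DS2.
  exists (fun x => expR_slope (S x - c x) (S' x - c x)); split.
  + by apply: bmeas_expR_slope; exact: bmeasB.
  + move=> x; have /andP[l r] := expR_slope_itv (DSc _ DS1 x) (DSc _ DS2 x).
    by rewrite l/= (le_trans r)// ler_expR; lra.
  + move=> x; have sub2 (a b r : R) : a - r - (b - r) = a - b by ring.
    rewrite /G sub2 -aprojB//; [|exact: bp|exact: bp].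
    congr (aproj _ _); apply/funext => y.
    by rewrite /p expR_slopeE sub2.
- move=> S DS1; have [bS aS oS mS] := DS1; have bpS := bp _ bS.
  have bG : bmeas (G S).
    by apply: bmeasB; [exact: bmeas_aproj|exact: bmeas_cst].
  have cG i x : cmean i (G S) x = cmean i (p S) x - 1.
    rewrite cmeanB//; [|exact: bmeas_aproj|exact: bmeas_cst].
    by rewrite cmean_cst cmean_aproj.
  have pL x : p S x <= expR (2 * w).
    by rewrite ler_expR; have /andP[] := DSc _ DS1 x.
  have pm x : expR (- (2 * w)) <= p S x.
    by rewrite ler_expR; have /andP[] := DSc _ DS1 x.
  split.
  + exact: bmeas_relax.
  + apply: additive_relax => // x; rewrite aprojB//; [|exact: bmeas_aproj|exact: bmeas_cst].
    by rewrite aproj_cst additive_aproj.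
  + move=> i x y.
    have bpi : bmeas (fun x => expR (S x - cmean i S x - c x)).
      by apply/bmeas_expR/bmeasB => //; apply: bmeasB => //; exact: bmeas_cmean.
    pose Q := cmean i (fun x => expR (S x - cmean i S x - c x)).
    (* The component of [S] factors out of the conditional mean; the other
    factor [Q] oscillates by a factor [expR A] at most, by [additive_offE]. *)
    have cp z : cmean i (p S) z = expR (cmean i S z) * Q z.
      have di : rowdep u i (fun v => expR (cmean i S v)).
        by move=> v v'; rewrite rowdep_cmean.
      rewrite /Q -(cmeanMl uP z di bpi).
      congr (cmean _ _ _); apply/funext => v.
      by rewrite -expRD /p; congr expR; ring.
    have Q0 z : 0 <= Q z by apply: mean_ge0 => v; exact: expR_ge0.
    have Qxy : Q y <= expR A * Q x.
      rewrite /Q -cmeanZ//.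
      apply: le_mean => [||v];
        [exact: (bmeas_res uP i y bpi)|exact: (bmeas_res uP i x (bmeasZ _ bpi))|].
      rewrite -expRD ler_expR !additive_offE//.
      have := cC (u i x v); have := cC (u i y v); rewrite !ler_norml /A.
      by move=> /andP[? ?] /andP[? ?]; lra.
    have cpL z : cmean i (p S) z <= expR (2 * w).
      by apply: le_mean_cst => [|v]; [exact: (bmeas_res uP)|exact: pL].
    rewrite !cmeanB//; [|exact: bmeasZ|exact: bmeasZ].
    rewrite !cmeanZ// !cG !cp.
    set a := cmean i S x; set b := cmean i S y.
    have ab : a <= b + A by rewrite -lerBlDl; exact: oS.
    have ba : b + A <= a + 2 * A by have := oS i y x; rewrite -/a -/b; lra.
    have h1 : m / L ^+ 2 * (expR (b + A) * Q x) <= 1.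
      apply: tle; apply: (@le_trans _ _ (expR (a + 2 * A) * Q x)).
        by rewrite ler_wpM2r// ler_expR.
      rewrite expRD mulrAC /L expRD ler_wpM2r ?expR_ge0//.
      by rewrite -cp.
    have := relax_mono t0 (Q0 x) ab h1.
    have := ler_wpM2l (mulr_ge0 t0 (expR_ge0 b)) Qxy.
    by rewrite expRD; nra.
  + pose a := mean S; pose W := mean (fun x => expR (S x - a - c x)).
    have bW : bmeas (fun x => expR (S x - a - c x)).
      by apply/bmeas_expR/bmeasB => //; apply: bmeasB => //; exact: bmeas_cst.
    have Sa x : - w <= S x - a - c x <= w.
      have := DS _ DS1 x; have := cC x; rewrite -/a !ler_norml /w.
      by move=> /andP[? ?] /andP[? ?]; apply/andP; split; lra.
    have Wl : expR (- w) <= W.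
      by apply: ge_mean_cst => // x; rewrite ler_expR; have /andP[] := Sa x.
    have Wr : W <= expR w.
      by apply: le_mean_cst => // x; rewrite ler_expR; have /andP[] := Sa x.
    have W0 : 0 <= W by apply: le_trans Wl; exact: expR_ge0.
    have mp : mean (p S) = expR a * W.
      rewrite /W -meanZ//; congr (mean _); apply/funext => x.
      by rewrite -expRD /p; congr expR; ring.
    rewrite meanB//; last exact: bmeasZ.
    rewrite meanZ// meanB//; [|exact: bmeas_aproj|exact: bmeas_cst].
    rewrite mean_cst mean_aproj// mp -/a.
    have [aw wa] : - w <= a /\ a <= w by move: mS; rewrite ler_norml -/a => /andP[].
    have wL : expR w * W <= L.
      apply: (@le_trans _ _ (expR w * expR w)).
        by rewrite ler_wpM2l// expR_ge0.
      by rewrite -expRD ler_expR; lra.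
    have aL : expR a * W <= L.
      by apply: le_trans wL; rewrite ler_wpM2r// ler_expR.
    rewrite ler_norml; apply/andP; split.
      have := relax_mono t0 W0 aw (tle _ aL).
      have : expR (- w) * W <= 1.
        by rewrite expRN mulrC ler_pdivrMr ?expR_gt0// mul1r.
      rewrite -subr_ge0 => /(mulr_ge0 t0); nra.
    have := relax_mono t0 W0 wa (tle _ wL).
    have : 1 <= expR w * W.
      by rewrite mulrC -ler_pdivrMr ?expR_gt0// mul1r -expRN.
    rewrite -subr_ge0 => /(mulr_ge0 t0); nra.
have [bS aS oS mS] := DS0; exists S; split; last first.
  move=> x; have := DS _ DS0 x; move: mS; rewrite !ler_norml /potential_bound /w -/A.
  by move=> /andP[? ?] /andP[? ?]; apply/andP; split; lra.
by split => // x; have /eqP := hS x; rewrite subr_eq0 => /eqP.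
Qed.

(** Built from the least bound of [c], the potential obeys the estimate for
all the bounds of [c] at once; potentials chosen along a curve of costs are
then locally bounded together. *)
Lemma potential_exists_sharp c : bmeas c -> exists S, potential c S /\
  forall C : R, (forall x, `|c x| <= C) -> forall x, `|S x| <= potential_bound C.
Proof.
move=> bc; have [_ [M cM]] := bc; have [x0 _] := prob_inhabited P.
pose A := [set `|c x| | x in setT].
have supA x : `|c x| <= sup A.
  by apply: ub_le_sup; [exists M => _ [y _ <-]|exists x].
have [S [hS SB]] := potential_exists bc supA.
exists S; split => // C cC x; apply: (le_trans (SB x)).
have AC : sup A <= C.
  by apply: ge_sup; [exists `|c x0|, x0|move=> _ [y _ <-]].
have : N * (2 * sup A) <= N * (2 * C) by rewrite ler_wpM2l// ler_wpM2l.
by rewrite /potential_bound; lra.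
Qed.

End schrodinger.

(** * Smooth curves for the sup norm *)

Section curves.
Context {R : realType} {d : measure_display} {T : measurableType d}.
Implicit Types (u v w : R -> T -> R) (t s eps : R).

Lemma expR_quadratic (x : R) : 0 <= expR x - 1 - x <= x ^+ 2 * expR `|x|.
Proof.
apply/andP; split; first by have := expR_ge1Dx x; lra.
have := expR_tangent 0 x; rewrite expR0 sub0r => h1.
have [x0|x0] := leP 0 x.
  have h2 : expR x - 1 <= x * expR x by lra.
  by rewrite ger0_norm//; have := ler_wpM2l x0 h2; lra.
have e1 : 1 <= expR `|x| by rewrite -[leLHS]expR0 ler_expR.
have := expR_ge1Dx x => h2.
have : expR x <= 1 by rewrite -expR0 ler_expR ltW.
have := ler_wpM2l (sqr_ge0 x) e1; nra.
Qed.

Lemma expR_remainder (x a : R) : `|x| <= a -> a <= 1 ->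
  `|expR x - 1 - x| <= a ^+ 2 * expR 1.
Proof.
move=> xa a1; have /andP[q0 q1] := expR_quadratic x.
rewrite ger0_norm// (le_trans q1)// ler_pM ?sqr_ge0 ?expR_ge0//; last first.
  by rewrite ler_expR (le_trans xa).
by rewrite -real_normK ?num_real// lerXn2r ?nnegrE// (le_trans _ xa).
Qed.

Definition unif_cont u := forall t eps, 0 < eps ->
  \forall s \near t, forall x, `|u s x - u t x| <= eps.

Definition unif_deriv u u' := forall t eps, 0 < eps ->
  \forall s \near t, forall x,
    `|u s x - u t x - (s - t) * u' t x| <= eps * `|s - t|.

(** Curves of class C^k with values in the bounded measurable functions, for
the sup norm. *)
Fixpoint smooth_curve k u : Prop :=
  (forall t, bmeas (u t)) /\
  match k with
  | 0 => unif_cont u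
  | k'.+1 => exists2 u', smooth_curve k' u' & unif_deriv u u'
  end.

Lemma smooth_curve_bmeas k u : smooth_curve k u -> forall t, bmeas (u t).
Proof. by case: k => [|k] []. Qed.

Lemma near_and t (A B : set R) : nbhs t A -> nbhs t B -> nbhs t (A `&` B).
Proof. exact: filterI. Qed.

Lemma near_dist_lt t (eps : R) : 0 < eps -> \forall s \near t, `|s - t| <= eps.
Proof.
by move=> e0; apply/nbhs_ballP; exists eps => //= s; rewrite /ball/= distrC => /ltW.
Qed.

Lemma unif_deriv_lipschitz u u' t : bmeas (u' t) -> unif_deriv u u' ->
  exists2 K : R, 0 <= K & \forall s \near t, forall x,
    `|u s x - u t x| <= K * `|s - t|.
Proof.
move=> [_ [M hM]] du; exists (1 + `|M|); first by rewrite addr_ge0.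
apply: filterS (du t 1 ltr01) => s h x.
have -> : u s x - u t x = (u s x - u t x - (s - t) * u' t x) + (s - t) * u' t x.
  by ring.
rewrite (le_trans (ler_normD _ _))// [leRHS]mulrDl lerD//.
by rewrite normrM mulrC ler_wpM2r// (le_trans (hM x))// ler_norm.
Qed.

Lemma unif_deriv_cont u u' : (forall t, bmeas (u' t)) -> unif_deriv u u' ->
  unif_cont u.
Proof.
move=> bu' du t eps e0; have [K K0 hK] := unif_deriv_lipschitz (bu' t) du.
have K1 : 0 < K + 1 by lra.
apply: filterS2 hK (near_dist_lt t (divr_gt0 e0 K1)) => s h1 h2 x.
apply: (le_trans (h1 x)); apply: (le_trans (ler_wpM2l K0 h2)).
by rewrite mulrA ler_pdivrMr// mulrC ler_pM2l//; lra.
Qed.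

Lemma smooth_curve_cont k u : smooth_curve k u -> unif_cont u.
Proof.
case: k => [|k] [bu]// [u' su' du].
by apply: unif_deriv_cont du => t; exact: smooth_curve_bmeas su' t.
Qed.

Lemma smooth_curveS k u : smooth_curve k.+1 u -> smooth_curve k u.
Proof.
elim: k u => [|k IH] u su.
  by split; [exact: smooth_curve_bmeas su|exact: smooth_curve_cont su].
have [bu [u' su' du]] := su; split => //; exists u' => //; exact: IH.
Qed.

Lemma unif_cont_bounded u t : bmeas (u t) -> unif_cont u ->
  exists2 M : R, 0 <= M & \forall s \near t, forall x, `|u s x| <= M.
Proof.
move=> [_ [M hM]] cu; exists (1 + `|M|); first by rewrite addr_ge0.
apply: filterS (cu t 1 ltr01) => s h x.
have -> : u s x = (u s x - u t x) + u t x by ring.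
by rewrite (le_trans (ler_normD _ _))// lerD// (le_trans (hM x))// ler_norm.
Qed.

Lemma smooth_curve_cst k (f : T -> R) : bmeas f -> smooth_curve k (fun=> f).
Proof.
elim: k f => [|k IH] f bf; split => //.
  by move=> t eps e0; near=> s => x; rewrite subrr normr0 ltW.
exists (fun _ _ => 0); first exact/IH/bmeas_cst.
move=> t eps e0; near=> s => x.
by rewrite subrr mulr0 subrr normr0 mulr_ge0// ltW.
Unshelve. all: by end_near. Qed.

Lemma smooth_curveD k u v : smooth_curve k u -> smooth_curve k v ->
  smooth_curve k (fun t x => u t x + v t x).
Proof.
elim: k u v => [|k IH] u v su sv; (split=> [t|];
  first by apply: bmeasD; [exact: smooth_curve_bmeas su t|exact: smooth_curve_bmeas sv t]).
  have [bu cu] := su; have [bv cv] := sv.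
  move=> t eps e0; have e2 : 0 < eps / 2 by rewrite divr_gt0.
  apply: filterS2 (cu t _ e2) (cv t _ e2) => s h1 h2 x.
  rewrite opprD addrACA (le_trans (ler_normD _ _))//.
  by rewrite [leRHS]splitr lerD.
have [bu [u' su' du]] := su; have [bv [v' sv' dv]] := sv.
exists (fun t x => u' t x + v' t x); first exact: IH.
move=> t eps e0; have e2 : 0 < eps / 2 by rewrite divr_gt0.
apply: filterS2 (du t _ e2) (dv t _ e2) => s h1 h2 x.
have -> : u s x + v s x - (u t x + v t x) - (s - t) * (u' t x + v' t x) =
  (u s x - u t x - (s - t) * u' t x) + (v s x - v t x - (s - t) * v' t x) by ring.
rewrite (le_trans (ler_normD _ _))//.
by rewrite [in leRHS](splitr eps) [leRHS]mulrDl lerD.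
Qed.

Lemma smooth_curveM k u v : smooth_curve k u -> smooth_curve k v ->
  smooth_curve k (fun t x => u t x * v t x).
Proof.
elim: k u v => [|k IH] u v su sv; (split=> [t|];
  first by apply: bmeasM; [exact: smooth_curve_bmeas su t|exact: smooth_curve_bmeas sv t]).
  have [bu cu] := su; have [bv cv] := sv.
  move=> t eps e0.
  have [A A0 hA] := unif_cont_bounded (bu t) cu.
  have [B hB] : exists M : R, forall x, `|v t x| <= M by case: (bv t).
  have D0 : 0 < A + `|B| + 1 by rewrite ltr_wpDl// addr_ge0.
  have e2 : 0 < eps / (A + `|B| + 1) by rewrite divr_gt0.
  apply: filterS3 hA (cu t _ e2) (cv t _ e2) => s h0 h1 h2 x.
  have -> : u s x * v s x - u t x * v t x =
    u s x * (v s x - v t x) + v t x * (u s x - u t x) by ring.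
  rewrite (le_trans (ler_normD _ _))// !normrM.
  apply: (@le_trans _ _ (A * (eps / (A + `|B| + 1)) + `|B| * (eps / (A + `|B| + 1)))).
    by rewrite lerD// ler_pM// (le_trans (hB x))// ler_norm.
  by rewrite -mulrDl mulrA ler_pdivrMr// mulrC ler_pM2l//; lra.
have [bu [u' su' du]] := su; have [bv [v' sv' dv]] := sv.
exists (fun t x => u' t x * v t x + u t x * v' t x).
  by apply: smooth_curveD; apply: IH => //; exact: smooth_curveS.
move=> t eps e0.
have [K K0 hK] := unif_deriv_lipschitz (smooth_curve_bmeas su' t) du.
have [A hA] : exists M : R, forall x, `|u t x| <= M by case: (bu t).
have [B hB] : exists M : R, forall x, `|v t x| <= M by case: (bv t).
have D0 : 0 < `|A| + `|B| + K + 1 by rewrite ltr_wpDl// !addr_ge0.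
set D := `|A| + `|B| + K + 1 in D0.
have e2 : 0 < eps / D by rewrite divr_gt0.
have hI := near_and hK (smooth_curve_cont sv t e2).
apply: filterS3 (du t _ e2) (dv t _ e2) hI => s h1 h2 [h3 h4] x.
have -> : u s x * v s x - u t x * v t x - (s - t) * (u' t x * v t x + u t x * v' t x) =
  (u s x - u t x - (s - t) * u' t x) * v t x +
  u t x * (v s x - v t x - (s - t) * v' t x) +
  (u s x - u t x) * (v s x - v t x) by ring.
apply: (@le_trans _ _ (eps / D * `|s - t| * `|B| + `|A| * (eps / D * `|s - t|) +
   K * `|s - t| * (eps / D))).
  rewrite (le_trans (ler_normD _ _))// lerD//; last by rewrite normrM ler_pM.
  rewrite (le_trans (ler_normD _ _))// !normrM lerD// ler_pM//.
    by rewrite (le_trans (hB x))// ler_norm.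
  by rewrite (le_trans (hA x))// ler_norm.
have -> : eps / D * `|s - t| * `|B| + `|A| * (eps / D * `|s - t|) +
   K * `|s - t| * (eps / D) = (`|A| + `|B| + K) / D * (eps * `|s - t|) by ring.
rewrite -[leRHS]mul1r ler_wpM2r//; first by rewrite mulr_ge0// ltW.
by rewrite ler_pdivrMr// mul1r /D; lra.
Qed.

Lemma smooth_curveN k u : smooth_curve k u -> smooth_curve k (fun t x => - u t x).
Proof.
move=> su; have := smooth_curveM (smooth_curve_cst k (bmeas_cst (-1))) su.
congr smooth_curve; apply/funext => t; apply/funext => x; exact: mulN1r.
Qed.

Lemma smooth_curveB k u v : smooth_curve k u -> smooth_curve k v ->
  smooth_curve k (fun t x => u t x - v t x).
Proof. by move=> su sv; apply: smooth_curveD => //; exact: smooth_curveN. Qed.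

Lemma smooth_curve_sum k (J : Type) (r : seq J) (F : J -> R -> T -> R) :
  (forall j, smooth_curve k (F j)) ->
  smooth_curve k (fun t x => \sum_(j <- r) F j t x).
Proof.
move=> sF; elim: r => [|j r IH].
  have := smooth_curve_cst k (bmeas_cst (0 : R)).
  congr smooth_curve; apply/funext => t; apply/funext => x; by rewrite big_nil.
have := smooth_curveD (sF j) IH.
congr smooth_curve; apply/funext => t; apply/funext => x; by rewrite big_cons.
Qed.

Lemma smooth_curve_expR k u : smooth_curve k u ->
  smooth_curve k (fun t x => expR (u t x)).
Proof.
elim: k u => [|k IH] u su; (split=> [t|];
  first by apply: bmeas_expR; exact: smooth_curve_bmeas su t).
  have [bu cu] := su; move=> t eps e0.
  have [A A0 hA] := unif_cont_bounded (bu t) cu.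
  have hAt : forall x, `|u t x| <= A by exact: nbhs_singleton hA.
  have e2 : 0 < eps / expR A by rewrite divr_gt0// expR_gt0.
  apply: filterS2 hA (cu t _ e2) => s h0 h1 x.
  rewrite expR_slopeE normrM mulrC.
  have b1 : - A <= u s x <= A by rewrite -ler_norml.
  have b2 : - A <= u t x <= A by rewrite -ler_norml.
  have /andP[l r] := expR_slope_itv b1 b2.
  rewrite (ger0_norm (le_trans (expR_ge0 _) l)).
  apply: (@le_trans _ _ (eps / expR A * expR A)).
    by rewrite ler_pM// (le_trans (expR_ge0 _) l).
  by rewrite divfK// gt_eqF// expR_gt0.
have [bu [u' su' du]] := su.
exists (fun t x => u' t x * expR (u t x)).
  by apply: smooth_curveM => //; apply: IH; exact: smooth_curveS.
move=> t eps e0.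
have [K K0 hK] := unif_deriv_lipschitz (smooth_curve_bmeas su' t) du.
have [A hA] : exists M : R, forall x, `|u t x| <= M by case: (bu t).
pose D := expR A * (1 + K ^+ 2 * expR 1).
have D0 : 0 < D.
  by rewrite mulr_gt0 ?expR_gt0// ltr_wpDr// mulr_ge0 ?sqr_ge0 ?expR_ge0.
have e2 : 0 < eps / D by rewrite divr_gt0.
have K1 : 0 < 1 / (K + 1) by rewrite divr_gt0//; lra.
have hI := near_and (near_dist_lt t e2) (near_dist_lt t K1).
apply: filterS3 (du t _ e2) hK hI => s h1 h2 [h3 h4] x.
set del := u s x - u t x.
have -> : expR (u s x) = expR (u t x) * expR del.
  by rewrite -expRD /del; congr expR; ring.
have -> : expR (u t x) * expR del - expR (u t x) - (s - t) * (u' t x * expR (u t x)) =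
  expR (u t x) * ((expR del - 1 - del) + (del - (s - t) * u' t x)) by ring.
rewrite normrM (ger0_norm (expR_ge0 _)).
have dK : `|del| <= K * `|s - t| by exact: h2.
have Kh1 : K * `|s - t| <= 1.
  apply: (le_trans (ler_wpM2l K0 h4)).
  by rewrite mulrA mulr1 ler_pdivrMr; lra.
apply: (@le_trans _ _ (expR A * (K ^+ 2 * expR 1 * (eps / D) * `|s - t| + eps / D * `|s - t|))).
  rewrite ler_pM ?expR_ge0// ?ler_expR; first exact: le_trans (ler_norm _) (hA x).
  rewrite (le_trans (ler_normD _ _))// lerD//; last exact: h1.
  apply: (le_trans (expR_remainder dK Kh1)).
  have -> : (K * `|s - t|) ^+ 2 * expR 1 = K ^+ 2 * expR 1 * `|s - t| * `|s - t|.
    by ring.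
  by rewrite ler_wpM2r// ler_wpM2l// mulr_ge0 ?sqr_ge0 ?expR_ge0.
have -> : expR A * (K ^+ 2 * expR 1 * (eps / D) * `|s - t| + eps / D * `|s - t|) =
  D * (eps / D) * `|s - t| by move: (eps / D) => q; rewrite /D; ring.
by rewrite mulrCA divff ?mulr1// gt_eqF.
Qed.

Context (P : probability T R).

Lemma Ck_lineS k (f g : R -> R) : (forall t, is_derive t 1 f (g t)) ->
  Ck_line k g -> Ck_line k.+1 f.
Proof.
move=> fg [dg cg].
have f1 : derive1 f = g.
  by apply/funext => t; rewrite derive1E; apply: derive_val; exact: fg.
split=> [[|j] jk x|[|j] jk].
- by have [] := fg x.
- by rewrite derive1Sn f1; exact: dg.
- by move=> x; apply: differentiable_continuous; apply/derivable1_diffP; have [] := fg x.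
- by rewrite derive1Sn f1; exact: cg.
Qed.

Lemma quotient_is_derive (f : R -> R) (t a : R) :
  (forall eps, 0 < eps -> \forall s \near t,
    `|f s - f t - (s - t) * a| <= eps * `|s - t|) -> is_derive t 1 f a.
Proof.
move=> h.
have key : h^-1 *: (f (h *: 1 + t) - f t) @[h --> 0^'] --> a.
  apply/cvgrPdist_le => eps e0.
  have hn : \forall s \near (0 : R), `|f (s + t) - f t - s * a| <= eps * `|s|.
    have /nbhs_ballP[r /= r0 hr] := h _ e0; apply/nbhs_ballP; exists r => //= s sr.
    have := hr (s + t); rewrite addrK; apply.
    by move: sr; rewrite /ball/= sub0r normrN opprD addrCA subrr addr0 normrN.
  apply: filterS2 (nbhs_dnbhs_neq 0) (nbhs_dnbhs hn) => s s0 hs.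
  rewrite [_ *: 1]mulr1 distrC.
  have -> : s^-1 *: (f (s + t) - f t) - a = s^-1 * (f (s + t) - f t - s * a).
    by rewrite mulrBr mulKf.
  by rewrite normrM normfV ler_pdivrMl ?normr_gt0// (mulrC _ eps).
by apply: DeriveDef; [apply/cvg_ex; exists a|exact: cvg_lim].
Qed.

(** The mean is linear and continuous for the sup norm. *)
Lemma smooth_curve_mean k u : smooth_curve k u ->
  Ck_line k (fun t => mean P (u t)).
Proof.
elim: k u => [|k IH] u su.
  split=> // -[|//] _ t; apply/cvgrPdist_le => eps e0.
  apply: filterS (smooth_curve_cont su t e0) => s h.
  rewrite distrC -meanB; [|exact: smooth_curve_bmeas su s|exact: smooth_curve_bmeas su t].
  apply: norm_mean_le => //.
  by apply: bmeasB; [exact: smooth_curve_bmeas su s|exact: smooth_curve_bmeas su t].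
have [bu [u' su' du]] := su; apply: (@Ck_lineS _ _ (fun t => mean P (u' t))); last exact: IH.
move=> t; apply: quotient_is_derive => eps e0.
apply: filterS (du t _ e0) => s h.
have bu' := smooth_curve_bmeas su' t.
rewrite -meanZ// -!meanB//; [|exact: bmeasB|exact: bmeasZ].
apply: norm_mean_le => //.
by apply: bmeasB; [exact: bmeasB|exact: bmeasZ].
Qed.

End curves.

(** * Potentials along a curve of costs *)

Section potential_curves.
Context {R : realType} {d : measure_display} {T : measurableType d}.
Context {I : finType} (P : probability T R) (u : I -> T -> T -> T).
Hypothesis uP : resampling P u.

Local Notation cmean := (cmean P u).
Local Notation aproj := (aproj P u).
Local Notation mean := (mean P).
Local Notation additive := (additive_fun P u).
Local Notation potential := (potential P u).
Implicit Types (f g e b S : T -> R) (t s eps : R).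

Lemma bounded_below_near (p : R -> T -> R) t (m : R) : 0 < m ->
  bmeas (p t) -> unif_cont p -> (forall x, m <= p t x) ->
  exists2 L : R, m / 2 <= L &
    \forall s \near t, forall x, m / 2 <= p s x <= L.
Proof.
move=> m0 bp cp pm; have [M M0 hM] := unif_cont_bounded bp cp.
have m2 : 0 < m / 2 by rewrite divr_gt0.
exists (M + m / 2); first by lra.
apply: filterS2 hM (cp t _ m2) => s h1 h2 x.
have := h1 x; have := h2 x; have := pm x; rewrite !ler_norml.
by move=> ? /andP[? ?] /andP[? ?]; apply/andP; split; lra.
Qed.

Lemma bounded_weight (p : T -> R) (m : R) : bmeas p -> (forall x, m <= p x) ->
  exists2 L : R, m <= L & forall x, m <= p x <= L.
Proof.
move=> [_ [L pL]] pm; have h x : m <= p x <= L.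
  by rewrite pm/=; exact: le_trans (ler_norm _) (pL x).
exists L => //; have [x _] := prob_inhabited P.
by have /andP[] := h x; exact: le_trans.
Qed.

Lemma weighted_solutions (p f : R -> T -> R) :
  (forall t, bmeas (p t)) -> (forall t, bmeas (f t)) ->
  (forall t, exists2 m, 0 < m & forall x, m <= p t x) ->
  exists e : R -> T -> R, forall t, [/\ bmeas (e t), additive (e t) &
    forall x, aproj (fun x => p t x * e t x) x = aproj (f t) x].
Proof.
move=> bp bf p0; have ex t : {e : T -> R | [/\ bmeas e, additive e &
    forall x, aproj (fun x => p t x * e x) x = aproj (f t) x]}.
  apply: cid; have [m m0 pm] := p0 t.
  have [L mL pmL] := bounded_weight (bp t) pm.
  exact: (weighted_solve uP m0 mL (bp t) (bf t) pmL).
by exists (fun t => sval (ex t)) => t; exact: svalP (ex t).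
Qed.

(** Differentiating [aproj (p * e) = aproj f] gives an equation of the same
form for the derivative of [e], with source [f' - p' * e]. It is solvable by
[weighted_solve]; [weighted_stability] bounds the remainder of the expansion
of [e], and [e] is as smooth as the data by induction. *)
Lemma weighted_curve k (p f e : R -> T -> R) :
  smooth_curve k p -> smooth_curve k f ->
  (forall t, exists2 m, 0 < m & forall x, m <= p t x) ->
  (forall t, [/\ bmeas (e t), additive (e t) &
     forall x, aproj (fun x => p t x * e t x) x = aproj (f t) x]) ->
  smooth_curve k e.
Proof.
move=> sp + p0; elim: k p sp p0 f e => [|k IH] p sp p0 f e sf he.
  split=> [t|t eps eps0]; first by have [] := he t.
  have [m m0 pm] := p0 t; have m2 : 0 < m / 2 by rewrite divr_gt0.
  have bp := smooth_curve_bmeas sp; have bf := smooth_curve_bmeas sf.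
  have cp := smooth_curve_cont sp; have cf := smooth_curve_cont sf.
  have [L mL hL] := bounded_below_near m0 (bp t) cp pm.
  have [bet aet het] := he t.
  have [M hM] : exists M : R, forall x, `|e t x| <= M by case: bet.
  have st0 := stab_ge0 (I := I) m2 mL.
  set st := stab _ _ in st0.
  pose D := st * (1 + `|M|) + 1.
  have D0 : 0 < D by rewrite /D ltr_wpDl// mulr_ge0// addr_ge0.
  have e2 : 0 < eps / D by rewrite divr_gt0.
  apply: filterS3 hL (cp t _ e2) (cf t _ e2) => s h1 h2 h3 x.
  have [bes aes hes] := he s.
  have bps := bp s; have bpt := bp t; have bfs := bf s; have bft := bf t.
  pose F x := (f s x - f t x) - (p s x - p t x) * e t x.
  have bF : bmeas F by apply: bmeasB; [exact: bmeasB|apply: bmeasM => //; exact: bmeasB].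
  have bes' : bmeas (fun x => e s x - e t x) by exact: bmeasB.
  have aes' : additive (fun x => e s x - e t x).
    by move=> y; rewrite aprojB// aes aet.
  have FM y : `|F y| <= eps / D * (1 + `|M|).
    rewrite (le_trans (ler_normB _ _))// mulrDr mulr1 lerD// normrM ler_pM//.
    by rewrite (le_trans (hM y))// ler_norm.
  have E y : aproj (fun x => p s x * (e s x - e t x)) y = aproj F y.
    have bpe r : bmeas (fun x => p s x * e t x) by exact: bmeasM.
    have -> : F = (fun x => (f s x - p s x * e t x) - (f t x - p t x * e t x)).
      by apply/funext => z; rewrite /F; ring.
    have b1 : bmeas (fun x => p s x * e s x) by exact: bmeasM.
    have b2 : bmeas (fun x => p s x * e t x) by exact: bmeasM.
    have b3 : bmeas (fun x => p t x * e t x) by exact: bmeasM.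
    rewrite (aprojB uP y (bmeasB bfs b2) (bmeasB bft b3)).
    rewrite (aprojB uP y bfs b2) (aprojB uP y bft b3) het subrr subr0 -hes.
    rewrite -(aprojB uP y b1 b2); congr (aproj _ _).
    by apply/funext => z; rewrite mulrBr.
  have := weighted_stability uP m2 bps bes' bF aes' h1 FM E x.
  move=> /le_trans; apply; rewrite -/st.
  rewrite mulrCA [leRHS](_ : _ = eps / D * D); last by rewrite divfK// gt_eqF.
  by rewrite ler_wpM2l ?(ltW e2)// /D; lra.
have [_ [p' sp' dp]] := sp; have [_ [f' sf' df]] := sf.
have spk := smooth_curveS sp; have sfk := smooth_curveS sf.
have sek : smooth_curve k e by exact: (IH p spk p0 f e sfk he).
have bp := smooth_curve_bmeas sp; have bf := smooth_curve_bmeas sf.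
have be := smooth_curve_bmeas sek.
have cp := smooth_curve_cont sp; have cf := smooth_curve_cont sf.
have bp' := smooth_curve_bmeas sp'; have bf' := smooth_curve_bmeas sf'.
have bg t : bmeas (fun x => f' t x - p' t x * e t x).
  by apply: bmeasB => //; exact: bmeasM.
have [e' he'] := weighted_solutions bp bg p0.
split=> //; exists e'.
  apply: (IH p spk p0 _ e' _ he').
  by apply: smooth_curveB => //; exact: smooth_curveM.
move=> t eps eps0.
have [m m0 pm] := p0 t; have m2 : 0 < m / 2 by rewrite divr_gt0.
have [L mL hL] := bounded_below_near m0 (bp t) cp pm.
have [bet aet het] := he t; have [be't ae't he't] := he' t.
have [M hM] : exists M : R, forall x, `|e t x| <= M by case: bet.
have [M' hM'] : exists M : R, forall x, `|e' t x| <= M by case: be't.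
have st0 := stab_ge0 (I := I) m2 mL.
set st := stab _ _ in st0.
pose D := st * (1 + `|M| + `|M'|) + 1.
have D0 : 0 < D by rewrite /D ltr_wpDl// mulr_ge0// !addr_ge0.
have e2 : 0 < eps / D by rewrite divr_gt0.
have hI := near_and hL (cp t _ e2).
apply: filterS3 hI (dp t _ e2) (df t _ e2) => s [h1 h2] h3 h4 x.
have [bes aes hes] := he s.
have bps := bp s; have bpt := bp t; have bfs := bf s; have bft := bf t.
have bp't := bp' t; have bf't := bf' t.
pose h := s - t.
(* The remainder [r] solves the weighted equation at time [s] with source [F];
only the weight at time [s] may be used, since [e s] satisfies the equation at
time [s]. *)
pose F x := (f s x - f t x - h * f' t x) - (p s x - p t x - h * p' t x) * e t x
  - h * ((p s x - p t x) * e' t x).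
pose r x := e s x - e t x - h * e' t x.
have br : bmeas r by apply: bmeasB; [exact: bmeasB|exact: bmeasZ].
have ar : additive r.
  move=> y; rewrite aprojB//; [|exact: bmeasB|exact: bmeasZ].
  by rewrite aprojB// aprojZ// aes aet ae't.
have bpe : bmeas (fun x => p s x * e s x) by exact: bmeasM.
pose F1 x := (f s x - p s x * e t x) - h * (p s x * e' t x).
have b1 : bmeas (fun x => p s x * e t x) by exact: bmeasM.
have b2 : bmeas (fun x => p s x * e' t x) by exact: bmeasM.
have b3 : bmeas (fun x => p t x * e t x) by exact: bmeasM.
have b4 : bmeas (fun x => p t x * e' t x) by exact: bmeasM.
have bF1 : bmeas F1 by apply: bmeasB; [exact: bmeasB|exact: bmeasZ].
pose F2 x := (f t x - p t x * e t x) +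
   h * ((f' t x - p' t x * e t x) - p t x * e' t x).
have bF2 : bmeas F2.
  by apply: bmeasD; [exact: bmeasB|apply: bmeasZ; apply: bmeasB].
have EF : F = (fun x => F1 x - F2 x).
  by apply/funext => z; rewrite /F /F1 /F2; ring.
have bF : bmeas F by rewrite EF; exact: bmeasB.
have F20 y : aproj F2 y = 0.
  rewrite aprojD//; [|exact: bmeasB|by apply: bmeasZ; exact: bmeasB].
  rewrite aprojB// het subrr add0r aprojZ//; last exact: bmeasB.
  by rewrite aprojB// he't subrr mulr0.
have E y : aproj (fun x => p s x * r x) y = aproj F y.
  rewrite EF aprojB// F20 subr0 /F1.
  rewrite aprojB//; [|exact: bmeasB|exact: bmeasZ].
  rewrite aprojB// aprojZ// -hes -aprojB// -aprojZ// -aprojB//; last exact: bmeasZ.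
  - by congr (aproj _ _); apply/funext => z; rewrite /r; ring.
  - exact: bmeasB.
have FM y : `|F y| <= eps / D * (1 + `|M| + `|M'|) * `|h|.
  have -> : eps / D * (1 + `|M| + `|M'|) * `|h| =
     eps / D * `|h| + eps / D * `|h| * `|M| + `|h| * (eps / D * `|M'|) by ring.
  rewrite (le_trans (ler_normB _ _))// lerD//.
    rewrite (le_trans (ler_normB _ _))// lerD//.
    rewrite normrM ler_pM//.
    by rewrite (le_trans (hM y))// ler_norm.
  rewrite !normrM ler_wpM2l// ler_pM//.
  by rewrite (le_trans (hM' y))// ler_norm.
have := weighted_stability uP m2 bps br bF ar h1 FM E x.
move=> /le_trans; apply; rewrite -/st -/h.
have -> : st * (eps / D * (1 + `|M| + `|M'|) * `|h|) =
  eps / D * `|h| * (st * (1 + `|M| + `|M'|)) by ring.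
rewrite [leRHS](_ : _ = eps / D * `|h| * D); last first.
  by rewrite mulrAC divfK// gt_eqF.
apply: ler_wpM2l; last by rewrite /D lerDl.
by apply: mulr_ge0 => //; exact: ltW.
Qed.

(** The difference of two potentials solves a weighted linear equation, the
weight being a divided difference of the exponential. *)
Lemma potential_lipschitz (c S : R -> T -> R) t :
  (forall t, bmeas (c t)) -> unif_cont c -> (forall t, potential (c t) (S t)) ->
  (forall t (C : R), (forall x, `|c t x| <= C) ->
    forall x, `|S t x| <= potential_bound (I := I) C) ->
  exists2 K : R, 0 <= K & \forall s \near t, forall M : R,
    (forall x, `|c s x - c t x| <= M) -> forall x, `|S s x - S t x| <= K * M.
Proof.
move=> bc cc hS hB; have [C C0 hC] := unif_cont_bounded (bc t) cc.
pose w := potential_bound (I := I) C + C.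
have w0 : 0 <= w.
  have : 0 <= #|I|%:R * (2 * C) by apply: mulr_ge0 => //; exact: mulr_ge0.
  by rewrite /w /potential_bound; lra.
pose m := expR (- w); pose L := expR w.
have m0 : 0 < m by exact: expR_gt0.
have L0 : 0 < L by exact: expR_gt0.
have mL : m <= L by rewrite ler_expR; lra.
have hw s : (forall x, `|c s x| <= C) -> forall x, - w <= S s x - c s x <= w.
  move=> hc x; have := hB _ _ hc x; have := hc x; rewrite !ler_norml /w.
  by move=> /andP[? ?] /andP[? ?]; apply/andP; split; lra.
have st0 := stab_ge0 (I := I) m0 mL.
exists (stab (I := I) m L * L); first by rewrite mulr_ge0// ltW.
have ht : forall x, `|c t x| <= C by exact: nbhs_singleton hC.
apply: filterS hC => s hs M hM x.
have [bS aS eS] := hS s; have [bSt aSt eSt] := hS t.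
have bcs := bc s; have bct := bc t.
pose b x := expR_slope (S s x - c s x) (S t x - c t x).
have bb : bmeas b by apply: bmeas_expR_slope; exact: bmeasB.
have bmL y : m <= b y <= L by exact: expR_slope_itv (hw _ hs y) (hw _ ht y).
pose e x := S s x - S t x; pose f x := b x * (c s x - c t x).
have be : bmeas e by exact: bmeasB.
have bf : bmeas f by apply: bmeasM => //; exact: bmeasB.
have ae : additive e by move=> y; rewrite aprojB// aS aSt.
have b1 : bmeas (fun x => expR (S s x - c s x)) by apply/bmeas_expR/bmeasB.
have b2 : bmeas (fun x => expR (S t x - c t x)) by apply/bmeas_expR/bmeasB.
have E y : aproj (fun x => b x * e x) y = aproj f y.
  apply/eqP; rewrite -subr_eq0 -aprojB//; last exact: bmeasM.
  have -> : (fun x => b x * e x - f x) =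
     (fun x => expR (S s x - c s x) - expR (S t x - c t x)).
    by apply/funext => z; rewrite expR_slopeE -/(b z) /f /e; ring.
  by rewrite aprojB// eS eSt subrr.
have fM y : `|f y| <= L * M.
  rewrite normrM ler_pM//; have /andP[l r] := bmL y.
  by rewrite ger0_norm// (le_trans _ l)// ltW.
by rewrite -mulrA; exact: (weighted_stability uP m0 bb be bf ae bmL fM E x).
Qed.

Lemma bmeas_density c S : bmeas c -> bmeas S ->
  bmeas (fun x => expR (S x - c x)).
Proof. by move=> bc bS; apply/bmeas_expR/bmeasB. Qed.

(** The derivative [e] of the potential solves the linearised system
[aproj (p * e) = aproj (p * c')] with [p = expR (S - c)]. If [S] is of class
C^k, so is [p], hence so is [e] by [weighted_curve], and [S] is of class
C^(k+1). *)
Theorem potential_curve k (c S : R -> T -> R) :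
  smooth_curve k c -> (forall t, potential (c t) (S t)) ->
  (forall t (C : R), (forall x, `|c t x| <= C) ->
    forall x, `|S t x| <= potential_bound (I := I) C) ->
  smooth_curve k S.
Proof.
move=> + hS hB; elim: k => [|k IH] sc.
  split=> [t|t eps eps0]; first by have [] := hS t.
  have bc := smooth_curve_bmeas sc; have cc := smooth_curve_cont sc.
  have [K K0 hK] := potential_lipschitz t bc cc hS hB.
  have K1 : 0 < K + 1 by lra.
  have e2 : 0 < eps / (K + 1) by rewrite divr_gt0.
  apply: filterS2 hK (cc t _ e2) => s h1 h2 x.
  apply: (le_trans (h1 _ h2 x)).
  by rewrite mulrA ler_pdivrMr// mulrC ler_pM2l//; lra.
have bc := smooth_curve_bmeas sc; have cc := smooth_curve_cont sc.
have sS := IH (smooth_curveS sc).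
have bS := smooth_curve_bmeas sS.
have [_ [c' sc' dc]] := sc.
have bc' := smooth_curve_bmeas sc'.
pose p t x := expR (S t x - c t x).
have sp : smooth_curve k p.
  by apply: smooth_curve_expR; apply: smooth_curveB => //; exact: smooth_curveS.
have bp := smooth_curve_bmeas sp.
have p0 t : exists2 m, 0 < m & forall x, m <= p t x.
  have [_ [A hA]] := bmeasB (bS t) (bc t).
  exists (expR (- A)) => [|x]; first exact: expR_gt0.
  by rewrite ler_expR; have := hA x; rewrite ler_norml => /andP[].
have bpc t : bmeas (fun x => p t x * c' t x) by exact: bmeasM.
have [e he] := weighted_solutions bp bpc p0.
split=> //; exists e.
  by apply: (weighted_curve sp _ p0 he); exact: smooth_curveM.
move=> t eps eps0.
have [m m0 pm] := p0 t; have [L mL pL] := bounded_weight (bp t) pm.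
have L0 : 0 < L by exact: lt_le_trans mL.
have [K K0 hK] := potential_lipschitz t bc cc hS hB.
have [K' K'0 hK'] := unif_deriv_lipschitz (bc' t) dc.
have st0 := stab_ge0 (I := I) m0 mL.
set st := stab _ _ in st0.
pose Q := (K + 1) * K'.
have Q0 : 0 <= Q by rewrite mulr_ge0// addr_ge0.
pose D := st * (L * (1 + Q ^+ 2 * expR 1)) + 1.
have QQ0 : 0 <= Q ^+ 2 * expR 1 by rewrite mulr_ge0 ?sqr_ge0 ?expR_ge0.
have D0 : 0 < D.
  by rewrite /D ltr_wpDl//; apply: mulr_ge0 => //; apply: mulr_ge0; [exact: ltW|rewrite addr_ge0].
have e2 : 0 < eps / D by rewrite divr_gt0.
have Q1 : 0 < 1 / (Q + 1) by rewrite divr_gt0//; lra.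
have hI := near_and (near_dist_lt t e2) (near_dist_lt t Q1).
have hI2 := near_and hK hK'.
apply: filterS3 hI hI2 (dc t _ e2) => s [h1 h2] [h3 h4] h5 x.
pose h := s - t; rewrite -/h in h1 h2 h3 h4 h5 *.
have [bSs aSs eSs] := hS s; have [bSt aSt eSt] := hS t.
have [bet aet het] := he t.
have bcs := bc s; have bct := bc t; have bc't := bc' t.
have bps := bp s; have bpt := bp t.
pose v x := (S s x - S t x) - (c s x - c t x).
have vQ y : `|v y| <= Q * `|h|.
  rewrite (le_trans (ler_normB _ _))//.
  have -> : Q * `|h| = K * (K' * `|h|) + K' * `|h| by rewrite /Q; ring.
  by rewrite lerD//; exact: h3.
have Qh1 : Q * `|h| <= 1.
  apply: (le_trans (ler_wpM2l Q0 h2)).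
  by rewrite mulrA mulr1 ler_pdivrMr; lra.
pose q x := p t x * (expR (v x) - 1 - v x).
have bv : bmeas v by apply: bmeasB; exact: bmeasB.
have bq : bmeas q.
  by apply: bmeasM => //; apply: bmeasB => //; apply: bmeasB; [exact: bmeas_expR|exact: bmeas_cst].
pose r x := S s x - S t x - h * e t x.
have br : bmeas r by apply: bmeasB; [exact: bmeasB|exact: bmeasZ].
have ar : additive r.
  move=> y; rewrite aprojB//; [|exact: bmeasB|exact: bmeasZ].
  by rewrite aprojB// aprojZ// aSs aSt aet.
(* Expanding [p s = p t * expR v] to first order leaves the remainder [q],
quadratic in [v] and hence in [h]. *)
pose F x := p t x * (c s x - c t x - h * c' t x) - q x.
have bF : bmeas F.
  apply: bmeasB => //; apply: bmeasM => //.
  by apply: bmeasB; [exact: bmeasB|exact: bmeasZ].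
have b1 : bmeas (fun x => p t x * e t x) by exact: bmeasM.
have b2 : bmeas (fun x => p t x * c' t x) by exact: bmeasM.
have E y : aproj (fun x => p t x * r x) y = aproj F y.
  apply/eqP; rewrite -subr_eq0 -aprojB//; last exact: bmeasM.
  have -> : (fun x => p t x * r x - F x) = (fun x =>
     (p s x - p t x) - h * (p t x * e t x - p t x * c' t x)).
    apply/funext => z; have -> : p s z = p t z * expR (v z).
      by rewrite /p -expRD /v; congr expR; ring.
    by rewrite /F /q /v /r; ring.
  rewrite aprojB//; [|exact: bmeasB|by apply: bmeasZ; exact: bmeasB].
  rewrite aprojZ//; last exact: bmeasB.
  by rewrite !aprojB// het eSs eSt !subrr mulr0 subr0.
have FM y : `|F y| <= L * (1 + Q ^+ 2 * expR 1) * (eps / D * `|h|).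
  have -> : L * (1 + Q ^+ 2 * expR 1) * (eps / D * `|h|) =
    L * (eps / D * `|h|) + L * (Q ^+ 2 * expR 1 * (eps / D * `|h|)) by ring.
  have pLy : `|p t y| <= L.
    by have /andP[ml mr] := pL y; rewrite ger0_norm// (le_trans _ ml)// ltW.
  rewrite (le_trans (ler_normB _ _))// !normrM lerD// ler_pM//.
  apply: (le_trans (expR_remainder (vQ y) Qh1)).
  have -> : (Q * `|h|) ^+ 2 * expR 1 = Q ^+ 2 * expR 1 * (`|h| * `|h|) by ring.
  by rewrite ler_wpM2l// ler_wpM2r.
have := weighted_stability uP m0 bpt br bF ar pL FM E x.
move=> /le_trans; apply; rewrite -/st.
have -> : st * (L * (1 + Q ^+ 2 * expR 1) * (eps / D * `|h|)) =
  eps / D * `|h| * (st * (L * (1 + Q ^+ 2 * expR 1))) by ring.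
rewrite [leRHS](_ : _ = eps / D * `|h| * D); last first.
  by rewrite mulrAC divfK// gt_eqF.
apply: ler_wpM2l; last by rewrite /D lerDl.
by apply: mulr_ge0 => //; exact: ltW.
Qed.

(** The measure of density [expR (S - c)] has the same coordinate marginals as
[P]. *)
Lemma potential_mean c S f : bmeas c -> potential c S -> bmeas f -> additive f ->
  mean (fun x => expR (S x - c x) * f x) = mean f.
Proof.
move=> bc [bS aS eS] bf af.
rewrite -(aproj_additive uP (bmeas_density bc bS) bf af).
by congr (mean _); apply/funext => x; rewrite eS mul1r.
Qed.

Lemma potential_mass c S : bmeas c -> potential c S ->
  mean (fun x => expR (S x - c x)) = 1.
Proof.
move=> bc hS; have a1 : additive (fun=> 1) by move=> x; rewrite aproj_cst.
have := potential_mean bc hS (bmeas_cst 1) a1; rewrite mean_cst => <-.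
by congr (mean _); apply/funext => x; rewrite mulr1.
Qed.

Lemma cmean_density c S i x : bmeas c -> potential c S ->
  cmean i (fun x => expR (S x - c x)) x = 1.
Proof.
move=> bc [bS aS eS]; rewrite -(cmean_aproj uP i x (bmeas_density bc bS)).
have -> : aproj (fun x => expR (S x - c x)) = (fun=> 1) by exact/funext.
by rewrite cmean_cst.
Qed.

Section comparison.
Variables (c0 c1 S0 S1 : T -> R).
Hypotheses (bc0 : bmeas c0) (bc1 : bmeas c1).
Hypotheses (hS0 : potential c0 S0) (hS1 : potential c1 S1).
Let p0 x := expR (S0 x - c0 x).
Let v x := c1 x - c0 x.

Let bS0 : bmeas S0. Proof. by case: hS0. Qed.
Let bS1 : bmeas S1. Proof. by case: hS1. Qed.
Let bp0 : bmeas p0. Proof. exact: bmeas_density. Qed.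
Let bv : bmeas v. Proof. exact: bmeasB. Qed.

(** The exponential lies above its tangents. Both densities have mass 1, and
the additive function [S1 - S0] has the same mean under [p0 P] as under [P],
so that only the change of cost remains. *)
Lemma potential_value_le : mean S1 - mean S0 <= mean (fun x => p0 x * v x).
Proof.
have [_ aS0 _] := hS0; have [_ aS1 _] := hS1.
have bS10 : bmeas (fun x => S1 x - S0 x) by exact: bmeasB.
have aS10 : additive (fun x => S1 x - S0 x) by move=> x; rewrite aprojB// aS1 aS0.
rewrite -meanB// -(potential_mean bc0 hS0 bS10 aS10) -subr_le0 -meanB; last 2 first.
- exact: bmeasM.
- exact: bmeasM.
have b1 : bmeas (fun x => expR (S1 x - c1 x)) by exact: bmeas_density.
rewrite [leRHS](_ : 0 = mean (fun x => expR (S1 x - c1 x)) - mean p0); last first.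
  by rewrite !potential_mass// subrr.
rewrite -meanB//; apply: le_mean.
- by apply: bmeasB; exact: bmeasM.
- exact: bmeasB.
- move=> x; rewrite /p0 -mulrBr.
  apply: le_trans (expR_tangent _ _); rewrite ler_wpM2l ?expR_ge0//.
  by rewrite /v; lra.
Qed.

(** The same tangent inequality with the roles exchanged involves the density
of [c1]; writing [expR (S0 - c1)] as [p0 * expR (- v)] brings back [p0], at
the price of the second order remainder of the exponential. *)
Lemma potential_value_ge (B : R) : (forall x, `|v x| <= B) ->
  mean (fun x => p0 x * v x) - expR B * mean (fun x => p0 x * v x ^+ 2) <=
  mean S1 - mean S0.
Proof.
move=> vB; have [_ aS0 _] := hS0; have [_ aS1 _] := hS1.
have bS10 : bmeas (fun x => S0 x - S1 x) by exact: bmeasB.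
have aS10 : additive (fun x => S0 x - S1 x) by move=> x; rewrite aprojB// aS1 aS0.
have b1 : bmeas (fun x => expR (S1 x - c1 x)) by exact: bmeas_density.
have b2 : bmeas (fun x => p0 x * v x) by exact: bmeasM.
have b3 : bmeas (fun x => p0 x * v x ^+ 2) by apply: bmeasM => //; exact: bmeasM.
rewrite -[leRHS]opprB -lerN2 opprK opprB -meanB//.
rewrite -(potential_mean bc1 hS1 bS10 aS10).
have b4 : bmeas (fun x => expR (S1 x - c1 x) * (S0 x - S1 x)) by exact: bmeasM.
rewrite -meanZ// -meanB//; last exact: bmeasZ.
have b5 : bmeas (fun x => expR B * (p0 x * v x ^+ 2) - p0 x * v x).
  by apply: bmeasB => //; exact: bmeasZ.
rewrite -[leLHS]addr0 -[leRHS]addr0 [X in _ + X <= _](_ : 0 =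
   mean (fun x => expR (S1 x - c1 x)) - mean p0); last first.
  by rewrite !potential_mass// subrr.
rewrite -meanB// -meanD//; last exact: bmeasB.
rewrite addr0; apply: le_mean => [||x] //.
  by apply: bmeasD => //; exact: bmeasB.
have E : expR (S0 x - c1 x) = p0 x * expR (- v x).
  by rewrite /p0 -expRD /v; congr expR; ring.
have := expR_tangent (S0 x - c1 x) (S1 x - c1 x).
rewrite E => h1.
have /andP[_ h2] := expR_quadratic (- v x).
have h3 : expR `|- v x| <= expR B by rewrite ler_expR normrN.
have h4 := ler_wpM2l (sqr_ge0 (v x)) h3.
have h5 : expR (- v x) - 1 + v x <= v x ^+ 2 * expR B.
  by apply: le_trans h4; move: h2; rewrite sqrrN opprK.
have h6 := ler_wpM2l (expR_ge0 (S0 x - c0 x)) h5.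
rewrite -/(p0 x) in h6; lra.
Qed.

End comparison.

(** When the costs differ on a null set only, the bound on the difference of
the values vanishes in both directions. *)
Lemma potential_value_ae c0 c1 S0 S1 : bmeas c0 -> bmeas c1 ->
  potential c0 S0 -> potential c1 S1 -> mean (fun x => `|c1 x - c0 x|) = 0 ->
  mean S0 = mean S1.
Proof.
have le c c' S S' : bmeas c -> bmeas c' -> potential c S -> potential c' S' ->
    mean (fun x => `|c' x - c x|) = 0 -> mean S' <= mean S.
  move=> bc bc' hS hS' h; rewrite -subr_le0.
  apply: (le_trans (potential_value_le bc bc' hS hS')).
  have [bS _ _] := hS; have bcc : bmeas (fun x => c' x - c x) by exact: bmeasB.
  rewrite (mean_ae0 _ (bmeas_norm bcc) _ h)//.
    by apply: bmeasM => //; exact: bmeas_density.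
  by move=> x /eqP; rewrite normr_eq0 => /eqP ->; rewrite mulr0.
move=> b0 b1 h0 h1 h; apply/eqP; rewrite eq_le; apply/andP; split; last exact: le h.
apply: (le c1 c0) => //; rewrite -[RHS]h.
by congr (mean _); apply/funext => x; rewrite distrC.
Qed.

End potential_curves.

(** * Product measures and resampling of rows *)

Section matrix_measures.
Context {R : realType} {N n : nat}.
Implicit Types (A : 'I_N -> set 'rV[R]_n).

Definition box A : set 'M[R]_(N, n) := [set x | forall i, A i (row i x)].

Definition boxes : set (set 'M[R]_(N, n)) :=
  [set box A | A in [set A | forall i, measurable (A i)]].

Lemma measurable_boxes : @measurable _ 'M[R]_(N, n) = <<s boxes >>.
Proof.
apply/seteqP; split; last first.
  apply: smallest_sub; first exact: sigma_algebra_measurable.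
  by move=> _ [A mA <-]; exact: measurable_box.
move=> B mB.
have mid : measurable_fun setT (id : g_sigma_algebraType boxes -> 'M[R]_(N, n)).
  apply: measurable_fun_mx => i j _ Y mY; rewrite setTI.
  apply: sub_sigma_algebra.
  exists (fun k => if k == i then [set r : 'rV[R]_n | Y (r ord0 j)] else setT).
    move=> k /=; case: ifP => // _.
    by have := measurable_coord (ord0 : 'I_1) j measurableT mY; rewrite setTI.
  apply/seteqP; split => [x /(_ i)|x Yx k] /=; first by rewrite eqxx/= mxE.
  by case: eqVneq => [->|//] /=; rewrite mxE.
by have := mid measurableT B mB; rewrite setTI.
Qed.

(** Boxes are stable by intersection and generate the Borel sets. *)
Lemma mx_measure_unique (m1 : probability 'M[R]_(N, n) R)
    (m2 : {measure set 'M[R]_(N, n) -> \bar R}) :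
  (forall A, (forall i, measurable (A i)) -> m1 (box A) = m2 (box A)) ->
  forall B, measurable B -> m1 B = m2 B.
Proof.
move=> h B mB; apply: (@measure_unique _ _ _ boxes (fun=> setT)) => //.
- exact: measurable_boxes.
- move=> _ _ [A mA <-] [A' mA' <-]; exists (fun i => A i `&` A' i) => /=.
    by move=> i; exact: measurableI.
  apply/seteqP; split=> [x h'|x [h1 h2] i //].
  by split=> i; have [] := h' i.
- by move=> _; exists (fun=> setT) => //=; apply/seteqP; split.
- by apply/seteqP; split => // x _; exists 0%N.
- by move=> _ [A mA <-]; exact: h.
- by move=> _; rewrite -ge0_fin_numE// fin_num_measure.
Qed.

Definition resample (i : 'I_N) (x y : 'M[R]_(N, n)) : 'M[R]_(N, n) :=
  \matrix_(k, l) if k == i then x k l else y k l.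

Lemma row_resample i k x y :
  row k (resample i x y) = if k == i then row k x else row k y.
Proof. by apply/rowP => l; rewrite !mxE; case: ifP => _; rewrite mxE. Qed.

Context (mu : 'I_N -> probability 'rV[R]_n R).

Lemma prod_measure_box A : (forall i, measurable (A i)) ->
  prod_measure mu (box A) = (\prod_i mu i (A i))%E.
Proof. exact: prod_measureE. Qed.

(** A box pulls back to the product of a box constraining the [i]-th row of
the first point and a box constraining the other rows of the second one. *)
Lemma resampling_prod_measure : resampling (prod_measure mu) resample.
Proof.
have mres i : measurable_fun setT
    (fun xy : 'M[R]_(N, n) * 'M[R]_(N, n) => resample i xy.1 xy.2).
  apply: measurable_fun_mx => k l.
  rewrite (_ : (fun _ => _) = if k == i
      then (fun xy : 'M[R]_(N, n) * 'M[R]_(N, n) => xy.1 k l)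
      else (fun xy : 'M[R]_(N, n) * 'M[R]_(N, n) => xy.2 k l)); last first.
    by apply/funext => xy; rewrite mxE; case: ifP.
  case: ifP => _.
    by apply: (measurableT_comp (measurable_coord k l)); exact: measurable_fst.
  by apply: (measurableT_comp (measurable_coord k l)); exact: measurable_snd.
split=> //.
- move=> i B mB; apply/esym.
  pose f : {mfun _ >-> 'M[R]_(N, n)} :=
    HB.pack (fun xy : 'M[R]_(N, n) * 'M[R]_(N, n) => resample i xy.1 xy.2)
      (isMeasurableFun.Build _ _ _ _ _ (mres i)).
  apply: (@mx_measure_unique _ (pushforward (prod_measure mu \x prod_measure mu)%E f)) => // A mA.
  pose A1 k := if k == i then A k else setT.
  pose A2 k := if k == i then setT else A k.
  have mA1 k : measurable (A1 k) by rewrite /A1; case: ifP.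
  have mA2 k : measurable (A2 k) by rewrite /A2; case: ifP.
  rewrite /pushforward/=.
  rewrite [X in _ = (_ \x _)%E X](_ : _ = box A1 `*` box A2).
    rewrite product_measure1E; [|exact: measurable_box|exact: measurable_box].
    transitivity ((\prod_k mu k (A1 k)) * (\prod_k mu k (A2 k)))%E; last first.
      by congr (_ * _)%E; apply/esym; exact: prod_measure_box.
    rewrite prod_measure_box// -big_split/=; apply: eq_bigr => k _.
    by rewrite /A1 /A2; case: ifP => _; have /= -> := @probability_setT _ _ _ (mu k);
      rewrite ?mule1 ?mul1e.
  apply/seteqP; split=> -[x y] /= => [h|[h1 h2] k].
    by split=> k; have := h k; rewrite row_resample /A1 /A2;
      case: (k == i) => // _; exact: I.
  have := h1 k; have := h2 k; rewrite /A1 /A2 => a2 a1.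
  suff : A k (if k == i then row k x else row k y) by rewrite -row_resample.
  by move: a1 a2; case: (k == i).
- by move=> i x y z; apply/matrixP => k l; rewrite !mxE; case: (k == i).
- move=> i j x y z ij; apply/matrixP => k l; rewrite !mxE.
  by case: eqVneq => // ->; rewrite (negPf ij).
Qed.

Lemma prod_measure_row i B : measurable B ->
  prod_measure mu (row i @^-1` B) = mu i B.
Proof.
move=> mB; pose A k := if k == i then B else setT.
have -> : row i @^-1` B = box A.
  apply/seteqP; split=> [x /= Bx k|x /(_ i)]; rewrite /A ?eqxx//.
  by case: eqVneq => // ->.
rewrite prod_measure_box => [|k]; last by rewrite /A; case: ifP.
rewrite (bigD1 i)//= big1 ?mule1 /A ?eqxx// => k /negPf ->.
by have /= -> := @probability_setT _ _ _ (mu k).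
Qed.

End matrix_measures.

(** The preimage of a box by a map acting row by row is a box. *)
Lemma prod_measure_rowwise {R : realType} {N n n' : nat}
    (nu : 'I_N -> probability 'rV[R]_n R) (mu : 'I_N -> probability 'rV[R]_n' R)
    (phi : 'rV[R]_n -> 'rV[R]_n') (Phi : 'M[R]_(N, n) -> 'M[R]_(N, n')) :
  measurable_fun setT phi -> measurable_fun setT Phi ->
  (forall i z, row i (Phi z) = phi (row i z)) ->
  (forall i A, measurable A -> mu i A = nu i (phi @^-1` A)) ->
  forall B, measurable B -> prod_measure mu B = prod_measure nu (Phi @^-1` B).
Proof.
move=> mphi mPhi rPhi numu B mB.
pose f : {mfun _ >-> 'M[R]_(N, n')} :=
  HB.pack Phi (isMeasurableFun.Build _ _ _ _ _ mPhi).
apply: (@mx_measure_unique _ _ _ _ (pushforward (prod_measure nu) f)) => // A mA.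
rewrite /pushforward/= prod_measure_box//.
under eq_bigr do rewrite numu//.
rewrite -prod_measure_box.
  by congr (prod_measure nu _); apply/seteqP; split=> x h i; have := h i; rewrite /= rPhi.
by move=> i; have := mphi measurableT _ (mA i); rewrite setTI.
Qed.

(** * Relative entropy and duality *)

Section entropy.
Context {R : realType} {d : measure_display} {T : measurableType d}.
Context (P : probability T R).
Implicit Types (p psi f : T -> R).

Lemma measurable_lne (f : T -> \bar R) : measurable_fun setT f ->
  measurable_fun setT (fun x => lne (f x)).
Proof.
move=> mf; rewrite (_ : (fun _ => _) = (fun x => if (f x <= 0)%E then -oo%E
    else if f x == +oo%E then +oo%E else (ln (fine (f x)))%:E)); last first.
  by apply/funext => x; case: (f x) => [r| |]; rewrite ?lee_fin ?leye_eq ?leNye.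
apply: measurable_fun_ifT => //; first exact: measurable_fun_lee.
apply: measurable_fun_ifT => //; first exact: measurable_fun_eqe.
apply/measurable_EFinP; apply: measurableT_comp => //.
exact: (measurableT_comp (fine_measurable measurableT) mf).
Qed.

Lemma le_integral_l (mu : probability T R) (f g : T -> \bar R) :
  mu.-integrable setT f -> measurable_fun setT g -> (forall x, (f x <= g x)%E) ->
  (\int[mu]_x f x <= \int[mu]_x g x)%E.
Proof.
move=> intf mg fg; have mf := measurable_int _ intf.
have fgD : {in [set: T], forall x, (f x <= g x)%E} by move=> x _.
rewrite integralE [leRHS]integralE; apply: leeB; apply: ge0_le_integral => //.
- exact: measurable_funepos.
- exact: measurable_funepos.
- by move=> x _; apply: (funepos_le fgD); rewrite inE.
- exact: measurable_funeneg.
- exact: measurable_funeneg.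
- by move=> x _; apply: (funeneg_le fgD); rewrite inE.
Qed.

Lemma density_probability p : bmeas p -> (forall x, 0 <= p x) -> mean P p = 1 ->
  exists s : probability T R,
    forall A, measurable A -> s A = (\int[P]_(x in A) (p x)%:E)%E.
Proof.
move=> bp p0 p1; pose m A := (\int[P]_(x in A) (p x)%:E)%E.
have mp : measurable_fun setT (EFin \o p) by apply/measurable_EFinP; case: bp.
have m0 : m set0 = 0%E by rewrite /m integral_set0.
have m_ge0 A : (0 <= m A)%E.
  by apply: integral_ge0 => x _; rewrite lee_fin.
have m_add : semi_sigma_additive m.
  move=> F mF tF mUF; rewrite /m; apply: cvg_toP.
    apply: ereal_nondecreasing_is_cvgn => i j ij.
    by apply: lee_sum_nneg_natr => // k _ _; exact: m_ge0.
  rewrite ge0_integral_bigcup//=; first exact: measurable_funTS.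
  by move=> x _; exact: p0.
pose mm : {measure set T -> \bar R} :=
  HB.pack m (isMeasure.Build _ _ _ m m0 m_ge0 m_add).
have m1 : mm setT = 1%E by rewrite /= /m (meanE P bp) p1.
pose mp1 : probability T R := HB.pack m (isMeasure.Build _ _ _ m m0 m_ge0 m_add) (@Measure_isProbability.Build _ _ R mm m1).
by exists mp1.
Qed.

Lemma rel_entropy_density (s : probability T R) psi : bmeas psi ->
  (forall A, measurable A -> s A = (\int[P]_(x in A) (expR (psi x))%:E)%E) ->
  rel_entropy s P = (mean s psi)%:E.
Proof.
move=> bpsi sE.
have bp := bmeas_expR bpsi.
have mp : measurable_fun setT (fun x => (expR (psi x))%:E).
  by apply/measurable_EFinP; case: bp.
have sP : s `<< P.
  apply/null_content_dominatesP => A mA PA.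
  by rewrite sE// null_set_integral//; exact: measurable_funTS.
rewrite /rel_entropy (asboolT sP) -(meanE s bpsi).
have RNm : measurable_fun setT (Radon_Nikodym (charge_of_finite_measure s) P).
  exact: (measurable_int P (@Radon_Nikodym_integrable _ _ _ (charge_of_finite_measure s) P sP)).
have h : ae_eq P setT (Radon_Nikodym (charge_of_finite_measure s) P)
    (fun x => (expR (psi x))%:E).
  apply: integral_ae_eq => //; first exact: Radon_Nikodym_integrable.
  by move=> E _ mE; rewrite -Radon_Nikodym_integral// -sE.
have h' := null_dominates_ae_eq measurableT sP h.
apply: ae_eq_integral => //.
- exact: measurable_lne.
- by apply/measurable_EFinP; case: bpsi.
- apply: filterS h' => x hx _; rewrite (hx I).
  by rewrite lne_EFin ?expR_gt0// expRK.
Qed.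

(** With [r] the density of [s], this is [ln r >= 1 + psi - expR psi / r]
integrated against [s], since the integral of [expR psi / r] against [s] is at
most that of [expR psi] against [P], which is 1. Where [r] vanishes, a null
set for [s], the quotient is replaced by 0. *)
Lemma gibbs_inequality (s : probability T R) psi : bmeas psi ->
  mean P (fun x => expR (psi x)) = 1 ->
  ((mean s psi)%:E <= rel_entropy s P)%E.
Proof.
move=> bpsi p1; rewrite /rel_entropy; case: asboolP => sP; last exact: leey.
have bp := bmeas_expR bpsi.
have RNm : measurable_fun setT (Radon_Nikodym (charge_of_finite_measure s) P).
  exact: (measurable_int P (@Radon_Nikodym_integrable _ _ _ (charge_of_finite_measure s) P sP)).
pose f := Radon_Nikodym_SigmaFinite.f s P.
have f0 : forall x, (0 <= f x)%E := Radon_Nikodym_SigmaFinite.f_ge0 sP.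
have ff : forall x, f x \is a fin_num := Radon_Nikodym_SigmaFinite.f_fin_num sP.
have mf : measurable_fun setT f.
  exact: (measurable_int P (Radon_Nikodym_SigmaFinite.f_integrable sP)).
pose r x := fine (f x).
have fr x : f x = (r x)%:E by rewrite /r fineK.
have mr : measurable_fun setT r.
  exact: (measurableT_comp (fine_measurable measurableT) mf).
have mr0 : measurable_fun setT (fun x => r x <= 0) by exact: measurable_fun_ler.
pose q x := if r x <= 0 then 0 else expR (psi x) * r x `^ (-1).
have mq : measurable_fun setT q.
  apply: measurable_fun_ifT => //; apply: measurable_funM; first by case: bp.
  exact: (measurableT_comp (measurable_powR (-1)) mr).
have q0 x : 0 <= q x.
  by rewrite /q; case: ifP => // _; rewrite mulr_ge0 ?expR_ge0 ?powR_ge0.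
have mqE : measurable_fun setT (EFin \o q) by exact/measurable_EFinP.
have q1 : (\int[s]_x (q x)%:E <= 1)%E.
  rewrite -(Radon_Nikodym_SigmaFinite.change_of_variables sP)//.
  rewrite -/f -p1 -(meanE P bp); apply: ge0_le_integral => //.
  - by move=> x _; rewrite mule_ge0// lee_fin.
  - exact: emeasurable_funM.
  - by apply/measurable_EFinP; case: bp.
  - move=> x _; rewrite fr -EFinM lee_fin /q; case: ifPn => [_|].
      by rewrite mul0r expR_ge0.
    rewrite -ltNge => rx.
    by rewrite powR_inv1 ?(ltW rx)// mulfVK// gt_eqF.
have qint : s.-integrable setT (EFin \o q).
  apply/integrableP; split => //.
  under eq_integral do rewrite /= ger0_norm//.
  by rewrite (le_lt_trans q1)// ltry.
pose G x := (psi x + 1 - q x)%:E.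
have bpsi1 : bmeas (fun x => psi x + 1) by apply: bmeasD => //; exact: bmeas_cst.
have mG : measurable_fun setT G.
  by apply/measurable_EFinP; apply: measurable_funB => //; case: bpsi1.
have Gint : s.-integrable setT G.
  exact: (integrableB measurableT (bmeas_integrable s bpsi1) qint).
pose l x := if r x <= 0 then G x else lne (f x).
have ml : measurable_fun setT l.
  by apply: measurable_fun_ifT => //; exact: measurable_lne.
have Gl x : (G x <= l x)%E.
  rewrite /l; case: ifPn => //; rewrite -ltNge => rx.
  have rN : (r x <= 0) = false by rewrite leNgt rx.
  rewrite fr lne_EFin// lee_fin /q rN.
  rewrite powR_inv1 ?(ltW rx)//.
  have y0 : 0 < expR (psi x) / r x by rewrite divr_gt0// expR_gt0.
  have y1 : -1 < expR (psi x) / r x - 1 by lra.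
  have := le_ln1Dx y1; rewrite [X in ln X](_ : _ = expR (psi x) / r x); last by ring.
  rewrite ln_div ?posrE ?expR_gt0// expRK; lra.
have G1 : ((mean s psi)%:E <= \int[s]_x G x)%E.
  rewrite /G; under eq_integral do rewrite EFinB.
  rewrite integralB//; last exact: bmeas_integrable.
  rewrite (meanE s bpsi1) meanD//; last exact: bmeas_cst.
  have qfin : (\int[s]_x (q x)%:E)%E \is a fin_num by exact: integrable_fin_num.
  move: q1; rewrite -(fineK qfin) lee_fin mean_cst -EFinB lee_fin; lra.
apply: (le_trans G1); apply: (@le_trans _ _ (\int[s]_x l x)%E).
  exact: le_integral_l.
rewrite le_eqVlt; apply/orP; left; apply/eqP; apply: ae_eq_integral => //.
  exact: measurable_lne.
have fRN : ae_eq s setT f (Radon_Nikodym (charge_of_finite_measure s) P).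
  apply: (null_dominates_ae_eq measurableT sP).
  exact: ae_eq_Radon_Nikodym_SigmaFinite.
have rpos : {ae s, forall x, ~ (r x <= 0)}.
  exists [set x | r x <= 0]; split => //.
  - by have := mr0 measurableT [set true] I; rewrite setTI.
  - rewrite (Radon_Nikodym_SigmaFinite.f_integral sP).
      rewrite -/f; apply: integral0_eq => x /= rx.
      have := f0 x; rewrite fr lee_fin => r0.
      by congr EFin; apply/eqP; rewrite eq_le rx r0.
    by have := mr0 measurableT [set true] I; rewrite setTI.
  - by move=> x /= /contrapT.
apply: filterS2 fRN rpos => x fx rx _.
by rewrite /l; case: ifPn => // _; rewrite (fx I).
Qed.

End entropy.

Section duality.
Context {R : realType} {N d : nat}.
Implicit Types (X : 'I_N -> set 'rV[R]_d) (mu : 'I_N -> probability 'rV[R]_d R).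

(** Such a function factors through the [i]-th row, whose law is the same
under both measures. *)
Lemma mean_row (s s' : probability 'M[R]_(N, d) R) (i : 'I_N) (g : 'M[R]_(N, d) -> R) :
  (forall A, measurable A -> s (row i @^-1` A) = s' (row i @^-1` A)) ->
  bmeas g -> rowdep resample i g -> mean s g = mean s' g.
Proof.
move=> ss' bg ig; have [mg [M gM]] := bg.
pose emb (r : 'rV[R]_d) : 'M[R]_(N, d) := \matrix_(k, l) if k == i then r ord0 l else 0.
have memb : measurable_fun setT emb.
  apply: measurable_fun_mx => k l.
  rewrite (_ : (fun _ => _) = if k == i then (fun x : 'rV[R]_d => x ord0 l) else cst 0).
    by case: ifP => _; [exact: measurable_coord|exact: measurable_cst].
  by apply/funext => x; rewrite mxE; case: ifP.
have bh : bmeas (g \o emb).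
  by split; [exact: measurableT_comp|exists M => x; exact: gM].
have gE x : g x = (g \o emb) (row i x).
  rewrite /= -(ig (emb (row i x)) x); congr g; apply/matrixP => k l; rewrite !mxE.
  by case: eqVneq => [->|].
have pf (r : probability 'M[R]_(N, d) R) :
    (\int[r]_x (g x)%:E = \int[pushforward r (row i)]_y ((g \o emb) y)%:E)%E.
  have mh : measurable_fun setT (EFin \o (g \o emb)) by apply/measurable_EFinP; case: bh.
  have inth : r.-integrable (row i @^-1` setT) ((EFin \o (g \o emb)) \o row i).
    rewrite preimage_setT (_ : _ \o row i = EFin \o g); first exact: bmeas_integrable.
    by apply/funext => x /=; rewrite [in RHS]gE.
  have := integral_pushforward (measurable_row i) mh inth measurableT.
  rewrite preimage_setT => ->.
  by apply: eq_integral => x _ /=; rewrite [in LHS]gE.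
apply: EFin_inj; rewrite -!meanE// !pf.
by apply: eq_measure_integral => *; first [exact: ss'|exact: measurable_row].
Qed.

(** Each centred component is averaged against its own marginal, and its mean
vanishes under [s] as it does under the product. *)
Lemma mean_additive_coupling (s : probability 'M[R]_(N, d) R) mu S :
  (forall i A, measurable A -> s (row i @^-1` A) = mu i A) ->
  bmeas S -> additive_fun (prod_measure mu) resample S ->
  mean s S = mean (prod_measure mu) S.
Proof.
move=> smu bS aS; have uP := resampling_prod_measure mu.
have -> : mean s S = mean s (aproj (prod_measure mu) resample S).
  by congr mean; apply/funext => x; rewrite aS.
have bi i : bmeas (fun x => cmean (prod_measure mu) resample i S x - mean (prod_measure mu) S).
  by apply: bmeasB; [exact: bmeas_cmean|exact: bmeas_cst].
rewrite /aproj meanD; [|exact: bmeas_sum|exact: bmeas_cst].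
rewrite mean_cst mean_sum// big1 ?add0r// => i _.
rewrite meanB; [|exact: bmeas_cmean|exact: bmeas_cst].
rewrite mean_cst (@mean_row s (prod_measure mu) i).
- by rewrite mean_cmean ?subrr.
- by move=> A mA; rewrite smu// prod_measure_row.
- exact: bmeas_cmean.
- exact: rowdep_cmean.
Qed.

Lemma measurable_prodset X : (forall i, measurable (X i)) -> measurable (prodset X).
Proof. exact: measurable_box. Qed.

Lemma prodset_mass X mu : (forall i, measurable (X i)) ->
  (forall i, prob_on (X i) (mu i)) -> prod_measure mu (prodset X) = 1%E.
Proof.
move=> mX Xmu; rewrite (@prod_measure_box _ _ _ mu X mX).
by rewrite big1 // => i _; exact: Xmu.
Qed.

(** Duality without gap. For a coupling [s], the mean of the cost is the mean
of [S] minus that of [S - c], and the latter is at most the entropy by Gibbs'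
inequality; the measure of density [expR (S - c)] is a coupling, by the
Schroedinger system, for which equality holds. Extending the cost by 0 off the
product set makes it a bounded function on the whole space. *)
Theorem eot_potential X mu (c S : 'M[R]_(N, d) -> R) :
  (forall i, measurable (X i)) -> (forall i, prob_on (X i) (mu i)) ->
  bmeas (c \_ (prodset X)) ->
  potential (prod_measure mu) resample (c \_ (prodset X)) S ->
  eot X c mu = (mean (prod_measure mu) S)%:E.
Proof.
move=> mX Xmu bc hS; have uP := resampling_prod_measure mu.
set c0 := c \_ (prodset X) in bc hS *; set P := prod_measure mu in hS *.
have mK := measurable_prodset mX.
have [bS aS _] := hS.
have bpsi : bmeas (fun x => S x - c0 x) by exact: bmeasB.
have mass := potential_mass uP bc hS.
have costE (s : probability 'M[R]_(N, d) R) :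
    (\int[s]_(x in prodset X) (c x)%:E = (mean s c0)%:E)%E.
  rewrite -meanE// integral_mkcond; apply: eq_integral => x _.
  by rewrite /c0 /patch; case: ifP.
have sumE (s : probability 'M[R]_(N, d) R) :
    (forall i A, measurable A -> s (row i @^-1` A) = mu i A) ->
    mean s c0 + mean s (fun x => S x - c0 x) = mean P S.
  move=> smu; rewrite meanB// addrC subrK.
  exact: mean_additive_coupling.
apply/eqP; rewrite eq_le; apply/andP; split; last first.
  apply: le_ereal_inf_tmp => _ [s [sX smu] <-].
  rewrite costE -(sumE s) ?EFinD; last by move=> i A mA; exact: smu.
  by rewrite leeD2l//; exact: gibbs_inequality.
have bp := bmeas_expR bpsi.
have p0 x : 0 <= expR (S x - c0 x) by exact: expR_ge0.
have [s sE] := density_probability bp p0 mass.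
have smu i A : measurable A -> s (row i @^-1` A) = mu i A.
  move=> mA.
  have mB : measurable (row i @^-1` A : set 'M[R]_(N, d)).
    by have := measurable_row i measurableT mA; rewrite setTI.
  have bA : bmeas (\1_(row i @^-1` A) : 'M[R]_(N, d) -> R).
    split; first exact: measurable_indic.
    by exists 1 => x; rewrite indicE; case: (_ \in _); rewrite ?normr1 ?normr0.
  have dA : rowdep resample i (\1_(row i @^-1` A) : 'M[R]_(N, d) -> R).
    move=> x y; rewrite !indicE; congr ((nat_of_bool _)%:R).
    by apply/idP/idP; rewrite !in_setE /= row_resample eqxx.
  rewrite sE// integral_mkcond -(prod_measure_row mu i mA) -/P.
  have -> : ((fun x => (expR (S x - c0 x))%:E) \_ (row i @^-1` A) =
      fun x : 'M[R]_(N, d) => (\1_(row i @^-1` A) x * expR (S x - c0 x))%:E).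
    apply/funext => x; rewrite /patch indicE.
    by case: ifP => _; rewrite ?mul1r ?mul0r.
  rewrite meanE; last exact: bmeasM.
  rewrite -(mean_cmean uP i); last exact: bmeasM.
  have -> : cmean P resample i (fun x => \1_(row i @^-1` A) x * expR (S x - c0 x)) =
      \1_(row i @^-1` A).
    by apply/funext => x; rewrite (cmeanMl uP x dA bp) (cmean_density uP)// mulr1.
  by rewrite -meanE// integral_indic// setIT.
have sC : s (~` prodset X) = 0%E.
  rewrite sE; last exact: measurableC.
  apply: null_set_integral.
  - exact: measurableC.
  - by apply: measurable_funTS; apply/measurable_EFinP; case: bp.
  - by have := probability_setC P mK; rewrite (prodset_mass mX Xmu) subee.
have sX : prob_on (prodset X) s.
  by have := probability_setC s (measurableC mK); rewrite setCK sC sube0.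
apply: ge_ereal_inf; exists (\int[s]_(x in prodset X) (c x)%:E + rel_entropy s P)%E.
  by exists s => //; split => // i A mA; exact: smu.
by rewrite costE (rel_entropy_density bpsi sE) -EFinD sumE.
Qed.

End duality.

(** * Calculus with partial derivatives *)

Section coordinate_calculus.
Context {R : realType} {m n : nat}.
Implicit Types (F : 'M[R]_(m, n) -> R) (x y v : 'M[R]_(m, n)) (e : 'I_m * 'I_n).

Definition cube (r : R) : set 'M[R]_(m, n) := [set x | forall i j, `|x i j| <= r].

Lemma cube_compact r : compact (cube r).
Proof.
have -> : cube r = @vec_mx _ _ _ @` [set v : 'rV[R]_(m * n) | forall i, `[- r, r]%classic (v ord0 i)].
  apply/seteqP; split => [x xr|_ [v /= vr <-] i j].
    exists (mxvec x); last exact: mxvecK.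
    move=> /= k; case/mxvec_indexP: k => i j.
    by rewrite mxvecE in_itv/= -ler_norml; exact: xr.
  by rewrite mxE; have := vr (mxvec_index i j); rewrite in_itv/= ler_norml.
apply: continuous_compact; last first.
  apply: (@rV_compact _ _ (fun=> `[- r, r]%classic)) => i; exact: segment_compact.
apply: continuous_subspaceT => v A /nbhs_ballP[eps /= e0 vA].
apply/nbhs_ballP; exists eps => //= w [_ vw]; apply: vA; split => // i j.
by rewrite !mxE; exact: vw.
Qed.

Lemma continuous_cube_bounded F (r : R) : continuous F ->
  exists M : R, forall x, cube r x -> `|F x| <= M.
Proof.
move=> cF; have : compact (F @` cube r).
  by apply: continuous_compact; [exact: continuous_subspaceT|exact: cube_compact].
move/compact_bounded => [M [_ hM]]; exists (M + 1) => x xr.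
by apply: hM; [rewrite ltrDl|exists x].
Qed.

Lemma heine_cantor F (r eps : R) : continuous F -> 0 < eps ->
  exists2 delta : R, 0 < delta & forall x y, cube r x ->
    (forall i j, `|y i j - x i j| <= delta) -> `|F y - F x| <= eps.
Proof.
move=> cF e0.
have /compact_near_coveringP ncov := @cube_compact r.
pose Q (delta : R) (x : 'M[R]_(m, n)) := forall y,
    (forall i j, `|y i j - x i j| <= delta) -> `|F y - F x| <= eps.
have delta0 : \forall delta \near (0 : R)^'+, cube r `<=` Q delta.
  apply: (ncov _ _ Q) => x _.
  have e2 : 0 < eps / 2 by rewrite divr_gt0.
  have /cvgrPdist_le/(_ _ e2)/nbhs_ballP[/= s s0 hs] := cF x.
  have s2 : 0 < s / 2 by rewrite divr_gt0.
  exists (ball x (s / 2), [set delta | delta < s / 2]) => /=.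
    by split; [exact: nbhsx_ballx|exact: nbhs_right_lt].
  move=> [x' delta] /= [[_ xx'] ds] y hy.
  have h1 : `|F x - F x'| <= eps / 2.
    by apply: hs; split => // i j; apply: le_ball (xx' i j); lra.
  have h2 : `|F x - F y| <= eps / 2.
    apply: hs; split => // i j; have := xx' i j; have := hy i j.
    rewrite /ball/= => hy' hx'.
    have -> : x i j - y i j = (x i j - x' i j) - (y i j - x' i j) by ring.
    by rewrite (le_lt_trans (ler_normB _ _))//; lra.
  have -> : F y - F x' = (F x - F x') - (F x - F y) by ring.
  by rewrite (le_trans (ler_normB _ _))//; lra.
have [d [d0 hd']] : exists d : R, 0 < d /\ cube r `<=` Q d.
  near (0 : R)^'+ => d; exists d; split; first by near: d; exact: nbhs_right_gt.
  by near: d; exact: delta0.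
by exists d => // x y xr; exact: (hd' x xr).
Unshelve. all: by end_near. Qed.

Definition partial e F : 'M[R]_(m, n) -> R := 'D_(delta_mx e.1 e.2) F.

Lemma is_derive_line F v x (r : R) : derivable F (x + r *: v) v ->
  is_derive r 1 (fun s => F (x + s *: v)) ('D_v F (x + r *: v)).
Proof.
have E : (fun h : R => h^-1 *: (F (x + (h *: 1 + r) *: v) - F (x + r *: v))) =
    (fun h : R => h^-1 *: (F (h *: v + (x + r *: v)) - F (x + r *: v))).
  apply/funext => h; congr (_ *: (F _ - _)).
  by rewrite [h *: 1]mulr1 scalerDl addrCA.
move=> dF; apply: DeriveDef.
  by rewrite /derivable /= E.
by rewrite /derive /= E.
Qed.

Lemma mean_value_line F v x (a : R) :
  (forall y, derivable F y v) ->
  exists2 s : R, `|s| <= `|a| & F (x + a *: v) - F x = a * 'D_v F (x + s *: v).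
Proof.
move=> dF; pose g (s : R) := F (x + s *: v).
have dg (s : R) : is_derive s 1 g ('D_v F (x + s *: v)) by exact: is_derive_line.
have cg : continuous g.
  by move=> s; apply: differentiable_continuous; apply/derivable1_diffP; have [] := dg s.
have E0 : F x = g 0 by rewrite /g scale0r addr0.
have [a0|a0] := leP 0 a.
  have [c /[!in_itv]/= /andP[c0 ca] h] :=
    MVT_segment a0 (fun s _ => dg s) (continuous_subspaceT cg).
  exists c; first by rewrite !ger0_norm.
  by rewrite E0 -/(g a) h subr0 mulrC.
have [c /[!in_itv]/= /andP[c0 ca] h] :=
  MVT_segment (ltW a0) (fun s _ => dg s) (continuous_subspaceT cg).
exists c; first by rewrite !ler0_norm ?lerN2// ltW.
by rewrite E0 -/(g a) -opprB h sub0r mulrN opprK mulrC.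
Qed.

(** A telescoping sum over the coordinates, applying the mean value theorem
along each of them; partial derivatives at the intermediate points suffice. *)
Lemma taylor_coordinates F (L : 'I_m * 'I_n -> R) x v (eps : R) :
  (forall e y, derivable F y (delta_mx e.1 e.2)) ->
  (forall e y, (forall i j, `|y i j - x i j| <= `|v i j|) ->
     `|partial e F y - L e| <= eps) ->
  `|F (x + v) - F x - \sum_e v e.1 e.2 * L e| <= eps * \sum_e `|v e.1 e.2|.
Proof.
move=> dF hF.
pose w (s : seq ('I_m * 'I_n)) : 'M[R]_(m, n) :=
  \matrix_(i, j) if (i, j) \in s then v i j else 0.
have key (s : seq ('I_m * 'I_n)) : uniq s ->
    `|F (x + w s) - F x - \sum_(e <- s) v e.1 e.2 * L e| <=
    eps * \sum_(e <- s) `|v e.1 e.2|.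
  elim: s => [_|e s IH /= /andP[es us]].
    rewrite !big_nil mulr0 subr0 (_ : w [::] = 0) ?addr0 ?subrr ?normr0//.
    by apply/matrixP => i j; rewrite !mxE.
  rewrite !big_cons.
  have we : x + w (e :: s) = x + w s + v e.1 e.2 *: delta_mx e.1 e.2.
    rewrite -addrA; congr (_ + _); apply/matrixP => i j; rewrite !mxE inE -pair_eqE/=.
    rewrite /pair_eq/=; case: (eqVneq i e.1) => [->|_] /=; last by rewrite mulr0 addr0.
    case: (eqVneq j e.2) => [->|_] /=; last by rewrite mulr0 addr0.
    by rewrite -surjective_pairing (negPf es) mulr1 add0r.
  have [s' hs' E] := mean_value_line (x + w s) (v e.1 e.2) (dF e).
  have hy i j : `|(x + w s + s' *: delta_mx e.1 e.2) i j - x i j| <= `|v i j|.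
    have cancel (p q r : R) : p + q + r - p = q + r by ring.
    rewrite !mxE cancel.
    have [/andP[/eqP ie /eqP je]|ne] := boolP ((i == e.1) && (j == e.2)).
      rewrite ie je -surjective_pairing (negPf es) add0r mulr1.
      exact: hs'.
    by rewrite mulr0 addr0; case: ifP => // _; rewrite normr0.
  have h1 := hF e _ hy; have h2 := IH us.
  rewrite we mulrDr.
  have -> : F (x + w s + v e.1 e.2 *: delta_mx e.1 e.2) - F x -
      (v e.1 e.2 * L e + \sum_(j <- s) v j.1 j.2 * L j) =
    v e.1 e.2 * (partial e F (x + w s + s' *: delta_mx e.1 e.2) - L e) +
    (F (x + w s) - F x - \sum_(j <- s) v j.1 j.2 * L j).
    by rewrite mulrBr /partial -E; ring.
  by rewrite (le_trans (ler_normD _ _))// lerD// normrM mulrC ler_wpM2r.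
have := key (enum {: 'I_m * 'I_n}) (enum_uniq _).
rewrite !big_enum/=; congr (`|F (x + _) - _ - _| <= _).
by apply/matrixP => i j; rewrite mxE mem_enum.
Qed.

End coordinate_calculus.

(** * The interpolated cost *)

Section interpolated_cost.
Context {R : realType} {N d : nat}.
Implicit Types (F : 'M[R]_(N, d) -> R) (e : 'I_N * 'I_d) (t s : R).

(** A pair of points of R^d is one row of length [d + d], so that a pair of
configurations is a matrix again and a plan for each row defines a product
measure of the type studied above. *)
Definition mx_interp k t (z : 'M[R]_(k, d + d)) : 'M[R]_(k, d) :=
  lsubmx z + t *: (rsubmx z - lsubmx z).

Definition displ k (z : 'M[R]_(k, d + d)) : 'M[R]_(k, d) := rsubmx z - lsubmx z.

Lemma mx_interpD k t s (z : 'M[R]_(k, d + d)) :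
  mx_interp s z = mx_interp t z + (s - t) *: displ z.
Proof. by apply/matrixP => i j; rewrite !mxE; ring. Qed.

Lemma measurable_mx_interp k t :
  measurable_fun setT (@mx_interp k t).
Proof.
apply: measurable_fun_mx => i j.
rewrite (_ : (fun _ => _) = fun z : 'M[R]_(k, d + d) =>
    z i (lshift d j) + t * (z i (rshift d j) - z i (lshift d j))).
  apply: measurable_funD; first exact: measurable_coord.
  apply: measurable_funM => //; apply: measurable_funB; exact: measurable_coord.
by apply/funext => z; rewrite !mxE.
Qed.

Lemma measurable_displ k i j :
  measurable_fun setT (fun z : 'M[R]_(k, d + d) => displ z i j).
Proof.
rewrite (_ : (fun _ => _) = fun z : 'M[R]_(k, d + d) =>
    z i (rshift d j) - z i (lshift d j)).
  by apply: measurable_funB; exact: measurable_coord.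
by apply/funext => z; rewrite !mxE.
Qed.

Lemma measurable_lsubmx k :
  measurable_fun setT (@lsubmx R k d d).
Proof.
apply: measurable_fun_mx => i j.
rewrite (_ : (fun _ => _) = fun z : 'M[R]_(k, d + d) => z i (lshift d j)).
  exact: measurable_coord.
by apply/funext => z; rewrite mxE.
Qed.

Lemma measurable_rsubmx k :
  measurable_fun setT (@rsubmx R k d d).
Proof.
apply: measurable_fun_mx => i j.
rewrite (_ : (fun _ => _) = fun z : 'M[R]_(k, d + d) => z i (rshift d j)).
  exact: measurable_coord.
by apply/funext => z; rewrite mxE.
Qed.

Lemma compact_measurable_mx m n (A : set 'M[R]_(m, n)) : compact A -> measurable A.
Proof.
move=> cA; rewrite -[A]setCK; apply: measurableC; apply: open_measurable_mx.
by apply: closed_openC; apply: compact_closed => //; exact: norm_hausdorff.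
Qed.

Context (X : 'I_N -> set 'rV[R]_d).
Hypothesis cX : forall i, compact (X i).

Definition dprodset : set 'M[R]_(N, d + d) :=
  [set z | prodset X (lsubmx z) /\ prodset X (rsubmx z)].

Lemma measurable_dprodset : measurable dprodset.
Proof.
have mX i : measurable (X i) by exact: compact_measurable_mx.
have mK := measurable_prodset mX.
apply: measurableI.
  by have := measurable_lsubmx measurableT mK; rewrite setTI.
by have := measurable_rsubmx measurableT mK; rewrite setTI.
Qed.

Lemma rows_bounded : exists2 B : R, 0 <= B &
  forall i r, X i r -> forall j, `|r ord0 j| <= B.
Proof.
have h (e : 'I_N * 'I_d) : {M : R | forall r, X e.1 r -> `|r ord0 e.2| <= M}.
  apply: cid; have : compact ((fun r : 'rV[R]_d => r ord0 e.2) @` X e.1).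
    apply: continuous_compact => //; apply: continuous_subspaceT.
    exact: coord_continuous.
  move/compact_bounded => [M [_ hM]]; exists (M + 1) => r Xr.
  by apply: hM; [rewrite ltrDl|exists r].
exists (\sum_e `|sval (h e)|); first exact: sumr_ge0.
move=> i r Xr j; apply: (@le_trans _ _ `|sval (h (i, j))|).
  exact: (le_trans (svalP (h (i, j)) _ Xr) (ler_norm _)).
by rewrite (bigD1 (i, j))//= lerDl sumr_ge0.
Qed.

Lemma prodset_bounded : exists2 B : R, 0 <= B & prodset X `<=` cube B.
Proof.
have [B B0 hB] := rows_bounded; exists B => // x Kx i j.
by have := hB i _ (Kx i) j; rewrite mxE.
Qed.

Lemma dprodset_bounded : exists2 B : R, 0 <= B & forall z, dprodset z ->
  (forall i j, `|displ z i j| <= B) /\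
  (forall t i j, `|mx_interp t z i j| <= (1 + `|t|) * B).
Proof.
have [B B0 hB] := prodset_bounded.
exists (B + B); first exact: addr_ge0.
move=> z [zl zr].
have hd i j : `|displ z i j| <= B + B.
  by rewrite !mxE (le_trans (ler_normB _ _))// lerD//;
    [have := hB _ zr i j|have := hB _ zl i j]; rewrite mxE.
split=> // t i j.
have -> : mx_interp t z i j = lsubmx z i j + t * displ z i j by rewrite !mxE.
rewrite (le_trans (ler_normD _ _))// mulrDl mul1r lerD//.
  by rewrite (le_trans (hB _ zl i j))// lerDl.
by rewrite normrM ler_wpM2l.
Qed.

(** Cut to 0 off the compact set which carries the plans: there [F] and its
derivatives are bounded, and the curve is smooth for the sup norm. *)
Definition cost_curve F t : 'M[R]_(N, d + d) -> R :=
  (fun z => F (mx_interp t z)) \_ dprodset.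

Lemma cost_curveE F t z : dprodset z -> cost_curve F t z = F (mx_interp t z).
Proof. by move=> Kz; rewrite /cost_curve patchE mem_set. Qed.

Lemma cost_curve0 F t z : ~ dprodset z -> cost_curve F t z = 0.
Proof. by move=> Kz; rewrite /cost_curve patchE memNset. Qed.

Lemma bmeas_cost_curve F t : continuous F -> bmeas (cost_curve F t).
Proof.
move=> cF; split.
  apply/(measurable_restrictT _ measurable_dprodset).
  apply: measurable_funTS; apply: measurableT_comp.
    exact: continuous_measurable_mx.
  exact: measurable_mx_interp.
have [B B0 hB] := dprodset_bounded.
have [M hM] := continuous_cube_bounded ((1 + `|t|) * B) cF.
exists `|M| => z; have [Kz|Kz] := pselect (dprodset z); last first.
  by rewrite cost_curve0// normr0.
rewrite cost_curveE// (le_trans _ (ler_norm M))//; apply: hM => i j.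
by have [_ h] := hB _ Kz; exact: h.
Qed.

Definition dcoord e : 'M[R]_(N, d + d) -> R :=
  (fun z => displ z e.1 e.2) \_ dprodset.

Lemma bmeas_dcoord e : bmeas (dcoord e).
Proof.
split.
  apply/(measurable_restrictT _ measurable_dprodset).
  by apply: measurable_funTS; exact: measurable_displ.
have [B B0 hB] := dprodset_bounded.
exists B => z; rewrite /dcoord patchE; case: ifPn => [|_]; last by rewrite normr0.
by rewrite inE => Kz; have [h _] := hB _ Kz; exact: h.
Qed.

Lemma cost_curve_cont F : continuous F -> unif_cont (cost_curve F).
Proof.
move=> cF t eps e0; have [B B0 hB] := dprodset_bounded.
have [del d0 hd] := heine_cantor ((1 + `|t|) * B) cF e0.
have B1 : 0 < B + 1 by lra.
apply: filterS (near_dist_lt t (divr_gt0 d0 B1)) => s hs z.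
have [Kz|Kz] := pselect (dprodset z); last first.
  by rewrite !cost_curve0// subrr normr0 ltW.
have [h1 h2] := hB _ Kz.
rewrite !cost_curveE//; apply: hd => i j; first exact: h2.
rewrite (mx_interpD t s) mxE addrAC subrr add0r mxE normrM.
apply: (@le_trans _ _ (del / (B + 1) * B)); first by rewrite ler_pM.
by rewrite mulrAC ler_pdivrMr// ler_pM2l//; lra.
Qed.

(** The chain rule, uniform in [z] because the partial derivatives are
uniformly continuous near the compact set of interpolated points. *)
Lemma cost_curve_deriv F : Ck 1 F -> unif_deriv (cost_curve F)
  (fun t z => \sum_e cost_curve (partial e F) t z * dcoord e z).
Proof.
move=> [dF cF] t eps e0; have [B B0 hB] := dprodset_bounded.
have dF' e y : derivable F y (delta_mx e.1 e.2) by exact: (dF [::]).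
have cF' e : continuous (partial e F) by exact: (cF [:: e]).
pose n := #|{: 'I_N * 'I_d}|%:R : R.
have n0 : 0 <= n by exact: ler0n.
have D0 : 0 < n * B + 1 by rewrite ltr_wpDl// mulr_ge0.
have e2 : 0 < eps / (n * B + 1) by rewrite divr_gt0.
have hd e := heine_cantor ((1 + `|t|) * B) (cF' e) e2.
have [del d0 hdel] : exists2 del : R, 0 < del & forall e (x y : 'M[R]_(N, d)),
    cube ((1 + `|t|) * B) x -> (forall i j, `|y i j - x i j| <= del) ->
    `|partial e F y - partial e F x| <= eps / (n * B + 1).
  pose del e := s2val (cid2 (hd e)).
  have del0 e : 0 < del e by exact: s2valP (cid2 (hd e)).
  exists (\big[Order.min/1]_e del e).
    by apply/bigmin_gtP; split => // e _.
  move=> e x y cx hxy; apply: (s2valP' (cid2 (hd e))) => // i j.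
  apply: (le_trans (hxy i j)); apply: bigmin_le_cond => //.
have B1 : 0 < B + 1 by lra.
apply: filterS (near_dist_lt t (divr_gt0 d0 B1)) => s hs z.
have [Kz|Kz] := pselect (dprodset z); last first.
  rewrite !cost_curve0// big1 ?mulr0 ?subrr ?normr0.
    by rewrite mulr_ge0// ltW.
  by move=> e _; rewrite cost_curve0// mul0r.
have [h1 h2] := hB _ Kz.
have -> : \sum_e cost_curve (partial e F) t z * dcoord e z =
    \sum_e partial e F (mx_interp t z) * displ z e.1 e.2.
  by apply: eq_bigr => e _; rewrite cost_curveE// /dcoord patchE mem_set.
rewrite !cost_curveE// (mx_interpD t s).
have := @taylor_coordinates _ _ _ F (fun e => partial e F (mx_interp t z))
  (mx_interp t z) ((s - t) *: displ z) (eps / (n * B + 1)) dF'.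
move=> /(_ _)/wrap[|].
  move=> e y hy; apply: hdel => [i j|i j]; first exact: h2.
  apply: (le_trans (hy i j)); rewrite mxE normrM.
  apply: (@le_trans _ _ (del / (B + 1) * B)); first by rewrite ler_pM.
  by rewrite mulrAC ler_pdivrMr// ler_pM2l//; lra.
have -> : \sum_e ((s - t) *: displ z) e.1 e.2 * partial e F (mx_interp t z) =
    (s - t) * \sum_e partial e F (mx_interp t z) * displ z e.1 e.2.
  by rewrite mulr_sumr; apply: eq_bigr => e _; rewrite mxE; ring.
move=> /le_trans; apply.
have hs2 : \sum_e `|((s - t) *: displ z) e.1 e.2| <= `|s - t| * (n * B).
  apply: (@le_trans _ _ (\sum_(e : 'I_N * 'I_d) `|s - t| * B)).
    by apply: ler_sum => e _; rewrite mxE normrM ler_wpM2l.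
  by rewrite sumr_const -[leLHS]mulr_natl mulrCA.
apply: (le_trans (ler_wpM2l (ltW e2) hs2)).
rewrite mulrCA [leRHS]mulrC ler_wpM2l//.
by rewrite mulrAC ler_pdivrMr// ler_pM2l//; lra.
Qed.

Lemma dpartial_rcons m n (s : seq ('I_m * 'I_n)) a (F : 'M[R]_(m, n) -> R) :
  dpartial s (partial a F) = dpartial (rcons s a) F.
Proof. by rewrite /dpartial foldr_rcons. Qed.

Lemma Ck_partial m n k a (F : 'M[R]_(m, n) -> R) : Ck k.+1 F -> Ck k (partial a F).
Proof.
move=> [dF cF]; split=> [s ij sk x|s sk]; rewrite dpartial_rcons.
  by apply: dF; rewrite size_rcons ltnS.
by apply: cF; rewrite size_rcons ltnS.
Qed.

Lemma Ck_le m n k k' (F : 'M[R]_(m, n) -> R) : (k <= k')%N -> Ck k' F -> Ck k F.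
Proof.
move=> kk [dF cF]; split=> [s ij sk|s sk]; first by apply: dF; exact: leq_trans kk.
by apply: cF; exact: leq_trans kk.
Qed.

Lemma Ck_continuous m n k (F : 'M[R]_(m, n) -> R) : Ck k F -> continuous F.
Proof. by move=> [_ cF]; exact: (cF [::]). Qed.

(** The derivative is a combination of the cost curves of the partial
derivatives, with coefficients which do not depend on time. *)
Theorem smooth_cost_curve k F : Ck k F -> smooth_curve k (cost_curve F).
Proof.
elim: k F => [|k IH] F CF; have cF := Ck_continuous CF.
  by split=> [t|]; [exact: bmeas_cost_curve|exact: cost_curve_cont].
split=> [t|]; first exact: bmeas_cost_curve.
exists (fun t z => \sum_e cost_curve (partial e F) t z * dcoord e z).
  apply: smooth_curve_sum => e; apply: smooth_curveM.
    by apply: IH; exact: Ck_partial.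
  exact/smooth_curve_cst/bmeas_dcoord.
by apply: cost_curve_deriv; exact: Ck_le CF.
Qed.

End interpolated_cost.

(** * A smooth cutoff of the line *)

Section cutoff.
Context {R : realType}.
Implicit Types (x y t a : R).

Lemma is_derive_quotient (f : R -> R) t a : is_derive t 1 f a ->
  forall eps, 0 < eps -> \forall s \near t,
    `|f s - f t - (s - t) * a| <= eps * `|s - t|.
Proof.
move=> [df fa] eps e0.
have /cvgrPdist_le/(_ _ e0) : h^-1 *: (f (h *: 1 + t) - f t) @[h --> 0^'] --> a.
  by rewrite -fa; exact: df.
move=> hn; have : \forall h \near (0 : R), h != 0 ->
    `|a - h^-1 *: (f (h *: 1 + t) - f t)| <= eps by exact: hn.
move=> /nbhs_ballP[r /= r0 hr]; apply/nbhs_ballP; exists r => //= s ts.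
have [->|st] := eqVneq s t; first by rewrite !subrr mul0r subrr normr0 mulr0.
have st0 : s - t != 0 by rewrite subr_eq0.
have := hr (s - t); rewrite /ball/= sub0r normrN distrC => /(_ ts st0).
rewrite [(s - t) *: 1]mulr1 subrK -[_ *: _]/(_ * _) => h.
have -> : f s - f t - (s - t) * a = - ((a - (s - t)^-1 * (f s - f t)) * (s - t)).
  by field.
by rewrite normrN normrM (distrC t) ler_wpM2r.
Qed.

(** Gluing with a constant at a point where the derivative vanishes. *)
Lemma is_derive_glue (g g' : R -> R) (sg L : R) x : `|sg| = 1 ->
  (forall y, is_derive y 1 g (g' y)) -> g' 0 = 0 ->
  is_derive x 1 (fun t => g (Num.max (sg * t - L) 0))
    (sg * g' (Num.max (sg * x - L) 0)).
Proof.
move=> sg1 dg g'0; apply: quotient_is_derive => eps e0.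
set y0 := Num.max (sg * x - L) 0.
have /nbhs_ballP[r /= r0 hr] := is_derive_quotient (dg y0) e0.
have hd s : `|Num.max (sg * s - L) 0 - y0| <= `|s - x|.
  have E : `|(sg * s - L) - (sg * x - L)| = `|s - x|.
    have -> : sg * s - L - (sg * x - L) = sg * (s - x) by ring.
    by rewrite normrM sg1 mul1r.
  rewrite -E /y0; case: (leP 0 (sg * s - L)) => h1; case: (leP 0 (sg * x - L)) => h2 //.
  - by rewrite subr0 !ger0_norm //; lra.
  - by rewrite sub0r normrN ger0_norm// ler_normr; apply/orP; right; lra.
  - by rewrite subrr normr0.
have [x0|x0] := leP (sg * x - L) 0.
  have y00 : y0 = 0 by rewrite /y0 max_r.
  apply/nbhs_ballP; exists r => //= s xs.
  have := hr (Num.max (sg * s - L) 0); rewrite /ball/= distrC => /(_ _)/wrap[|].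
    by apply: le_lt_trans (hd s) _; rewrite distrC.
  rewrite y00 g'0 !mulr0 => h; apply: (le_trans h).
  by rewrite ler_wpM2l ?(ltW e0)//; have := hd s; rewrite y00.
have y0E : y0 = sg * x - L by rewrite /y0 max_l// ltW.
pose r' := Num.min r (sg * x - L).
have r'0 : 0 < r' by rewrite lt_min r0.
apply/nbhs_ballP; exists r' => //= s; rewrite /ball/= lt_min => /andP[xs1 xs2].
have s0 : 0 < sg * s - L.
  have : `|sg * (x - s)| < sg * x - L by rewrite normrM sg1 mul1r.
  by rewrite ltr_norml => /andP[_]; lra.
have := hr (Num.max (sg * s - L) 0); rewrite /ball/= distrC => /(_ _)/wrap[|].
  by apply: le_lt_trans (hd s) _; rewrite distrC.
move=> h; have := le_trans h (ler_wpM2l (ltW e0) (hd s)).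
rewrite max_l ?(ltW s0)// y0E.
by congr (`|_| <= _); ring.
Qed.

(** The excess [w] over [L] will be replaced by [sin w]; the correction
[sin w - w] and its first two derivatives vanish at 0, which makes the gluing
of class C^2. *)
Definition cut0 w : R := sin w - w.
Definition cut1 w : R := cos w - 1.
Definition cut2 w : R := - sin w.

Lemma is_derive_cut0 y : is_derive y 1 cut0 (cut1 y).
Proof. exact: (is_deriveB (is_derive_sin y) (is_derive_id y 1)). Qed.

Lemma is_derive_cut1 y : is_derive y 1 cut1 (cut2 y).
Proof.
have := is_deriveB (is_derive_cos y) (is_derive_cst (1 : R) y 1).
by rewrite subr0.
Qed.

Variable L : R.
Hypothesis L0 : 0 <= L.

(** The identity on [[-L, L]], bounded, of class C^2. The positive part of the
excess is taken on both sides, the signs [1] and [-1] being written out as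
factors for [is_derive_glue]. *)
Definition clip x : R :=
  x + cut0 (Num.max (1 * x - L) 0) - cut0 (Num.max (-1 * x - L) 0).
Definition clip1 x : R :=
  1 + cut1 (Num.max (1 * x - L) 0) + cut1 (Num.max (-1 * x - L) 0).
Definition clip2 x : R :=
  cut2 (Num.max (1 * x - L) 0) - cut2 (Num.max (-1 * x - L) 0).

Lemma is_derive_clip x : is_derive x 1 clip (clip1 x).
Proof.
have c0 : cut1 0 = 0 by rewrite /cut1 cos0 subrr.
have d1 := is_derive_glue L x (normr1 R) is_derive_cut0 c0.
have N1 : `|-1 : R| = 1 by rewrite normrN1.
have d2 := is_derive_glue L x N1 is_derive_cut0 c0.
have := is_deriveB (is_deriveD (is_derive_id x 1) d1) d2.
by rewrite mul1r mulN1r opprK.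
Qed.

Lemma is_derive_clip1 x : is_derive x 1 clip1 (clip2 x).
Proof.
have c0 : cut2 0 = 0 by rewrite /cut2 sin0 oppr0.
have d1 := is_derive_glue L x (normr1 R) is_derive_cut1 c0.
have N1 : `|-1 : R| = 1 by rewrite normrN1.
have d2 := is_derive_glue L x N1 is_derive_cut1 c0.
have := is_deriveD (is_deriveD (is_derive_cst (1 : R) x 1) d1) d2.
by rewrite mul1r mulN1r add0r.
Qed.

Lemma continuous_is_derive (f f' : R -> R) : (forall x, is_derive x 1 f (f' x)) ->
  continuous f.
Proof.
move=> df x; apply: differentiable_continuous; apply/derivable1_diffP.
by have [] := df x.
Qed.

Lemma continuous_clip2 : continuous clip2.
Proof.
have cm (sg : R) : continuous (fun x => Num.max (sg * x - L) 0).
  move=> x; apply: (@continuous_max _ _ (fun x => sg * x - L) (cst 0)).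
    by apply: cvgB; [apply: cvgMr; exact: cvg_id|exact: cvg_cst].
  exact: cvg_cst.
have cc (sg : R) : continuous (fun x => cut2 (Num.max (sg * x - L) 0)).
  move=> x; apply: cvgN; apply: (continuous_comp (cm sg x)); exact: continuous_sin.
by move=> x; apply: cvgB; exact: cc.
Qed.

Lemma clip_id x : `|x| <= L -> clip x = x.
Proof.
rewrite ler_norml => /andP[h1 h2].
by rewrite /clip !max_r; [ring|lra|lra].
Qed.

Lemma norm_clip_le x : `|clip x| <= L + 1.
Proof.
rewrite /clip /cut0.
have s0 : sin 0 = 0 :> R by exact: sin0.
have [h1|h1] := leP (1 * x - L) 0; have [h2|h2] := leP (-1 * x - L) 0;
  rewrite ?s0; rewrite ler_norml; apply/andP; split;
  have := sin_le1 (1 * x - L); have := sin_geN1 (1 * x - L);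
  have := sin_le1 (-1 * x - L); have := sin_geN1 (-1 * x - L);
  move: (sin (1 * x - L)) (sin (-1 * x - L)) => p q *; move: L0; lra.
Qed.

Lemma norm_clip1_le x : `|clip1 x| <= 5.
Proof.
rewrite /clip1 /cut1 ler_norml.
set w := Num.max _ _; set w' := Num.max (-1 * x - L) _.
by have := cos_le1 w; have := cos_geN1 w; have := cos_le1 w';
  have := cos_geN1 w' => *; apply/andP; split; lra.
Qed.

Lemma norm_clip2_le x : `|clip2 x| <= 2.
Proof.
rewrite /clip2 /cut2 ler_norml.
set w := Num.max _ _; set w' := Num.max (-1 * x - L) _.
by have := sin_le1 w; have := sin_geN1 w; have := sin_le1 w';
  have := sin_geN1 w' => *; apply/andP; split; lra.
Qed.

End cutoff.

(** * Extensions with bounded derivatives *)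

Lemma le_sum_term {R : realType} {I : finType} (F : I -> R) i :
  (forall j, 0 <= F j) -> F i <= \sum_j F j.
Proof. by move=> F0; rewrite (bigD1 i)//= lerDl sumr_ge0. Qed.

Section bounded_extension.
Context {R : realType} {m n : nat}.
Implicit Types (F : 'M[R]_(m, n) -> R) (x y v : 'M[R]_(m, n)) (e : 'I_m * 'I_n).

Lemma is_derive_of_line F v x (a : R) :
  is_derive (0 : R) 1 (fun s => F (x + s *: v)) a -> is_derive x v F a.
Proof.
have E : (fun h : R => h^-1 *: (F (x + (h *: 1 + 0) *: v) - F (x + 0 *: v))) =
    (fun h : R => h^-1 *: (F (h *: v + x) - F x)).
  apply/funext => h; congr (_ *: (F _ - F _)); last by rewrite scale0r addr0.
  by rewrite [h *: 1]mulr1 addr0 addrC.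
by move=> [dF Fa]; apply: DeriveDef; [move: dF|move: Fa]; rewrite /derivable /derive/= E.
Qed.

Lemma entry_line x e e' (s : R) :
  (x + s *: delta_mx e.1 e.2 : 'M[R]_(m, n)) e'.1 e'.2 =
  x e'.1 e'.2 + s * (e' == e)%:R.
Proof. by rewrite !mxE -pair_eqE. Qed.

Lemma is_derive_entry (h h' : R -> R) e e' x :
  (forall t : R, is_derive t 1 h (h' t)) ->
  is_derive x (delta_mx e.1 e.2) (fun y => h (y e'.1 e'.2))
    (if e' == e then h' (x e'.1 e'.2) else 0).
Proof.
move=> dh; apply: is_derive_of_line; under eq_fun do rewrite entry_line.
case: eqVneq => _.
  apply: quotient_is_derive => eps e0.
  have /nbhs_ballP[r /= r0 hr] := is_derive_quotient (dh (x e'.1 e'.2)) e0.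
  apply/nbhs_ballP; exists r => //= s; rewrite /ball/= sub0r normrN => sr.
  have := hr (x e'.1 e'.2 + s); rewrite /ball/= opprD addrA subrr sub0r normrN.
  by move=> /(_ sr); rewrite mul0r addr0 mulr1 subr0 (addrC (x _ _) s) addrK.
under eq_fun do rewrite mulr0 addr0.
exact: is_derive_cst.
Qed.

Variable L : R.
Local Notation clip := (clip L).
Local Notation clip1 := (clip1 L).
Local Notation clip2 := (clip2 L).

Definition mx_clip x : 'M[R]_(m, n) := map_mx clip x.

Lemma mx_clip_continuous (f : 'M[R]_(m, n) -> R) : continuous f ->
  continuous (fun x => f (mx_clip x)).
Proof.
move=> cf x; apply: continuous_comp (cf _) => A /nbhs_ballP[r /= r0 hr].
have cc := continuous_is_derive (is_derive_clip L).
have : nbhs x (fun y : 'M[R]_(m, n) =>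
    forall e, ball (clip (x e.1 e.2)) r (clip (y e.1 e.2))).
  have FF : Filter (nbhs (x : 'M[R]_(m, n))) by exact: nbhs_filter.
  apply: (@filter_forall 'M[R]_(m, n) ('I_m * 'I_n)%type
    (fun e (y : 'M[R]_(m, n)) => ball (clip (x e.1 e.2)) r (clip (y e.1 e.2))) _ FF) => e.
  have ce : continuous (fun y : 'M[R]_(m, n) => clip (y e.1 e.2)).
    by move=> y; apply: continuous_comp (cc _); exact: coord_continuous.
  exact: (ce x _ (nbhsx_ballx _ _ r0)).
apply: filterS => y hy; apply: hr; split => // i j.
by rewrite !mxE; exact: (hy (i, j)).
Qed.

Lemma mx_clip_line x e (s : R) :
  mx_clip (x + s *: delta_mx e.1 e.2) =
  mx_clip x + (clip (x e.1 e.2 + s) - clip (x e.1 e.2)) *: delta_mx e.1 e.2.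
Proof.
apply/matrixP => i j; rewrite !mxE.
have [/andP[/eqP -> /eqP ->]|_] := boolP ((i == e.1) && (j == e.2)).
  by rewrite !mulr1 [RHS]addrC subrK.
by rewrite !mulr0 !addr0.
Qed.

Lemma is_derive_mx_clip F x e : (forall y, derivable F y (delta_mx e.1 e.2)) ->
  is_derive x (delta_mx e.1 e.2) (fun y => F (mx_clip y))
    (partial e F (mx_clip x) * clip1 (x e.1 e.2)).
Proof.
move=> dF; apply: is_derive_of_line; under eq_fun do rewrite mx_clip_line.
pose g (s : R) := F (mx_clip x + s *: delta_mx e.1 e.2).
pose s (r : R) := clip (x e.1 e.2 + r) - clip (x e.1 e.2).
have dg : is_derive (s 0) 1 g (partial e F (mx_clip x)).
  have := is_derive_line (x := mx_clip x) (r := s 0) (dF (mx_clip x + s 0 *: delta_mx e.1 e.2)).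
  by rewrite /s addr0 subrr scale0r addr0.
have ds : is_derive (0 : R) 1 s (clip1 (x e.1 e.2)).
  apply: quotient_is_derive => eps e0.
  have /nbhs_ballP[r /= r0 hr] := is_derive_quotient (is_derive_clip L (x e.1 e.2)) e0.
  apply/nbhs_ballP; exists r => //= t; rewrite /ball/= sub0r normrN => sr.
  have := hr (x e.1 e.2 + t); rewrite /ball/= opprD addrA subrr sub0r normrN.
  move=> /(_ sr); rewrite /s addr0 subrr !subr0.
  by rewrite (addrC (x _ _) t) addrK.
exact: is_derive1_comp dg ds.
Qed.

Local Notation clipped F := (fun y => F (mx_clip y)).

Lemma partial_clipped F e : (forall y, derivable F y (delta_mx e.1 e.2)) ->
  partial e (clipped F) = fun x => partial e F (mx_clip x) * clip1 (x e.1 e.2).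
Proof.
move=> dF; apply/funext => x.
by have := is_derive_mx_clip x dF => h; apply: derive_val.
Qed.

Section twice.
Variable F : 'M[R]_(m, n) -> R.
Hypothesis CF : Ck 2 F.

Let d1 e y : derivable F y (delta_mx e.1 e.2).
Proof. by case: CF => dF _; exact: (dF [::]). Qed.

Let d2 e e' y : derivable (partial e F) y (delta_mx e'.1 e'.2).
Proof. by case: CF => dF _; exact: (dF [:: e]). Qed.

Let c0 : continuous F.
Proof. by case: CF => _ cF; exact: (cF [::]). Qed.

Let c1 e : continuous (partial e F).
Proof. by case: CF => _ cF; exact: (cF [:: e]). Qed.

Let c2 e e' : continuous (partial e' (partial e F)).
Proof. by case: CF => _ cF; exact: (cF [:: e'; e]). Qed.

Let hess e e' x := partial e F (mx_clip x) * (if e == e' then clip2 (x e.1 e.2) else 0)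
  + clip1 (x e.1 e.2) * (partial e' (partial e F) (mx_clip x) * clip1 (x e'.1 e'.2)).

Let dhess e e' x :
  is_derive x (delta_mx e'.1 e'.2) (partial e (clipped F)) (hess e e' x).
Proof.
rewrite (partial_clipped (@d1 e)).
exact: is_deriveM (is_derive_mx_clip x (@d2 e e')) (is_derive_entry e' e x (is_derive_clip1 L)).
Qed.

Let hessE e e' : partial e' (partial e (clipped F)) = hess e e'.
Proof. by apply/funext => x; have h := dhess e e' x; apply: derive_val. Qed.

Let centry (h : R -> R) e : continuous h -> continuous (fun x : 'M[R]_(m, n) => h (x e.1 e.2)).
Proof.
by move=> ch x; apply: continuous_comp (ch _); exact: coord_continuous.
Qed.

Let cclip1 : continuous clip1.
Proof. exact: continuous_is_derive (is_derive_clip1 L). Qed.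

Let cD (f g : 'M[R]_(m, n) -> R) : continuous f -> continuous g ->
  continuous (fun x => f x + g x).
Proof. by move=> cf cg x; exact: (cvgD (cf x) (cg x)). Qed.

Let cM (f g : 'M[R]_(m, n) -> R) : continuous f -> continuous g ->
  continuous (fun x => f x * g x).
Proof. by move=> cf cg x; exact: (cvgM (cf x) (cg x)). Qed.

Let chess e e' : continuous (hess e e').
Proof.
rewrite /hess; apply: cD; apply: cM.
- exact: mx_clip_continuous.
- case: (e == e'); last exact: cst_continuous.
  exact: centry (@continuous_clip2 _ L).
- exact: centry.
- by apply: cM; [exact: mx_clip_continuous|exact: centry].
Qed.

Lemma Ck_clipped : Ck 2 (clipped F).
Proof.
split.
  move=> [|a [|//]] ij _ x /=.
    by have [] := is_derive_mx_clip x (@d1 ij).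
  by have [] := dhess a ij x.
move=> [|a [|b [|//]]] _ /=.
- exact: mx_clip_continuous.
- rewrite -/(partial a (clipped F)) partial_clipped//.
  by apply: cM; [exact: mx_clip_continuous|exact: centry].
- by rewrite -/(partial b (clipped F)) -/(partial a (partial b (clipped F))) hessE.
Qed.

Hypothesis L0 : 0 <= L.

Lemma clipped_bounded : exists M : R, forall s, (size s <= 2)%N ->
  forall x, `|dpartial s (clipped F) x| <= M.
Proof.
have clip_cube x : cube (L + 1) (mx_clip x).
  by move=> i j; rewrite mxE; exact: norm_clip_le.
have [B0 h0] := continuous_cube_bounded (L + 1) c0.
have b1 e : {B : R | forall x, cube (L + 1) x -> `|partial e F x| <= B}.
  by apply: cid; exact: continuous_cube_bounded.
have b2 e e' : {B : R | forall x, cube (L + 1) x -> `|partial e' (partial e F) x| <= B}.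
  by apply: cid; exact: continuous_cube_bounded.
pose S1 := \sum_e `|sval (b1 e)|; pose S2 := \sum_e \sum_e' `|sval (b2 e e')|.
have S10 : 0 <= S1 by exact: sumr_ge0.
have S20 : 0 <= S2 by apply: sumr_ge0 => e _; exact: sumr_ge0.
have h1 e x : `|partial e F (mx_clip x)| <= S1.
  apply: (le_trans (svalP (b1 e) _ (clip_cube x))); apply: (le_trans (ler_norm _)).
  exact: (le_sum_term (F := fun e => `|sval (b1 e)|)).
have h2 e e' x : `|partial e' (partial e F) (mx_clip x)| <= S2.
  apply: (le_trans (svalP (b2 e e') _ (clip_cube x))); apply: (le_trans (ler_norm _)).
  apply: (le_trans (le_sum_term (F := fun e' => `|sval (b2 e e')|) e' _)) => //.
  apply: (le_sum_term (F := fun e => \sum_e' `|sval (b2 e e')|)) => i.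
  exact: sumr_ge0.
(* The first and second derivatives of [clip] are bounded by 5 and 2: the
chain rule multiplies [S1] by 5 at first order and by 2 at second order, and
[S2] by 5 * 5. *)
exists (`|B0| + 7 * S1 + 25 * S2) => -[|a [|b [|//]]] _ x.
- apply: (le_trans (h0 _ (clip_cube x))); have := ler_norm B0; lra.
- rewrite [dpartial _ _](partial_clipped (@d1 a)) normrM.
  have := ler_pM (normr_ge0 _) (normr_ge0 _) (h1 a x) (norm_clip1_le L (x a.1 a.2)).
  by have := normr_ge0 B0; lra.
- rewrite [dpartial _ _](hessE b a) /hess.
  rewrite (le_trans (ler_normD _ _))// !normrM.
  have k1 : `|if b == a then clip2 (x b.1 b.2) else 0| <= 2.
    by case: ifP => _; [exact: norm_clip2_le|rewrite normr0].
  have k2 := ler_pM (normr_ge0 _) (normr_ge0 _) (h1 b x) k1.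
  have k3 := ler_pM (normr_ge0 _) (normr_ge0 _) (h2 b a x) (norm_clip1_le L (x a.1 a.2)).
  have k4 := ler_pM (normr_ge0 _) (mulr_ge0 (normr_ge0 _) (normr_ge0 _))
    (norm_clip1_le L (x b.1 b.2)) k3.
  by have := normr_ge0 B0; lra.
Qed.

End twice.

End bounded_extension.

(** Composing an extension with the cutoff of each entry gives an extension
with globally bounded derivatives. The infimum in the norm is thus finite, and
attained up to 1. *)
Lemma Ck_norm_attained {R : realType} {m n : nat} (K : set 'M[R]_(m, n))
    (c : 'M[R]_(m, n) -> R) (L : R) : 0 <= L -> K `<=` cube L -> Ck_on 2 K c ->
  exists F, [/\ Ck 2 F, forall x, K x -> F x = c x &
    forall s, (size s <= 2)%N -> forall x,
      `|dpartial s F x| <= `|Ck_norm 2 K c| + 1].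
Proof.
move=> L0 KL [F0 [CF0 F0c]].
set A := [set ereal_sup [set `|dpartial s F x|%:E |
  s in [set s | (size s <= 2)%N] & x in setT] | F in Ck_ext 2 K c].
have ub (F : 'M[R]_(m, n) -> R) s x : (size s <= 2)%N -> (`|dpartial s F x|%:E <=
    ereal_sup [set `|dpartial s F x|%:E |
      s in [set s | (size s <= 2)%N] & x in setT])%E.
  by move=> ss; apply: ereal_sup_ubound; exists s => //; exists x.
have inf0 : (0 <= ereal_inf A)%E.
  apply: le_ereal_inf_tmp => _ [F _ <-].
  have h : (0%:E <= `|dpartial [::] F 0|%:E)%E by rewrite lee_fin.
  exact: (le_trans h (ub F [::] 0 isT)).
have [M hM] := clipped_bounded CF0 L0.
have infM : (ereal_inf A <= M%:E)%E.
  apply: ge_ereal_inf; exists (ereal_sup [set `|dpartial s (fun y => F0 (mx_clip L y)) x|%:E |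
      s in [set s | (size s <= 2)%N] & x in setT]).
    exists (fun y => F0 (mx_clip L y)) => //; split; first exact: Ck_clipped.
    move=> x Kx; rewrite -F0c//; congr F0; apply/matrixP => i j.
    by rewrite mxE clip_id//; exact: KL.
  by apply: ge_ereal_sup => _ [s ss [x _ <-]]; rewrite lee_fin; exact: hM.
have inffin : ereal_inf A \is a fin_num.
  by rewrite ge0_fin_numE// (le_lt_trans infM)// ltry.
have [y [F [CF Fc] <-] hy] := lb_ereal_inf_adherent ltr01 inffin.
exists F; split => // s ss x; rewrite -lee_fin; apply: (le_trans (ub F s x ss)).
apply: (le_trans (ltW hy)); rewrite -(fineK inffin) -EFinD lee_fin lerD2r.
exact: ler_norm.
Qed.

(** * Transport to a fixed product measure *)

Section transported.
Context {R : realType} {N d : nat}.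

Definition pair_row (p : 'rV[R]_d * 'rV[R]_d) : 'rV[R]_(d + d) := row_mx p.1 p.2.

Lemma measurable_pair_row : measurable_fun setT pair_row.
Proof.
apply: measurable_fun_mx => i j.
rewrite (_ : (fun _ => _) = fun p : 'rV[R]_d * 'rV[R]_d =>
    match fintype.split j with inl k => p.1 i k | inr k => p.2 i k end); last first.
  by apply/funext => p; rewrite mxE.
case: (fintype.split j) => k.
  by apply: (measurableT_comp (measurable_coord i k)); exact: measurable_fst.
by apply: (measurableT_comp (measurable_coord i k)); exact: measurable_snd.
Qed.

HB.instance Definition _ :=
  isMeasurableFun.Build _ _ _ _ pair_row measurable_pair_row.

Context (X : 'I_N -> set 'rV[R]_d).
Context (g : 'I_N -> probability ('rV[R]_d * 'rV[R]_d)%type R).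
Hypothesis cX : forall i, compact (X i).
Hypothesis vX : forall i, convex_set (X i).
Hypothesis gX : forall i, prob_on (X i `*` X i) (g i).

Definition plan_row i : probability 'rV[R]_(d + d) R := distribution (g i) pair_row.

Local Notation P := (prod_measure plan_row).
Local Notation u := (@resample R N (d + d)).

(** The marginals at time [t], described by their values on sets: at times 0
and 1 this covers the given marginals themselves, and not only the images of
the plans. *)
Definition transported t (mu : 'I_N -> probability 'rV[R]_d R) :=
  forall i A, measurable A -> mu i A = g i (interp t @^-1` A).

Let uP : resampling P u. Proof. exact: resampling_prod_measure. Qed.

Let mX i : measurable (X i). Proof. exact: compact_measurable_mx. Qed.

Lemma mx_interp_pair t p : mx_interp t (pair_row p) = interp t p.
Proof.
rewrite /mx_interp /pair_row row_mxKl row_mxKr /interp scalerBl scale1r.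
by rewrite scalerBr addrA addrAC.
Qed.

Lemma row_mx_interp t i (z : 'M[R]_(N, d + d)) :
  row i (mx_interp t z) = mx_interp t (row i z).
Proof. by apply/rowP => j; rewrite !mxE. Qed.

Lemma transported_prod t mu : transported t mu -> forall B, measurable B ->
  prod_measure mu B = P (@mx_interp R d N t @^-1` B).
Proof.
move=> tmu; apply: (@prod_measure_rowwise _ _ _ _ _ _ (@mx_interp R d 1 t)).
- exact: measurable_mx_interp.
- exact: measurable_mx_interp.
- by move=> i z; rewrite row_mx_interp.
- move=> i A mA; rewrite tmu//= /distribution /pushforward.
  by congr (g i _); apply/seteqP; split=> p /=; rewrite mx_interp_pair.
Qed.

Lemma mean_transported t mu f : transported t mu -> bmeas f ->
  mean P (fun z => f (mx_interp t z)) = mean (prod_measure mu) f.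
Proof.
move=> tmu bf; have [mf [M fM]] := bf.
have bfi : bmeas (fun z => f (@mx_interp R d N t z)).
  split; last by exists M.
  by apply: measurableT_comp mf _; exact: measurable_mx_interp.
apply: EFin_inj; rewrite -!meanE//.
have mfE : measurable_fun setT (EFin \o f) by exact/measurable_EFinP.
have intf : P.-integrable (@mx_interp R d N t @^-1` setT)
    ((EFin \o f) \o @mx_interp R d N t).
  by rewrite preimage_setT; exact: bmeas_integrable.
have := integral_pushforward (measurable_mx_interp t) mfE intf measurableT.
rewrite preimage_setT => <-.
apply: eq_measure_integral; first exact: measurable_mx_interp.
by move=> *; apply/esym; exact: transported_prod.
Qed.

Lemma resample_mx_interp t i x y :
  mx_interp t (u i x y) = resample i (mx_interp t x) (mx_interp t y).
Proof. by apply/matrixP => k l; rewrite !mxE; case: (k == i). Qed.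

Lemma cmean_transported t mu f i z : transported t mu -> bmeas f ->
  cmean P u i (fun z => f (mx_interp t z)) z =
  cmean (prod_measure mu) resample i f (mx_interp t z).
Proof.
move=> tmu bf; rewrite /cmean -(mean_transported tmu).
  by congr mean; apply/funext => y; rewrite resample_mx_interp.
exact: (bmeas_res (resampling_prod_measure mu)).
Qed.

Lemma aproj_transported t mu f z : transported t mu -> bmeas f ->
  aproj P u (fun z => f (mx_interp t z)) z =
  aproj (prod_measure mu) resample f (mx_interp t z).
Proof.
move=> tmu bf; rewrite !aprojE (mean_transported tmu bf); congr (_ + _).
by apply: eq_bigr => i _; rewrite (cmean_transported i z tmu bf).
Qed.

Let XX i : set 'rV[R]_(d + d) := [set r | X i (lsubmx r) /\ X i (rsubmx r)].

Let mXX i : measurable (XX i).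
Proof.
apply: measurableI.
  by have := measurable_lsubmx measurableT (mX i); rewrite setTI.
by have := measurable_rsubmx measurableT (mX i); rewrite setTI.
Qed.

Lemma dprodsetE z : dprodset X z <-> forall i, XX i (row i z).
Proof.
have rl i : lsubmx (row i z) = row i (lsubmx z) by apply/rowP => j; rewrite !mxE.
have rr i : rsubmx (row i z) = row i (rsubmx z) by apply/rowP => j; rewrite !mxE.
split=> [[h1 h2] i|h]; first by split; [rewrite rl; exact: h1|rewrite rr; exact: h2].
by split=> i; have [] := h i; rewrite rl rr.
Qed.

Let plan_rowXX i : plan_row i (XX i) = 1%E.
Proof.
rewrite -(gX i) /plan_row/= /distribution /pushforward; congr (g i _).
by apply/seteqP; split=> p /=; rewrite /XX /pair_row/= row_mxKl row_mxKr.
Qed.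

Lemma dprodset_mass : P (dprodset X) = 1%E.
Proof.
have -> : dprodset X = box XX by apply/seteqP; split=> z /dprodsetE.
by rewrite prod_measure_box// big1 // => i _; exact: plan_rowXX.
Qed.

Lemma mean_off_dprodset f : bmeas f -> (forall z, dprodset X z -> f z = 0) ->
  mean P f = 0.
Proof.
move=> bf f0; have mK := measurable_dprodset cX.
have b1 : bmeas (\1_(~` dprodset X) : 'M[R]_(N, d + d) -> R).
  split; first by apply: measurable_indic; exact: measurableC.
  by exists 1 => z; rewrite indicE; case: (_ \in _); rewrite ?normr1 ?normr0.
apply: (mean_ae0 bf b1) => [z||z]; first by rewrite indicE.
  apply: EFin_inj; rewrite -meanE// integral_indic//; last exact: measurableC.
  rewrite setIT; have := probability_setC P mK.
  by rewrite dprodset_mass subee.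
rewrite indicE => /eqP; rewrite pnatr_eq0 eqb0 => /negP h.
by apply: f0; apply: contrapT => nz; apply: h; rewrite inE.
Qed.

Lemma interp_prodset t z : 0 <= t <= 1 -> dprodset X z -> prodset X (mx_interp t z).
Proof.
move=> t01 [zl zr] i; rewrite row_mx_interp.
have rl : lsubmx (row i z) = row i (lsubmx z) by apply/rowP => j; rewrite !mxE.
have rr : rsubmx (row i z) = row i (rsubmx z) by apply/rowP => j; rewrite !mxE.
move/andP: t01 => [t0 t1].
have := set_mem (vX (Itv01 t0 t1) (mem_set (zr i)) (mem_set (zl i))).
rewrite -rl -rr; congr (X i _); apply/matrixP => a b.
by rewrite /conv/= /unstable.onem !mxE; ring.
Qed.

Let transported_on t mu : 0 <= t <= 1 -> transported t mu ->
  forall i, prob_on (X i) (mu i).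
Proof.
move=> /andP[t0 t1] tmu i; rewrite /prob_on tmu//.
have mI : measurable (interp t @^-1` X i : set ('rV[R]_d * 'rV[R]_d)).
  by have := measurable_interp t measurableT (mX i); rewrite setTI.
apply/eqP; rewrite eq_le probability_le1//=.
rewrite -(gX i); apply: le_measure; rewrite ?inE//; first exact: measurableX.
move=> [x y] [/= Xx Xy]; have := set_mem (vX (Itv01 t0 t1) (mem_set Xy) (mem_set Xx)).
by rewrite /conv/= /unstable.onem /interp/= addrC.
Qed.

(** The potential of the transported marginals, composed with the
interpolation map, is a potential of the interpolated cost for the fixed
measure [P], up to a null set; the value is the mean of either. Time now only
enters through the cost. *)
Theorem eot_transported t mu (F c : 'M[R]_(N, d) -> R) S :
  0 <= t <= 1 -> transported t mu -> continuous F ->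
  (forall x, prodset X x -> F x = c x) -> potential P u (cost_curve X F t) S ->
  eot X c mu = (mean P S)%:E.
Proof.
move=> t01 tmu cF Fc hS; have uQ := resampling_prod_measure mu.
have c0E : c \_ (prodset X) = F \_ (prodset X).
  by apply/funext => x; rewrite !patchE; case: ifPn => //; rewrite inE => /Fc.
have bc0 : bmeas (c \_ (prodset X)).
  rewrite c0E; split.
    apply/(measurable_restrictT _ (measurable_prodset mX)); apply: measurable_funTS.
    exact: continuous_measurable_mx.
  have [B B0 hB] := prodset_bounded cX; have [M hM] := continuous_cube_bounded B cF.
  exists `|M| => x; rewrite patchE; case: ifPn => [|_]; last by rewrite normr0.
  by rewrite inE => /hB /hM /le_trans; apply; exact: ler_norm.
have [S0 [hS0 _]] := potential_exists_sharp uQ bc0.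
rewrite (eot_potential mX (transported_on t01 tmu) bc0 hS0); congr EFin.
have [bS0 aS0 eS0] := hS0.
have bcomp (f : 'M[R]_(N, d) -> R) : bmeas f -> bmeas (fun z => f (@mx_interp R d N t z)).
  move=> [mf [M fM]]; split; last by exists M.
  by apply: measurableT_comp mf _; exact: measurable_mx_interp.
pose c1 z := (c \_ (prodset X)) (@mx_interp R d N t z).
pose S1 z := S0 (@mx_interp R d N t z).
have hS1 : potential P u c1 S1.
  split; first exact: bcomp.
  - by move=> z; rewrite (aproj_transported z tmu bS0) aS0.
  - move=> z; have bp := bmeas_density bc0 bS0.
    by rewrite (aproj_transported z tmu bp) eS0.
have bct := bmeas_cost_curve cX t cF.
rewrite -(mean_transported tmu bS0).
apply: (potential_value_ae uP (@bcomp _ bc0) bct hS1 hS).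
apply: mean_off_dprodset; first by apply/bmeas_norm/bmeasB => //; exact: bcomp.
move=> z Kz; rewrite cost_curveE// c0E patchE mem_set ?subrr ?normr0//.
exact: interp_prodset.
Qed.

(** The squared displacement of one pair, cut to 0 off the support of the plan
to be bounded. *)
Definition vrow i : 'rV[R]_(d + d) -> R :=
  (fun r => \sum_j displ r ord0 j ^+ 2) \_ (XX i).

Definition vsq i (z : 'M[R]_(N, d + d)) : R := vrow i (row i z).

Let vrow_ge0 i r : 0 <= vrow i r.
Proof. by rewrite /vrow patchE; case: ifP => // _; apply: sumr_ge0 => j _; exact: sqr_ge0. Qed.

Let mvrow0 : measurable_fun setT
  (fun r : 'rV[R]_(d + d) => \sum_j displ r ord0 j ^+ 2).
Proof.
apply: measurable_sum => j; apply: measurable_funX; exact: measurable_displ.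
Qed.

Let mvrow i : measurable_fun setT (vrow i).
Proof. by apply/(measurable_restrictT _ (mXX i)); exact: measurable_funTS. Qed.

Lemma vsq_ge0 i z : 0 <= vsq i z. Proof. exact: vrow_ge0. Qed.

Lemma bmeas_vsq i : bmeas (vsq i).
Proof.
split; first by apply: measurableT_comp (mvrow i) _; exact: measurable_row.
have [B B0 hB] := rows_bounded cX.
exists (\sum_(j < d) (B + B) ^+ 2) => z; rewrite ger0_norm ?vrow_ge0//.
rewrite /vsq /vrow patchE; case: ifPn => [|_]; last by apply: sumr_ge0 => j _; exact: sqr_ge0.
rewrite inE => -[hl hr]; apply: ler_sum => j _.
rewrite -real_normK ?num_real// lerXn2r ?nnegrE// ?addr_ge0//.
have -> : displ (row i z) ord0 j =
    rsubmx (row i z) ord0 j - lsubmx (row i z) ord0 j by rewrite !mxE.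
rewrite (le_trans (ler_normB _ _))// lerD//.
  exact: hB hr j.
exact: hB hl j.
Qed.

Lemma rowdep_vsq i : rowdep u i (vsq i).
Proof. by move=> x y; rewrite /vsq row_resample eqxx. Qed.

Lemma vsq_dprodset i z : dprodset X z -> vsq i z = \sum_j displ z i j ^+ 2.
Proof.
move=> /dprodsetE Kz; rewrite /vsq /vrow patchE mem_set//.
by apply: eq_bigr => j _; rewrite !mxE.
Qed.

Lemma quad_cost_plan i : quad_cost (g i) = (mean P (vsq i))%:E.
Proof.
rewrite -(meanE P (bmeas_vsq i)).
have mv : measurable_fun setT (EFin \o vrow i) by exact/measurable_EFinP.
have v0 r : (0 <= (EFin \o vrow i) r)%E by rewrite lee_fin.
have -> : (\int[P]_z (vsq i z)%:E = \int[plan_row i]_r (EFin \o vrow i) r)%E.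
  rewrite -[LHS](@ge0_integral_pushforward _ _ _ _ _ _ (measurable_row i) P setT (EFin \o vrow i))//.
  by apply: eq_measure_integral => *; [exact: measurable_row|exact: prod_measure_row].
rewrite /plan_row ge0_integral_distribution//.
apply: ae_eq_integral => //.
- apply/measurable_EFinP; rewrite (_ : (fun _ => _) =
      (fun r : 'rV[R]_(d + d) => \sum_j displ r ord0 j ^+ 2) \o pair_row).
    by apply: measurableT_comp => //; exact: measurable_pair_row.
  apply/funext => p; rewrite /= /enorm sqr_sqrtr; last first.
    by apply: sumr_ge0 => j _; exact: sqr_ge0.
  by apply: eq_bigr => j _; rewrite /displ /pair_row row_mxKl row_mxKr.
- apply: measurableT_comp mv _; exact: measurable_pair_row.
- exists (~` (X i `*` X i)); split.
  + by apply: measurableC; exact: measurableX.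
  + have := probability_setC (g i) (measurableX (mX i) (mX i)).
    by rewrite (gX i) subee.
  + move=> p /= hp [Xl Xr]; apply: hp => _.
    rewrite /vrow patchE mem_set; last by rewrite /XX /pair_row/= row_mxKl row_mxKr.
    congr EFin; rewrite /enorm sqr_sqrtr; last first.
      by apply: sumr_ge0 => j _; exact: sqr_ge0.
    by apply: eq_bigr => j _; rewrite /displ /pair_row row_mxKl row_mxKr.
Qed.

(** The optimal coupling at any time has the plans as marginals, and [vsq i]
only sees the [i]-th one. *)
Lemma mean_density_vsq c S i : bmeas c -> potential P u c S ->
  mean P (fun z => expR (S z - c z) * vsq i z) = mean P (vsq i).
Proof.
move=> bc hS; have [bS _ _] := hS; have bp := bmeas_density bc bS.
have bv := bmeas_vsq i.
rewrite -(mean_cmean uP i); last exact: bmeasM.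
congr mean; apply/funext => z.
have -> : (fun z => expR (S z - c z) * vsq i z) = (fun z => vsq i z * expR (S z - c z)).
  by apply/funext => z'; rewrite mulrC.
by rewrite (cmeanMl uP z (@rowdep_vsq i) bp) (cmean_density uP)// mulr1.
Qed.

End transported.

(** * Second order estimates of the value *)

(** Cauchy-Schwarz, from the nonnegativity of the variance of the [a i]. *)
Lemma sqr_sum_le {R : realType} {I : finType} (a : I -> R) :
  (\sum_i a i) ^+ 2 <= #|I|%:R * \sum_i a i ^+ 2.
Proof.
set n := #|I|%:R; set s := \sum_i a i.
have n0 : 0 <= n by exact: ler0n.
have h : 0 <= \sum_i (n * a i - s) ^+ 2 by apply: sumr_ge0 => i _; exact: sqr_ge0.
have E : \sum_i (n * a i - s) ^+ 2 = n * (n * \sum_i a i ^+ 2 - s ^+ 2).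
  transitivity (\sum_i (n ^+ 2 * a i ^+ 2 - 2 * n * s * a i + s ^+ 2)).
    by apply: eq_bigr => i _; ring.
  rewrite big_split/= sumrB -!mulr_sumr sumr_const -[_ *+ _]mulr_natl -/n -/s; ring.
move: h; rewrite E => h.
have [n00|n1] := eqVneq n 0; last first.
  by move: h; rewrite pmulr_rge0 ?subr_ge0// lt_neqAle eq_sym n1.
have s0 : s = 0.
  rewrite /s big1// => i _; exfalso; move/eqP: n00; rewrite pnatr_eq0.
  by move=> /eqP/card0_eq/(_ i).
by rewrite s0 expr0n/= mulr_ge0// sumr_ge0// => i _; exact: sqr_ge0.
Qed.

Section second_order.
Context {R : realType} {m n : nat} (F : 'M[R]_(m, n) -> R) (M : R).
Hypothesis CF : Ck 2 F.
Hypothesis FM : forall s, (size s <= 2)%N -> forall x, `|dpartial s F x| <= M.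
Implicit Types (x v : 'M[R]_(m, n)) (e : 'I_m * 'I_n).

Lemma lipschitz_coordinates (G : 'M[R]_(m, n) -> R) x v :
  (forall e y, derivable G y (delta_mx e.1 e.2)) ->
  (forall e y, `|partial e G y| <= M) ->
  `|G (x + v) - G x| <= M * \sum_e `|v e.1 e.2|.
Proof.
move=> dG GM; have := @taylor_coordinates _ _ _ G (fun=> 0) x v M dG.
rewrite (eq_bigr (fun=> 0)) => [|e _]; last by rewrite mulr0.
by rewrite big1// subr0; apply => e y _; rewrite subr0.
Qed.

Lemma first_order_bound x v : `|F (x + v) - F x| <= M * \sum_e `|v e.1 e.2|.
Proof.
by apply: lipschitz_coordinates => e y; [case: CF => dF _; exact: (dF [::])|exact: (FM (s := [:: e]))].
Qed.

Lemma second_order_bound x v :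
  `|F (x + v) - F x - \sum_e v e.1 e.2 * partial e F x| <=
  M * (\sum_e `|v e.1 e.2|) ^+ 2.
Proof.
rewrite expr2 mulrA; apply: taylor_coordinates.
  by move=> e y; case: CF => dF _; exact: (dF [::]).
move=> e y hy.
have -> : y = x + (y - x) by rewrite addrC subrK.
have M0 : 0 <= M by exact: le_trans (FM (s := [::]) isT x).
apply: (@le_trans _ _ (M * \sum_e' `|(y - x) e'.1 e'.2|)).
  apply: lipschitz_coordinates => e' z; first by case: CF => dF _; exact: (dF [:: e]).
  exact: (FM (s := [:: e'; e])).
rewrite ler_wpM2l//; apply: ler_sum => e' _.
by rewrite mxE [X in _ + X]mxE; exact: hy.
Qed.

End second_order.

Section cost_estimates.
Context {R : realType} {N d : nat} (X : 'I_N -> set 'rV[R]_d).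
Context (F : 'M[R]_(N, d) -> R) (M : R).
Hypothesis cX : forall i, compact (X i).
Hypothesis CF : Ck 2 F.
Hypothesis FM : forall s, (size s <= 2)%N -> forall x, `|dpartial s F x| <= M.
Implicit Types (s t : R) (z : 'M[R]_(N, d + d)).

Definition cost_speed t z := \sum_e cost_curve X (partial e F) t z * dcoord X e z.
Definition sq_displ z := \sum_i vsq X i z.
Definition dimR : R := (N * d)%:R.

Let M0 : 0 <= M. Proof. exact: le_trans (FM (s := [::]) isT 0). Qed.
Let D0 : 0 <= dimR. Proof. exact: ler0n. Qed.

Lemma sq_displ_ge0 z : 0 <= sq_displ z.
Proof.
by apply: sumr_ge0 => i _; exact: vsq_ge0.
Qed.

Lemma bmeas_sq_displ : bmeas sq_displ.
Proof. by apply: bmeas_sum => i; exact: bmeas_vsq. Qed.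

Lemma bmeas_cost_speed t : bmeas (cost_speed t).
Proof.
apply: bmeas_sum => e; apply: bmeasM; last exact: bmeas_dcoord.
by apply: bmeas_cost_curve => //; case: CF => _ cF; exact: (cF [:: e]).
Qed.

Let sum_displ z : dprodset X z -> (\sum_e `|displ z e.1 e.2|) ^+ 2 <= dimR * sq_displ z.
Proof.
move=> Kz; apply: (le_trans (sqr_sum_le _)).
rewrite card_prod !card_ord ler_wpM2l//.
rewrite -(pair_bigA _ (fun i j => `|displ z i j| ^+ 2))/=.
apply: ler_sum => i _; rewrite vsq_dprodset//.
by apply: ler_sum => j _; rewrite real_normK ?num_real.
Qed.

Let sumZ (h : R) (v : 'M[R]_(N, d)) :
  \sum_e `|(h *: v) e.1 e.2| = `|h| * \sum_e `|v e.1 e.2|.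
Proof. by rewrite mulr_sumr; apply: eq_bigr => e _; rewrite mxE normrM. Qed.

Lemma cost_curve_taylor s t z :
  `|cost_curve X F s z - cost_curve X F t z - (s - t) * cost_speed t z| <=
  M * dimR * (s - t) ^+ 2 * sq_displ z.
Proof.
have [Kz|Kz] := pselect (dprodset X z); last first.
  rewrite /cost_speed !cost_curve0// big1 ?mulr0 ?subrr ?normr0.
    by rewrite mulr_ge0 ?sq_displ_ge0// mulr_ge0 ?sqr_ge0// mulr_ge0.
  by move=> e _; rewrite cost_curve0// mul0r.
rewrite !cost_curveE// (mx_interpD t s).
have -> : (s - t) * cost_speed t z =
    \sum_e ((s - t) *: displ z) e.1 e.2 * partial e F (mx_interp t z).
  rewrite /cost_speed mulr_sumr; apply: eq_bigr => e _.
  have -> : ((s - t) *: displ z) e.1 e.2 = (s - t) * displ z e.1 e.2 by rewrite [LHS]mxE.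
  by rewrite cost_curveE// /dcoord patchE mem_set//; ring.
apply: (le_trans (second_order_bound CF FM _ _)).
rewrite sumZ exprMn real_normK ?num_real// -!mulrA ler_wpM2l//.
have := ler_wpM2l (sqr_ge0 (s - t)) (sum_displ Kz); lra.
Qed.

Lemma cost_curve_sqr s t z :
  (cost_curve X F s z - cost_curve X F t z) ^+ 2 <=
  M ^+ 2 * dimR * (s - t) ^+ 2 * sq_displ z.
Proof.
have [Kz|Kz] := pselect (dprodset X z); last first.
  rewrite !cost_curve0// subrr expr0n/=.
  by rewrite mulr_ge0 ?sq_displ_ge0// mulr_ge0 ?sqr_ge0// mulr_ge0 ?sqr_ge0.
rewrite !cost_curveE// (mx_interpD t s).
have := first_order_bound CF FM (mx_interp t z) ((s - t) *: displ z).
rewrite sumZ; set a := F _ - F _; set b := \sum_e _ => h.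
have b0 : 0 <= b by exact: sumr_ge0.
have h2 : a ^+ 2 <= (M * (`|s - t| * b)) ^+ 2.
  rewrite -real_normK ?num_real// lerXn2r ?nnegrE//.
  by rewrite mulr_ge0// mulr_ge0.
apply: (le_trans h2); rewrite !exprMn real_normK ?num_real//.
have := ler_wpM2l (mulr_ge0 (sqr_ge0 M) (sqr_ge0 (s - t))) (sum_displ Kz).
rewrite -/b; lra.
Qed.

Lemma cost_curve_diff_le s t z :
  `|cost_curve X F s z - cost_curve X F t z| <= 2 * M.
Proof.
have h r : `|cost_curve X F r z| <= M.
  have [Kz|Kz] := pselect (dprodset X z); last by rewrite cost_curve0// normr0.
  by rewrite cost_curveE//; exact: (FM (s := [::])).
by rewrite (le_trans (ler_normB _ _))// mulr2n mulrDl mul1r lerD.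
Qed.

Context (g : 'I_N -> probability ('rV[R]_d * 'rV[R]_d)%type R).
Local Notation P := (prod_measure (plan_row g)).
Local Notation u := (@resample R N (d + d)).
Context (S : R -> 'M[R]_(N, d + d) -> R).
Hypothesis hS : forall t, potential P u (cost_curve X F t) (S t).

(** By the envelope principle, the variation of the potential does not
contribute to the derivative of the value at first order. *)
Definition value_speed t :=
  mean P (fun z => expR (S t z - cost_curve X F t z) * cost_speed t z).

Definition value_modulus := dimR * (M + expR (2 * M) * M ^+ 2) * mean P sq_displ.

(** The value at [s] lies between the two bounds of [potential_value_le] and
[potential_value_ge] around the linearised change of cost at [t]. The errors
are the Taylor remainder of the cost and the square of its increment, both at
most a multiple of the squared displacement; the mean of the latter under the
optimal coupling is the transport cost, by [mean_density_vsq]. *)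
Lemma value_quadratic s t :
  `|mean P (S s) - mean P (S t) - (s - t) * value_speed t| <=
  value_modulus * (s - t) ^+ 2.
Proof.
have uP := resampling_prod_measure (plan_row g).
have bc r : bmeas (cost_curve X F r) by apply: bmeas_cost_curve => //; exact: Ck_continuous CF.
have bS r : bmeas (S r) by case: (hS r).
pose p z := expR (S t z - cost_curve X F t z).
pose v z := cost_curve X F s z - cost_curve X F t z.
have bp : bmeas p by exact: bmeas_density.
have bv : bmeas v by exact: bmeasB.
have bV := bmeas_sq_displ.
have bpv : bmeas (fun z => p z * v z) by exact: bmeasM.
have bpV : bmeas (fun z => p z * sq_displ z) by exact: bmeasM.
have bpv2 : bmeas (fun z => p z * v z ^+ 2) by apply: bmeasM => //; exact: bmeasM.
have bsp := bmeas_cost_speed t.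
have bpc : bmeas (fun z => p z * cost_speed t z) by exact: bmeasM.
have p0 z : 0 <= p z by exact: expR_ge0.
have mpV : mean P (fun z => p z * sq_displ z) = mean P sq_displ.
  rewrite /sq_displ mean_sum; last by move=> i; exact: bmeas_vsq.
  under eq_fun do rewrite mulr_sumr.
  rewrite mean_sum; last by move=> i; apply: bmeasM => //; exact: bmeas_vsq.
  by apply: eq_bigr => i _; exact: mean_density_vsq.
have up := potential_value_le uP (bc t) (bc s) (hS t) (hS s).
have dn := potential_value_ge uP (bc t) (bc s) (hS t) (hS s) (cost_curve_diff_le s t).
rewrite -/p -/v in up dn.
have lin : `|mean P (fun z => p z * v z) - (s - t) * value_speed t| <=
    M * dimR * (s - t) ^+ 2 * mean P sq_displ.
  rewrite /value_speed -/p -meanZ// -meanB//; last exact: bmeasZ.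
  rewrite -mpV -meanZ//.
  apply: (le_trans (le_norm_mean _ _)); first by apply: bmeasB => //; exact: bmeasZ.
  apply: le_mean => [||z]; [by apply: bmeas_norm; apply: bmeasB => //; exact: bmeasZ|exact: bmeasZ|].
  have -> : p z * v z - (s - t) * (p z * cost_speed t z) = p z * (v z - (s - t) * cost_speed t z).
    by ring.
  rewrite normrM ger0_norm// mulrCA ler_wpM2l//; exact: cost_curve_taylor.
have quad : mean P (fun z => p z * v z ^+ 2) <=
    M ^+ 2 * dimR * (s - t) ^+ 2 * mean P sq_displ.
  rewrite -mpV -meanZ//; apply: le_mean => [//||z]; first exact: bmeasZ.
  rewrite [leRHS]mulrCA ler_wpM2l//; exact: cost_curve_sqr.
have quad' := ler_wpM2l (expR_ge0 (2 * M)) quad.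
have quad0 : 0 <= expR (2 * M) * (M ^+ 2 * dimR * (s - t) ^+ 2 * mean P sq_displ).
  apply: le_trans quad'; rewrite mulr_ge0 ?expR_ge0//.
  by apply: mean_ge0 => z; rewrite mulr_ge0 ?sqr_ge0.
move: lin up dn quad' quad0; rewrite !ler_norml /value_modulus.
set A := mean P (fun z => p z * v z); set E := expR (2 * M).
set V := mean P sq_displ; set Q := mean P (fun z => _ * _).
move=> /andP[l1 l2] up dn q q0.
have EQ : dimR * (M + E * M ^+ 2) * V * (s - t) ^+ 2 =
    M * dimR * (s - t) ^+ 2 * V + E * (M ^+ 2 * dimR * (s - t) ^+ 2 * V) by ring.
rewrite EQ; apply/andP; split; lra.
Qed.

Lemma value_is_derive t : is_derive t 1 (fun t => mean P (S t)) (value_speed t).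
Proof.
have W0 : 0 <= value_modulus.
  rewrite /value_modulus mulr_ge0//; last by apply: mean_ge0 => z; exact: sq_displ_ge0.
  by rewrite mulr_ge0// addr_ge0// mulr_ge0 ?sqr_ge0 ?expR_ge0.
apply: quotient_is_derive => eps e0.
have W1 : 0 < value_modulus + 1 by lra.
apply: filterS (near_dist_lt t (divr_gt0 e0 W1)) => s hs.
apply: (le_trans (value_quadratic s t)).
rewrite -real_normK ?num_real// expr2 mulrA ler_wpM2r//.
apply: (le_trans (ler_wpM2l W0 hs)).
by rewrite mulrA ler_pdivrMr// mulrC ler_pM2l//; lra.
Qed.

(** Adding the expansions from [s] to [t] and from [t] to [s] cancels the
values. *)
Lemma value_speed_lipschitz s t :
  `|value_speed s - value_speed t| <= 2 * value_modulus * `|s - t|.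
Proof.
have [->|st] := eqVneq s t; first by rewrite !subrr normr0 mulr0.
have st0 : 0 < `|s - t| by rewrite normr_gt0 subr_eq0.
rewrite -(ler_pM2r st0) -normrM.
have := value_quadratic s t; have := value_quadratic t s.
move: (mean P (S t)) (mean P (S s)) (value_speed s) (value_speed t) value_modulus => a b p q W h1 h2.
have -> : (p - q) * (s - t) = (a - b - (t - s) * p) + (b - a - (s - t) * q) by ring.
rewrite (le_trans (ler_normD _ _))//.
have -> : 2 * W * `|s - t| * `|s - t| = W * (t - s) ^+ 2 + W * (s - t) ^+ 2.
  by rewrite -mulrA -expr2 real_normK ?num_real//; ring.
exact: lerD.
Qed.

(** Expanding from [t] towards 0 and towards 1, the first order terms cancel
in the convex combination. *)
Lemma value_displacement t : 0 <= t <= 1 ->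
  `|mean P (S t) - ((1 - t) * mean P (S 0) + t * mean P (S 1))| <=
  value_modulus * (t * (1 - t)).
Proof.
move=> /andP[t0 t1].
have := value_quadratic 0 t; have := value_quadratic 1 t.
move: (mean P (S 0)) (mean P (S 1)) (mean P (S t)) (value_speed t) value_modulus => a b c p W h1 h0.
have t1' : 0 <= 1 - t by lra.
have -> : c - ((1 - t) * a + t * b) =
  - ((1 - t) * (a - c - (0 - t) * p) + t * (b - c - (1 - t) * p)).
  by ring.
rewrite normrN (le_trans (ler_normD _ _))// !normrM (ger0_norm t0) (ger0_norm t1').
have k0 := ler_wpM2l t1' h0; have k1 := ler_wpM2l t0 h1.
have E : W * (t * (1 - t)) =
  (1 - t) * (W * (0 - t) ^+ 2) + t * (W * (1 - t) ^+ 2) by ring.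
by rewrite E lerD.
Qed.

End cost_estimates.

(** * Optimal plans and displacement convexity *)

Section optimal_plans.
Context {R : realType} {d : nat}.
Implicit Types (mu nu : probability 'rV[R]_d R) (K : set 'rV[R]_d).

Lemma prob_on_coupling K mu nu (g : probability ('rV[R]_d * 'rV[R]_d)%type R) :
  measurable K -> prob_on K mu -> prob_on K nu -> coupling mu nu g ->
  prob_on (K `*` K) g.
Proof.
move=> mK muK nuK [g1 g2].
have m1 : measurable (fst @^-1` K : set ('rV[R]_d * 'rV[R]_d)).
  by rewrite -[X in measurable X]setTI; exact: measurable_fst.
have m2 : measurable (snd @^-1` K : set ('rV[R]_d * 'rV[R]_d)).
  by rewrite -[X in measurable X]setTI; exact: measurable_snd.
have h1 : g (fst @^-1` K) = 1%E by rewrite -muK -g1.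
have h2 : g (snd @^-1` K) = 1%E by rewrite -nuK -g2.
have n1 : g (~` (fst @^-1` K)) = 0%E by rewrite probability_setC// h1 subee.
have n2 : g (~` (snd @^-1` K)) = 0%E by rewrite probability_setC// h2 subee.
rewrite /prob_on -[K `*` K]setCK probability_setC; last by apply: measurableC; exact: measurableX.
rewrite (_ : ~` (K `*` K) = ~` (fst @^-1` K) `|` ~` (snd @^-1` K)).
  have n0 := etrans (measureU0 (measurableC m1) (measurableC m2) n2) n1.
  by rewrite [g _]n0 sube0.
by rewrite -setCI.
Qed.

Lemma W2_optimal mu nu (g : probability ('rV[R]_d * 'rV[R]_d)%type R) (a : R) :
  0 <= a -> optimal_plan mu nu g -> quad_cost g = a%:E -> W2 mu nu ^+ 2 = a.
Proof.
move=> a0 [cg og] ga; rewrite /W2.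
have -> : ereal_inf [set quad_cost g | g in coupling mu nu] = a%:E.
  apply/eqP; rewrite eq_le -ga; apply/andP; split.
    by apply: ge_ereal_inf; exists (quad_cost g) => //; exists g.
  by apply: le_ereal_inf_tmp => _ [g' cg' <-]; exact: og.
by rewrite sqr_sqrtr.
Qed.

End optimal_plans.

Section value_curve.
Context {R : realType} {N d : nat} (X : 'I_N -> set 'rV[R]_d).
Context (g : 'I_N -> probability ('rV[R]_d * 'rV[R]_d)%type R).
Hypothesis cX : forall i, compact (X i).
Hypothesis vX : forall i, convex_set (X i).
Hypothesis gX : forall i, prob_on (X i `*` X i) (g i).
Local Notation P := (prod_measure (plan_row g)).
Local Notation u := (@resample R N (d + d)).
Implicit Types F c : 'M[R]_(N, d) -> R.

Lemma plan_cost_mean : plan_cost g = (mean P (sq_displ X))%:E.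
Proof.
rewrite /plan_cost /sq_displ mean_sum; last by move=> i; exact: bmeas_vsq.
by rewrite -sumEFin; apply: eq_bigr => i _; exact: (quad_cost_plan cX gX).
Qed.

Lemma potential_family F : continuous F -> exists S : R -> 'M[R]_(N, d + d) -> R,
  (forall t, potential P u (cost_curve X F t) (S t)) /\
  (forall t C, (forall x, `|cost_curve X F t x| <= C) ->
     forall x, `|S t x| <= potential_bound (I := 'I_N) C).
Proof.
move=> cF; have uP := resampling_prod_measure (plan_row g).
have h t := cid (potential_exists_sharp uP (bmeas_cost_curve cX t cF)).
by exists (fun t => sval (h t)); split=> t; have [] := svalP (h t).
Qed.

Lemma eot_value_curve F c (S : R -> 'M[R]_(N, d + d) -> R) t : continuous F ->
  (forall x, prodset X x -> F x = c x) ->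
  (forall t, potential P u (cost_curve X F t) (S t)) -> 0 <= t <= 1 ->
  eot X c (mu_t g t) = (mean P (S t))%:E.
Proof. by move=> cF Fc hS t01; apply: (eot_transported cX vX gX t01 _ cF Fc (hS t)). Qed.

Lemma value_curve_smooth F k (S : R -> 'M[R]_(N, d + d) -> R) : Ck k F ->
  (forall t, potential P u (cost_curve X F t) (S t)) ->
  (forall t C, (forall x, `|cost_curve X F t x| <= C) ->
     forall x, `|S t x| <= potential_bound (I := 'I_N) C) ->
  Ck_line k (fun t => mean P (S t)).
Proof.
move=> CF hS bS; have uP := resampling_prod_measure (plan_row g).
exact: smooth_curve_mean (potential_curve uP (smooth_cost_curve cX CF) hS bS).
Qed.

End value_curve.

(** Twice the factor of the transport cost in [value_modulus], for the bound
[`|a| + 1] on the derivatives that [Ck_norm_attained] provides. The last 1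
keeps it positive in dimension 0. *)
Definition modulus {R : realType} (d N : nat) (a : R) : R :=
  2 * (N * d)%:R * (`|a| + 1 + expR (2 * (`|a| + 1)) * (`|a| + 1) ^+ 2) + 1.

Lemma modulus_gt0 {R : realType} d N (a : R) : 0 < modulus d N a.
Proof.
by rewrite /modulus ltr_wpDl// mulr_ge0 ?ler0n// addr_ge0// mulr_ge0 ?expR_ge0.
Qed.

Lemma value_modulus_le {R : realType} {N d : nat} (X : 'I_N -> set 'rV[R]_d)
    (g : 'I_N -> probability ('rV[R]_d * 'rV[R]_d)%type R) (a : R) :
  2 * value_modulus X (`|a| + 1) g <=
  modulus d N a * mean (prod_measure (plan_row g)) (sq_displ X).
Proof.
have V0 : 0 <= mean (prod_measure (plan_row g)) (sq_displ X).
  by apply: mean_ge0 => z; exact: sq_displ_ge0.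
rewrite /value_modulus /modulus /dimR; move: V0.
move: (mean _ _) (expR _) => V E V0.
rewrite [leRHS]mulrDl mul1r -[leLHS]addr0; apply: lerD => //.
by rewrite !mulrA.
Qed.

Section displacement_bounds.
Context {R : realType} {N d : nat} (X : 'I_N -> set 'rV[R]_d).
Context (c : 'M[R]_(N, d) -> R).
Hypothesis cX : forall i, compact (X i).
Hypothesis vX : forall i, convex_set (X i).
Hypothesis C2c : Ck_on 2 (prodset X) c.
Local Notation a := (Ck_norm 2 (prodset X) c).

Lemma value_curve_C2 (g : 'I_N -> probability ('rV[R]_d * 'rV[R]_d)%type R) :
  (forall i, prob_on (X i `*` X i) (g i)) ->
  exists f : R -> R, [/\ Ck_line 1 f,
    forall t mu, 0 <= t <= 1 -> transported g t mu -> eot X c mu = (f t)%:E,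
    forall s t, `|derive1 f s - derive1 f t| <=
      modulus d N a * fine (plan_cost g) * `|s - t| &
    forall t, 0 <= t <= 1 -> `|f t - ((1 - t) * f 0 + t * f 1)| <=
      modulus d N a / 2 * t * (1 - t) * fine (plan_cost g)].
Proof.
move=> gX; have [B B0 KB] := prodset_bounded cX.
have [F [CF Fc FM]] := Ck_norm_attained B0 KB C2c.
have cF : continuous F := Ck_continuous CF.
have [S [hS bS]] := potential_family g cX cF.
have W := @value_modulus_le R N d X g a.
have V := plan_cost_mean cX gX.
exists (fun t => mean (prod_measure (plan_row g)) (S t)); split.
- by apply: (value_curve_smooth cX _ hS bS); exact: Ck_le CF.
- by move=> t mu t01 tmu; exact: (eot_transported cX vX gX t01 tmu cF Fc (hS t)).
- move=> s t.
  have D r := @derive_val _ _ _ _ _ _ _ (value_is_derive cX CF FM hS r).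
  rewrite !derive1E !D V/=.
  apply: (le_trans (value_speed_lipschitz cX CF FM hS s t)).
  by rewrite ler_wpM2r.
- move=> t t01; apply: (le_trans (value_displacement cX CF FM hS t01)).
  have /andP[t0 t1] := t01.
  have h : 0 <= t * (1 - t) by rewrite mulr_ge0// subr_ge0.
  have := ler_wpM2r h W; rewrite V/=.
  by move: (value_modulus _ _ _) (mean _ _) (modulus _ _ _) => w v m; lra.
Qed.

(** The two halves of this absolute value are the displacement convexity of
the value and of its opposite. *)
Lemma eot_displacement_bound mu0 mu1 g t :
  (forall i, prob_on (X i) (mu0 i)) -> (forall i, prob_on (X i) (mu1 i)) ->
  (forall i, optimal_plan (mu0 i) (mu1 i) (g i)) -> 0 <= t <= 1 ->
  exists e0 e1 e : R, [/\ eot X c mu0 = e0%:E, eot X c mu1 = e1%:E,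
    eot X c (mu_t g t) = e%:E &
    `|e - ((1 - t) * e0 + t * e1)| <=
      modulus d N a / 2 * t * (1 - t) * W2N mu0 mu1 ^+ 2].
Proof.
move=> m0 m1 og t01.
have gX i : prob_on (X i `*` X i) (g i).
  by apply: (prob_on_coupling _ (m0 i) (m1 i)); [exact: compact_measurable_mx|case: (og i)].
have [f [_ fE _ fd]] := value_curve_C2 gX.
exists (f 0), (f 1), (f t); split.
(* At time 0 the interpolation is the first projection, at time 1 the second
one. *)
- apply: fE => [|i A mA]; first by rewrite lexx ler01.
  have [[h _] _] := og i; rewrite -h// /pushforward; congr (g i _).
  by apply/seteqP; split=> p; rewrite /= /interp subr0 scale1r scale0r addr0.
- apply: fE => [|i A mA]; first by rewrite lexx ler01.
  have [[_ h] _] := og i; rewrite -h// /pushforward; congr (g i _).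
  by apply/seteqP; split=> p; rewrite /= /interp subrr scale1r scale0r add0r.
- by apply: fE => // i A mA.
- apply: (le_trans (fd t t01)); rewrite le_eqVlt; apply/orP; left; apply/eqP.
  congr (_ * _); rewrite (plan_cost_mean cX gX)/= /W2N sqr_sqrtr; last first.
    by apply: sumr_ge0 => i _; exact: sqr_ge0.
  rewrite /sq_displ mean_sum; last by move=> i; exact: bmeas_vsq.
  apply: eq_bigr => i _; apply/esym.
  apply: (W2_optimal _ (og i)); last exact: quad_cost_plan.
  by apply: mean_ge0 => z; exact: vsq_ge0.
Qed.

End displacement_bounds.

Theorem theorem4p1 (R : realType) (d : nat) :
  exists C : nat -> R -> R, (forall N M, 0 < C N M) /\
  forall (N : nat) (X : 'I_N -> set 'rV[R]_d) (c : 'M[R]_(N, d) -> R),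
    (2 <= N)%N ->
    (forall i, compact (X i)) ->
    (forall i, convex_set (X i)) ->
    (forall (mu0 mu1 : 'I_N -> probability 'rV[R]_d R)
            (g : 'I_N -> probability ('rV[R]_d * 'rV[R]_d)%type R),
       (forall i, prob_on (X i) (mu0 i)) ->
       (forall i, prob_on (X i) (mu1 i)) ->
       (forall i, prob_on (X i `*` X i) (g i)) ->
       (forall i, coupling (mu0 i) (mu1 i) (g i)) ->
       (forall k : nat, (1 <= k)%N -> Ck_on (2 * k - 1) (prodset X) c ->
          exists f : R -> R, Ck_line k f /\
            forall t : R, 0 <= t <= 1 -> eot X c (mu_t g t) = (f t)%:E) /\
       (Ck_on 2 (prodset X) c ->
          exists f : R -> R, Ck_line 1 f /\
            (forall t : R, 0 <= t <= 1 -> eot X c (mu_t g t) = (f t)%:E) /\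
            forall s t : R, 0 <= s <= 1 -> 0 <= t <= 1 ->
              (`|derive1 f s - derive1 f t|%:E <=
                 (C N (Ck_norm 2 (prodset X) c))%:E * plan_cost g
                   * `|s - t|%:E)%E)) /\
    (Ck_on 2 (prodset X) c ->
       displacement_convex X (- C N (Ck_norm 2 (prodset X) c)) (eot X c) /\
       displacement_convex X (- C N (Ck_norm 2 (prodset X) c))
         (fun mu => (- eot X c mu)%E)).
Proof.
exists (modulus d); split; first exact: modulus_gt0.
move=> N X c _ cX vX; split.
  move=> _ _ g _ _ gX _; split.
    move=> k k1 [F [CF Fc]].
    have [S [hS bS]] := potential_family g cX (Ck_continuous CF).
    exists (fun t => mean (prod_measure (plan_row g)) (S t)); split.
      apply: (value_curve_smooth cX _ hS bS); apply: Ck_le CF.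
      by rewrite mul2n -addnn -addnBA// leq_addr.
    by move=> t; exact: eot_value_curve (Ck_continuous CF) Fc hS.
  move=> C2c; have [f [f1 fE fL _]] := value_curve_C2 cX vX C2c gX.
  exists f; split=> //; split=> [t t01|s t _ _]; first by apply: fE => // i A mA.
  rewrite (plan_cost_mean cX gX) -!EFinM lee_fin.
  by have := fL s t; rewrite (plan_cost_mean cX gX).
move=> C2c; split=> mu0 mu1 g m0 m1 og t t01;
  have [e0 [e1 [e [-> -> -> h]]]] := eot_displacement_bound cX vX C2c m0 m1 og t01;
  rewrite -?EFinN -!EFinM -!EFinD lee_fin;
  move: (modulus _ _ _) (W2N _ _ ^+ 2) h => m w; rewrite ler_norml => /andP[h1 h2]; lra.
Qed.
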